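(* Let $E/\mathbb{Q}$ be an elliptic curve given by $y^2=x^3+a_4x+a_6$ with $a_4,a_6\in\mathbb{Z}$, and suppose that $E(\mathbb{Q})$ has positive rank. If $P\in E(\mathbb{Q})$ is a point of infinite order, and $t$ is a positive integer for which $D=D(t):=4(t^3+a_4t-a_6)$ satisfies $$4(t+1)^2\exp(4\delta(E))<D<(t+1)^2t^2,$$ then $$\widehat{h}(P)\ \geq\ \frac{|E_{\mathrm{tor}}(\mathbb{Q})|^2}{\left(H(-D)+|E_{\mathrm{tor}}(\mathbb{Q})|\right)^2}\cdot T_E(-D,t).$$
   Context: $E_{\mathrm{tor}}(\mathbb{Q})$ denotes the torsion subgroup of $E(\mathbb{Q})$. Heights: each affine point $P\in E(\mathbb{Q})$ is written $P=\left(\frac{A}{C^2},\frac{B}{C^3}\right)$ with $A,B,C\in\mathbb{Z}$ and $\gcd(A,C)=\gcd(B,C)=1$. The naive height is $H(P):=\max(|A|,|C^2|)$, the logarithmic (Weil) height is $h_W(P):=\log H(P)$ (with $h_W=0$ at the identity), and the canonical height is $\widehat{h}(P):=\tfrac12\lim_{n\to\infty}\frac{h_W(nP)}{n^2}$. The non-negative real number $\delta(E)$ is $$\delta(E):=\max_{P\in E(\mathbb{Q})}\left(\tfrac12 h_W(P)-\widehat{h}(P)\right)$$ (the value $0$ is attained by the identity of $E(\mathbb{Q})$), and $$T_E(-D,t):=\log\left(\frac{D}{4(t+1)^2}\right)-4\delta(E).$$ $H(-D)$ is the Hurwitz-Kronecker class number: the number of $\mathrm{SL}_2(\mathbb{Z})$-classes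 of (not necessarily primitive) integral positive definite binary quadratic forms of discriminant $-D<0$, where each class $C$ is counted with multiplicity $1/|\mathrm{Aut}(C)|$ (automorphisms taken modulo $\pm1$). Explicitly, if $-D=-D_0f^2$ with $-D_0<0$ a fundamental discriminant, then $$H(-D)=\frac{h(-D_0)}{\omega(-D_0)}\sum_{d\mid f}\mu(d)\chi_{-D_0}(d)\sigma_1(f/d),$$ where $h(-D_0)$ is the class number of $\mathbb{Q}(\sqrt{-D_0})$, $\omega(-D_0)$ is half the number of units in (the ring of integers of) $\mathbb{Q}(\sqrt{-D_0})$, $\mu$ is the Möbius function, $\chi_{-D_0}=\left(\frac{-D_0}{\cdot}\right)$ is the Kronecker character, and $\sigma_1(n)$ is the sum of the positive divisors of $n$. *)

(* Defs.v *)
From mathcomp Require Import all_boot all_order all_algebra finmap.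
From mathcomp Require Import all_classical all_reals all_analysis.
From mathcomp Require Import ring lra zify.

Set Implicit Arguments.
Unset Strict Implicit.
Unset Printing Implicit Defensive.

Import Order.TTheory GRing.Theory Num.Theory.
Import numFieldNormedType.Exports.
Local Open Scope classical_set_scope.
Local Open Scope ring_scope.

Definition elliptic (a4 a6 : int) : bool := 4 * a4 ^+ 3 + 27 * a6 ^+ 2 != 0.

(* [None] is the point at infinity. *)
Definition on_curve (a4 a6 : int) (p : option (rat * rat)) : bool :=
  if p is Some (x, y) then y ^+ 2 == x ^+ 3 + a4%:~R * x + a6%:~R else true.

Definition Eopp_raw (p : option (rat * rat)) : option (rat * rat) :=
  if p is Some (x, y) then Some (x, - y) else None.

Definition Eadd_raw (a4 : int) (p q : option (rat * rat)) :
    option (rat * rat) :=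
  match p, q with
  | None, _ => q
  | _, None => p
  | Some (x1, y1), Some (x2, y2) =>
    if (x1 == x2) && (y1 == - y2) then None else
    let l := if x1 == x2 then (3 * x1 ^+ 2 + a4%:~R) / (2 * y1)
             else (y2 - y1) / (x2 - x1) in
    let x3 := l ^+ 2 - x1 - x2 in
    Some (x3, l * (x1 - x3) - y1)
  end.

Lemma on_curve_opp (a4 a6 : int) p :
  on_curve a4 a6 p -> on_curve a4 a6 (Eopp_raw p).
Proof. by case: p => [[x y]|] //=; rewrite sqrrN. Qed.

Lemma on_curve_add (a4 a6 : int) p q :
  on_curve a4 a6 p -> on_curve a4 a6 q -> on_curve a4 a6 (Eadd_raw a4 p q).
Proof.
case: p => [[x1 y1]|] //; case: q => [[x2 y2]|] // /eqP h1 /eqP h2.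
rewrite /Eadd_raw; case: ifPn => // hO; rewrite /on_curve; apply/eqP.
move: (a4%:~R) (a6%:~R) h1 h2 => a b h1 h2.
case: (eqVneq x1 x2) hO => [e|ne] /=.
  subst x2 => hO.
  have hy : (y1 - y2) * (y1 + y2) = 0.
    by transitivity (y1 ^+ 2 - y2 ^+ 2); [ring | rewrite h1 h2; ring].
  have hs : y1 + y2 != 0 by rewrite addr_eq0.
  move/eqP: hy; rewrite mulf_eq0 (negbTE hs) orbF subr_eq0 => /eqP ey.
  have y0 : y1 != 0 by apply: contraNneq hs => y0; rewrite -ey y0 addr0.
  have -> : b = y1 ^+ 2 - x1 ^+ 3 - a * x1 by rewrite h1; ring.
  by field.
move=> _.
have d0 : x2 - x1 != 0 by rewrite subr_eq0 eq_sym.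
have ha : a = (y2 ^+ 2 - y1 ^+ 2 - (x2 ^+ 3 - x1 ^+ 3)) / (x2 - x1).
  by rewrite h1 h2; field.
have -> : b = y1 ^+ 2 - x1 ^+ 3 - a * x1 by rewrite h1; ring.
by rewrite ha; field.
Qed.

Definition Ept (a4 a6 : int) := {p : option (rat * rat) | on_curve a4 a6 p}.

Section EllipticCurve.
Variables a4 a6 : int.
Implicit Types P Q : Ept a4 a6.

Definition Ezero : Ept a4 a6 := Sub None isT.

Definition Eopp P : Ept a4 a6 := Sub _ (on_curve_opp (valP P)).

Definition Eadd P Q : Ept a4 a6 := Sub _ (on_curve_add (valP P) (valP Q)).

Definition Emul (n : nat) P : Ept a4 a6 := iter n (Eadd P) Ezero.

Definition Emulz (k : int) P : Ept a4 a6 :=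
  match k with Posz n => Emul n P | Negz n => Eopp (Emul n.+1 P) end.

Definition Etor : set (Ept a4 a6) :=
  [set P | exists n : nat, (0 < n)%N /\ Emul n P = Ezero].

Definition infinite_order P : Prop :=
  forall n : nat, (0 < n)%N -> Emul n P <> Ezero.

Definition independent (r : nat) (P : 'I_r -> Ept a4 a6) : Prop :=
  forall k : 'I_r -> int,
    \big[Eadd/Ezero]_(i < r) Emulz (k i) (P i) = Ezero -> forall i, k i = 0.

Definition rank_ge (r : nat) : Prop :=
  exists P : 'I_r -> Ept a4 a6, independent P.

(* The x-coordinate A / C ^ 2 is in lowest terms, so A and C ^ 2 are its
   numerator and denominator: see [naive_heightP] and [naive_heightE]. *)
Definition naive_height P : int :=
  if val P is Some (x, _) then Num.max `|numq x| (denq x) else 1.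

Lemma naive_heightE P (A B C : int) :
    C != 0 -> coprimez A C ->
    val P = Some (A%:~R / C%:~R ^+ 2, B%:~R / C%:~R ^+ 3) ->
  naive_height P = Num.max `|A| `|C ^+ 2|.
Proof.
move=> C0 cAC; rewrite /naive_height => ->.
have c2 : coprime `|A| `|C ^+ 2| by rewrite abszX coprimeXr.
have C2 : 0 < C ^+ 2 by rewrite exprn_even_gt0 //= C0 orbT.
rewrite -rmorphXn /= coprimeq_num // coprimeq_den //.
by rewrite gtr0_sg // mul1r gt_eqF.
Qed.

Lemma naive_heightP P (x y : rat) : val P = Some (x, y) ->
  exists A B C : int, [/\ C != 0, coprimez A C, coprimez B C,
    x = A%:~R / C%:~R ^+ 2 & y = B%:~R / C%:~R ^+ 3].
Proof.
move=> eP; have := valP P; rewrite eP /= => /eqP h.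
set d := denq x; set e := denq y; set m := numq x; set k := numq y.
have d0 : d%:~R != 0 :> rat by rewrite intr_eq0 denq_neq0.
have e0 : e%:~R != 0 :> rat by rewrite intr_eq0 denq_neq0.
pose w := m ^+ 3 + a4 * m * d ^+ 2 + a6 * d ^+ 3.
have hw : y ^+ 2 = w%:~R / (d ^+ 3)%:~R.
  rewrite h /w -{1 2}(divq_num_den x) -/d -/m.
  by rewrite !(rmorphD, rmorphM, rmorphXn) /=; field.
have hk : y ^+ 2 = (k ^+ 2)%:~R / (e ^+ 2)%:~R.
  by rewrite -{1}(divq_num_den y) !rmorphXn /= expr_div_n.
have cmd : coprimez m d by rewrite /coprimez /gcdz; have := coprime_num_den x.
have cke : coprimez k e by rewrite /coprimez /gcdz; have := coprime_num_den y.
have cwd : coprime `|w| `|d ^+ 3|.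
  rewrite abszX coprimeXr //.
  have -> : w = m ^+ 3 + (a4 * m * d + a6 * d ^+ 2) * d by rewrite /w; ring.
  rewrite -[coprime _ _]/(coprimez _ _) /coprimez addrC gcdzC gcdzMDl gcdzC.
  exact: coprimezXl.
have cke2 : coprime `|k ^+ 2| `|e ^+ 2|.
  by rewrite !abszX coprimeXl // coprimeXr.
have dp : 0 < d by exact: denq_gt0.
have ep : 0 < e by exact: denq_gt0.
have E : d ^+ 3 = e ^+ 2.
  have := coprimeq_den cwd; have := coprimeq_den cke2.
  rewrite -hw -hk => ->; rewrite !expf_eq0 /= !gt_eqF //.
  by rewrite !gtr0_norm ?exprn_gt0.
have de : (d %| e)%Z.
  by rewrite dvdzE -(@dvdn_pexp2r _ _ 2) // -!abszX -dvdzE -E exprS dvdz_mull.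
have /dvdzP[C eC] := de.
have Cp : 0 < C by move: ep; rewrite eC pmulr_lgt0.
have eC2 : d = C ^+ 2.
  apply: (@mulIf _ (d ^+ 2)); first by rewrite expf_neq0 // gt_eqF.
  by rewrite -exprS E eC exprMn.
have eC3 : e = C ^+ 3 by rewrite eC eC2 [in RHS]exprSr mulrC.
exists m, k, C; split.
- by rewrite gt_eqF.
- by move: cmd; rewrite eC2 coprimez_pexpr.
- by move: cke; rewrite eC3 coprimez_pexpr.
- by rewrite -(divq_num_den x) -/d -/m eC2 rmorphXn.
- by rewrite -(divq_num_den y) -/e -/k eC3 rmorphXn.
Qed.

Variable R : realType.

Definition weil_height P : R := ln (naive_height P)%:~R.

Definition canonical_height P : R :=
  2^-1 * lim (weil_height (Emul n P) / n%:R ^+ 2 @[n --> \oo]).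

(* The supremum, which is the maximum whenever the latter is attained. *)
Definition delta : R :=
  sup (range (fun P => 2^-1 * weil_height P - canonical_height P)).

Definition Ediscr (t : int) : int := 4 * (t ^+ 3 + a4 * t - a6).

Definition TE (D t : int) : R :=
  ln (D%:~R / (4 * (t%:~R + 1) ^+ 2)) - 4 * delta.

Definition card_tor : nat := #|` fset_set Etor|.

End EllipticCurve.

(* (a, b, c) stands for a X ^ 2 + b X Y + c Y ^ 2. *)
Definition bqf : Type := (int * int * int)%type.

Definition bqf_eval (f : bqf) (x y : int) : int :=
  let: (a, b, c) := f in a * x ^+ 2 + b * x * y + c * y ^+ 2.

Definition bqf_disc (f : bqf) : int :=
  let: (a, b, c) := f in b ^+ 2 - 4 * a * c.

Definition bqf_posdef (f : bqf) : Prop :=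
  forall x y : int, (x, y) != (0, 0) -> 0 < bqf_eval f x y.

Definition bqf_act (f : bqf) (M : 'M[int]_2) : bqf :=
  let: (a, b, c) := f in
  let p := M 0 0 in let q := M 0 1 in let r := M 1 0 in let s := M 1 1 in
  (a * p ^+ 2 + b * p * r + c * r ^+ 2,
   2 * a * p * q + b * (p * s + q * r) + 2 * c * r * s,
   a * q ^+ 2 + b * q * s + c * s ^+ 2).

Lemma bqf_actE (f : bqf) (M : 'M[int]_2) (x y : int) :
  bqf_eval (bqf_act f M) x y =
  bqf_eval f (M 0 0 * x + M 0 1 * y) (M 1 0 * x + M 1 1 * y).
Proof. by case: f => [[a b] c] /=; ring. Qed.

Definition SL2Z : set 'M[int]_2 := [set M | \det M = 1].

Definition bqf_class (f : bqf) : set bqf := bqf_act f @` SL2Z.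

Definition bqf_classes (D : int) : set (set bqf) :=
  bqf_class @` [set f | bqf_posdef f /\ bqf_disc f = D].

(* Automorphisms modulo the sign: M is identified with the pair {M, - M}. *)
Definition bqf_aut (f : bqf) : set (set 'M[int]_2) :=
  [set [set M; - M] | M in [set M | SL2Z M /\ bqf_act f M = f]].

(* Equivalent forms have conjugate automorphism groups, so the choice of a
   representative of the class does not matter. *)
Definition bqf_class_aut (C : set bqf) : nat :=
  #|` fset_set (bqf_aut (xget (0, 0, 0) C))|.

Definition hurwitz (R : realType) (D : int) : R :=
  \sum_(C \in bqf_classes D) ((bqf_class_aut C)%:R^-1 : R).

(* Main.v *)
(* Write -D = -4m. A point V = (A/C^2, B/C^3) with (t+1)^2 H(V)^2 < m gives the
   form (alpha, 2b, (m+b^2)/alpha), where alpha = A + t C^2 and b C^3 = B modulo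
   alpha. Since alpha^2 < m, such a form determines alpha, hence V up to sign, and
   b modulo alpha; it is the only form of its class with so small a first
   coefficient, and it has no automorphism but the identity up to sign. Its class
   therefore determines V, except that V and -V collide when alpha divides 2B.
   One point of each such pair is sent instead to another form: a second form
   with the same alpha, the forms of first coefficient alpha/2 or 2 alpha, the dual
   ones coming from the factorization m = alpha gamma, or a reduced form
   with larger first coefficient. That the modified map is injective comes down to excluding
   alpha(W) = 2 alpha(V) and m = 2 alpha(V) alpha(W) for suitable V and W; this
   follows from the chord through V and W, which bounds H(V+W) from below, and
   from the product formula for x(V+W) and x(V-W).

   If the height of P were below the bound, then the points nP + T with T torsion
   and |n| <= N would all have small height, for an N such that their number
   (2N+1)|E_tor| exceeds H(-D). *)

Require Import Defs.
From HB Require Import structures.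
From mathcomp Require Import all_boot all_order all_algebra finmap.
From mathcomp Require Import all_classical all_reals all_analysis.
From mathcomp Require Import ring lra zify.

Set Implicit Arguments.
Unset Strict Implicit.
Unset Printing Implicit Defensive.

Import Order.TTheory GRing.Theory Num.Theory.
Local Open Scope ring_scope.

(** * The group law *)

(** The cubic takes the value - m at - t, and [alpha] is the numerator of x + t; hence [alpha]
    divides B^2 + m C^6, so - m is a square modulo [alpha] and the form exists. From [alpha] <= (t +
    1) H, smallness gives alpha^2 < m; and 4 (h + delta) < log (m / (t + 1)^2), with h the canonical
    height, gives smallness: hence T_E. With x = H(-D) / |E_tor| and N the integer part of (x + 1) /
    2, the points nP + T have height at most ((x + 1) / 2)^2 h(P), while 2 N + 1 > x: hence the
    square in the bound. The obstacle is that the count leaves no room: every point needs a class of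
    its own, of weight 1 in the class number, and the set of points is stable under negation, so
    each coincidence of V with - V has to be repaired. A replacement form may hit the form of an
    unrelated point W. Against this, of two indices in [- N, N] the sum or the difference is again
    in [- N, N], so V + W or V - W is small too, and the parallelogram law bounds the product of the
    heights of both. *)

Section GroupLaw.
Variables a4 a6 : int.
Local Notation a := (a4%:~R : rat).
Local Notation b := (a6%:~R : rat).
Implicit Types (x y l : rat) (p q r : option (rat * rat)).

(** Chord and tangent in one: for distinct abscissas the first equation determines [l], for a
    doubled point the second one does. The group laws become polynomial identities in [l], without a
    case distinction. *)
Definition is_slope x1 y1 x2 y2 l :=
  l * (x2 - x1) = y2 - y1 /\ l * (y1 + y2) = x1 ^+ 2 + x1 * x2 + x2 ^+ 2 + a.

Lemma slope_add x1 y1 x2 y2 l : is_slope x1 y1 x2 y2 l ->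
    ~~ ((x1 == x2) && (y1 == - y2)) ->
  Eadd_raw a4 (Some (x1, y1)) (Some (x2, y2)) =
  Some (l ^+ 2 - x1 - x2, l * (x1 - (l ^+ 2 - x1 - x2)) - y1).
Proof.
move=> [h1 h2] hO; rewrite /Eadd_raw (negbTE hO).
suff -> : (if x1 == x2 then (3 * x1 ^+ 2 + a) / (2 * y1)
           else (y2 - y1) / (x2 - x1)) = l by [].
case: (eqVneq x1 x2) hO => [e|ne] /= hO.
  subst x2; have ey : y2 = y1.
    by apply/eqP; rewrite -subr_eq0 -h1 subrr mulr0.
  subst y2; have y0 : y1 != 0.
    by apply: contraNneq hO => ->; rewrite oppr0.
  have -> : 3 * x1 ^+ 2 + a = l * (y1 + y1) by rewrite h2; ring.
  by field.
by rewrite -h1 mulfK // subr_eq0 eq_sym.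
Qed.

Lemma slope_ex x1 y1 x2 y2 :
    on_curve a4 a6 (Some (x1, y1)) -> on_curve a4 a6 (Some (x2, y2)) ->
    ~~ ((x1 == x2) && (y1 == - y2)) ->
  exists l, is_slope x1 y1 x2 y2 l.
Proof.
move=> /eqP h1 /eqP h2 hO.
have hy : (y2 - y1) * (y1 + y2) =
          (x2 - x1) * (x1 ^+ 2 + x1 * x2 + x2 ^+ 2 + a).
  by transitivity (y2 ^+ 2 - y1 ^+ 2); [ring | rewrite h1 h2; ring].
case: (eqVneq x1 x2) hO => [e|ne] /= hO.
  subst x2; have s0 : y1 + y2 != 0 by rewrite addr_eq0.
  exists ((x1 ^+ 2 + x1 * x1 + x1 ^+ 2 + a) / (y1 + y2)).
  split; last by rewrite mulfVK.
  move/eqP: hy; rewrite subrr mul0r mulf_eq0 (negbTE s0) orbF => /eqP ->.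
  by rewrite mulr0.
have d0 : x2 - x1 != 0 by rewrite subr_eq0 eq_sym.
exists ((y2 - y1) / (x2 - x1)); split; first by rewrite mulfVK.
by rewrite mulrAC hy mulrAC mulfV // mul1r.
Qed.

Lemma Eadd_rawC p q :
  on_curve a4 a6 p -> on_curve a4 a6 q -> Eadd_raw a4 p q = Eadd_raw a4 q p.
Proof.
case: p => [[x1 y1]|]; case: q => [[x2 y2]|] // hp hq.
case: (boolP ((x1 == x2) && (y1 == - y2))) => hO.
  rewrite /Eadd_raw hO; case/andP: hO => /eqP -> /eqP ->.
  by rewrite opprK !eqxx.
have [l hl] := slope_ex hp hq hO.
have hl' : is_slope x2 y2 x1 y1 l.
  case: hl => h1 h2; split.
    by rewrite -(opprB y2) -h1; ring.
  by rewrite addrC h2; ring.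
have hO' : ~~ ((x2 == x1) && (y2 == - y1)).
  apply: contra hO => /andP[/eqP -> /eqP ->]; by rewrite opprK !eqxx.
rewrite (slope_add hl hO) (slope_add hl' hO').
case: hl => h1 _; congr (Some (_, _)); first by ring.
have -> : y2 = y1 + l * (x2 - x1) by rewrite h1; ring.
by ring.
Qed.

Hypothesis hE : elliptic a4 a6.

Lemma smooth x y : y = 0 -> y ^+ 2 = x ^+ 3 + a * x + b ->
  3 * x ^+ 2 + a != 0.
Proof.
move=> -> h; apply: contraTneq hE => h0; rewrite /elliptic negbK.
rewrite -(intr_eq0 rat) !(rmorphD, rmorphM, rmorphXn) /=.
have -> : b = - x ^+ 3 - a * x by rewrite expr0n /= in h; lra.
have -> : a = - 3 * x ^+ 2 by lra.
by apply/eqP; ring.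
Qed.

Lemma Eadd_rawK p q : on_curve a4 a6 p -> on_curve a4 a6 q ->
  Eadd_raw a4 (Eadd_raw a4 p q) (Eopp_raw q) = p.
Proof.
case: p => [[x1 y1]|]; case: q => [[x2 y2]|] // hp hq; last first.
  by rewrite /= eqxx opprK eqxx.
case: (boolP ((x1 == x2) && (y1 == - y2))) => hO.
  have -> : Eadd_raw a4 (Some (x1, y1)) (Some (x2, y2)) = None.
    by rewrite /Eadd_raw hO.
  by case/andP: hO => /eqP -> /eqP ->.
have [l hl] := slope_ex hp hq hO; rewrite (slope_add hl hO).
set x3 := _ - x2; set y3 := _ - y1.
have hs : is_slope x3 y3 x2 (- y2) (- l).
  case: hl => h1 h2; split.
    have -> : y2 = y1 + l * (x2 - x1) by rewrite h1; ring.
    by rewrite /y3 /x3; ring.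
  have ey2 : y2 = y1 + l * (x2 - x1) by rewrite h1; ring.
  have -> : a = l * (y1 + y2) - (x1 ^+ 2 + x1 * x2 + x2 ^+ 2) by rewrite h2; ring.
  by rewrite ey2 /y3 /x3; ring.
(* If p + q = q, then q has y = 0 and the line meets the curve doubly there, so that x2 is a double
   root of the cubic. *)
have hO' : ~~ ((x3 == x2) && (y3 == - - y2)).
  apply/negP => /andP[/eqP ex /eqP ey].
  case: hl => h1 h2.
  have ey2 : y2 = y1 + l * (x2 - x1) by rewrite h1; ring.
  have y0 : y2 = 0.
    have : y2 + y3 = l * (x2 - x3) by rewrite ey2 /y3 -/x3; ring.
    by rewrite ex subrr mulr0 ey opprK; lra.
  have := smooth y0 (eqP hq).
  have hx : x1 = l ^+ 2 - 2 * x2 by move: ex; rewrite /x3; lra.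
  have -> : a = l * (y1 + y2) - (x1 ^+ 2 + x1 * x2 + x2 ^+ 2) by rewrite h2; ring.
  have -> : y1 = - l * (x2 - x1) by move: ey2; rewrite y0; lra.
  by rewrite y0 hx; apply/negP; rewrite negbK; apply/eqP; ring.
rewrite /Eopp_raw (slope_add hs hO').
case: hl => h1 _.
congr (Some (_, _)); first by rewrite /x3; ring.
by rewrite /y3 /x3; ring.
Qed.

(** Subtracting the two expressions for [a] leaves an equation linear in [y1] with coefficient 2 (m
    - l). So everything is rational in x1, x2, x3, l, m, and the generic case of associativity is an
    identity in five free variables. Exchanging the outer points exchanges [l] and [m], which gives
    the slope for the other bracketing. *)
Lemma slopes_assoc x1 y1 x2 y2 x3 y3 l m :
    is_slope x1 y1 x2 y2 l -> is_slope x2 y2 x3 y3 m -> l != m ->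
    let x4 := l ^+ 2 - x1 - x2 in let y4 := l * (x1 - x4) - y1 in
    is_slope x4 y4 x3 y3 ((x3 - x1) / (m - l) - l).
Proof.
move=> [h1 h2] [h3 h4] lm x4 y4.
have d0 : m - l != 0 by rewrite subr_eq0 eq_sym.
have ey2 : y2 = y1 + l * (x2 - x1) by rewrite h1; ring.
have ey3 : y3 = y1 + l * (x2 - x1) + m * (x3 - x2) by rewrite h1 h3; ring.
have ea : a = l * (y1 + y2) - (x1 ^+ 2 + x1 * x2 + x2 ^+ 2) by rewrite h2; ring.
have ey1 : y1 = ((x3 - x1) * (x1 + x2 + x3) + l ^+ 2 * (x2 - x1)
                 - 2 * m * l * (x2 - x1) - m ^+ 2 * (x3 - x2)) / (2 * (m - l)).
  have : (m - l) * (2 * y1) = (x3 - x1) * (x1 + x2 + x3) + l ^+ 2 * (x2 - x1)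
                 - 2 * m * l * (x2 - x1) - m ^+ 2 * (x3 - x2).
    move: h4; rewrite ea ey3 ey2 => h4; apply/eqP; rewrite -subr_eq0; apply/eqP.
    by move/eqP: h4; rewrite -subr_eq0 => /eqP <-; ring.
  by move=> <-; field.
split.
  by rewrite ey3 /y4 /x4 ey1; field.
by rewrite ea ey3 ey2 /y4 /x4 ey1; field.
Qed.

Lemma Eopp_rawK p : Eopp_raw (Eopp_raw p) = p.
Proof. by case: p => [[x y]|] //=; rewrite opprK. Qed.

Lemma Eadd_raw_eq0 p q : Eadd_raw a4 p q = None -> p = Eopp_raw q.
Proof.
case: p => [[u v]|]; case: q => [[u' v']|] //=.
by case: ifP => // /andP[/eqP -> /eqP ->].
Qed.

Lemma Eadd_rawN p : Eadd_raw a4 p (Eopp_raw p) = None.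
Proof. by case: p => [[u v]|] //=; rewrite opprK !eqxx. Qed.

Lemma Eadd_raw0 p : Eadd_raw a4 p None = p.
Proof. by case: p => [[u v]|]. Qed.

Lemma Eadd_raw_sum0 p q r :
    on_curve a4 a6 p -> on_curve a4 a6 q -> on_curve a4 a6 r ->
    Eadd_raw a4 (Eadd_raw a4 p q) r = None ->
  Eadd_raw a4 q r = Eopp_raw p.
Proof.
move=> hp hq hr /Eadd_raw_eq0 e.
have := Eadd_rawK hq hp; rewrite (Eadd_rawC hq hp) e => <-.
rewrite (@Eadd_rawC (Eopp_raw r)) ?on_curve_opp //.
by rewrite -{2}(Eopp_rawK r) Eadd_rawK ?on_curve_opp.
Qed.

Lemma Eadd_rawA p q r :
    on_curve a4 a6 p -> on_curve a4 a6 q -> on_curve a4 a6 r ->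
  Eadd_raw a4 p (Eadd_raw a4 q r) = Eadd_raw a4 (Eadd_raw a4 p q) r.
Proof.
move=> hp hq hr; have hpq := on_curve_add hp hq; have hqr := on_curve_add hq hr.
case: (eqVneq (Eadd_raw a4 (Eadd_raw a4 p q) r) None) => [e0|n0].
  by rewrite e0 (Eadd_raw_sum0 hp hq hr e0) Eadd_rawN.
case: (eqVneq (Eadd_raw a4 p (Eadd_raw a4 q r)) None) => [e0|n0'].
  have e1 : Eadd_raw a4 (Eadd_raw a4 r q) p = None.
    by rewrite (Eadd_rawC hr) // (Eadd_rawC _ hp).
  rewrite (Eadd_rawC hp hq) (Eadd_raw_sum0 hr hq hp e1) e0.
  by rewrite (Eadd_rawC _ hr) ?on_curve_opp // Eadd_rawN.
case: (eqVneq (Eadd_raw a4 p q) None) => [e|npq].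
  rewrite e (Eadd_raw_eq0 e) (Eadd_rawC hq hr) Eadd_rawC ?on_curve_opp //.
    by rewrite Eadd_rawK.
  exact: on_curve_add.
case: (eqVneq (Eadd_raw a4 q r) None) => [e|nqr].
  rewrite e Eadd_raw0 -{1}(@Eadd_rawK p q) // -(_ : Eopp_raw q = r) //.
  by rewrite (Eadd_raw_eq0 e) Eopp_rawK.
case: (eqVneq p r) => [<-|npr].
  by rewrite (Eadd_rawC hq hp) (Eadd_rawC hp).
case: p hp hpq n0 n0' npq npr => [[x1 y1]|] //.
case: q hq hqr nqr => [[x2 y2]|] //.
case: r hr => [[x3 y3]|]; last by move=> *; rewrite !Eadd_raw0.
move=> hr hq hqr nqr hp hpq n0 n0' npq npr.
have [h12 h23] : ~~ ((x1 == x2) && (y1 == - y2)) /\ ~~ ((x2 == x3) && (y2 == - y3)).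
  by split; [move: npq | move: nqr]; rewrite /Eadd_raw; case: ifP; rewrite ?eqxx.
have [l hl] := slope_ex hp hq h12; have [m hm] := slope_ex hq hr h23.
move: n0 n0'; rewrite (slope_add hl h12) (slope_add hm h23).
set x4 := l ^+ 2 - x1 - x2; set y4 := l * (x1 - x4) - y1.
set x5 := m ^+ 2 - x2 - x3; set y5 := m * (x2 - x5) - y2 => n4 n5.
have h43 : ~~ ((x4 == x3) && (y4 == - y3)).
  by move: n4; rewrite /Eadd_raw; case: ifP; rewrite ?eqxx.
have h15 : ~~ ((x1 == x5) && (y1 == - y5)).
  by move: n5; rewrite /Eadd_raw; case: ifP; rewrite ?eqxx.
have [h1 h2] := hl; have [h3 h4] := hm.
have ey2 : y2 = y1 + l * (x2 - x1) by rewrite h1; ring.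
have ey3 : y3 = y1 + l * (x2 - x1) + m * (x3 - x2) by rewrite h1 h3; ring.
(* Equal slopes put the three points on one line. Then [x3] is [x1] or [x4], which means p = r or (p
   + q) + r = 0, both already excluded. *)
case: (eqVneq l m) => [e|lm].
  have : (x3 - x1) * (x3 - x4) = 0.
    rewrite /x4.
    have -> : (x3 - x1) * (x3 - (l ^+ 2 - x1 - x2)) =
      m * (y2 + y3) - l * (y1 + y2) - l ^+ 2 * (x3 - x1) by rewrite h2 h4; ring.
    by rewrite -e ey3 ey2 -e; ring.
  move/eqP; rewrite mulf_eq0 !subr_eq0 => /orP[]/eqP e3.
    case/eqP: npr; congr (Some (_, _)) => //.
    by rewrite ey3 e3 e; ring.
  by case/negP: h43; rewrite -e3 eqxx /= ey3 /y4 -e3 -e; apply/eqP; ring.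
have d0 : m - l != 0 by rewrite subr_eq0 eq_sym.
have s43 := slopes_assoc hl hm lm.
have s15 : is_slope x1 y1 x5 y5 ((x3 - x1) / (m - l) - m).
  have swap u v u' v' k : is_slope u v u' v' k -> is_slope u' v' u v k.
    move=> [g1 g2]; split; first by rewrite -(opprB v') -g1; ring.
    by rewrite addrC g2; ring.
  have ml : m != l by rewrite eq_sym.
  have /swap := slopes_assoc (swap _ _ _ _ _ hm) (swap _ _ _ _ _ hl) ml.
  rewrite /= -[x1 - x3]opprB -[l - m]opprB invrN mulrNN.
  have -> : m ^+ 2 - x3 - x2 = x5 by rewrite /x5; ring.
  by have -> : m * (x3 - x5) - y3 = y5 by rewrite /y5 ey3 ey2; ring.
rewrite (slope_add s15 h15) (slope_add s43 h43).
have ex : ((x3 - x1) / (m - l) - l) ^+ 2 - x4 - x3 =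
  ((x3 - x1) / (m - l) - m) ^+ 2 - x1 - x5.
  by rewrite /x4 /x5; field.
have ey4 : y4 = y3 - ((x3 - x1) / (m - l) - l) * (x3 - x4).
  by case: s43 => ->; rewrite subKr.
by rewrite ex; congr (Some (_, _)); rewrite -/x4 -/y4 ey4 ey3 /x4 /x5; field.
Qed.

End GroupLaw.

(** The proof of nonsingularity is a phantom parameter: the group structure depends on it, while
    [Ept] does not mention it. *)
Definition EC (a4 a6 : int) (hE : elliptic a4 a6) : Type := Ept a4 a6.

Section EllipticGroup.
Variables (a4 a6 : int) (hE : elliptic a4 a6).
Implicit Types P Q T : EC hE.

HB.instance Definition _ := Choice.copy (EC hE) {p | on_curve a4 a6 p}.

Lemma Eadd_assoc : associative (@Eadd a4 a6 : EC hE -> EC hE -> EC hE).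
Proof. by move=> P Q T; apply/val_inj; apply: (Eadd_rawA hE); apply: valP. Qed.

Lemma Eadd_comm : commutative (@Eadd a4 a6 : EC hE -> EC hE -> EC hE).
Proof. by move=> P Q; apply/val_inj; apply: Eadd_rawC; apply: valP. Qed.

Lemma Eadd_zero : left_id (Ezero a4 a6 : EC hE) (@Eadd a4 a6 : EC hE -> EC hE -> EC hE).
Proof. by move=> P; apply/val_inj. Qed.

Lemma Eadd_opp : left_inverse (Ezero a4 a6 : EC hE) (@Eopp a4 a6 : EC hE -> EC hE)
  (@Eadd a4 a6 : EC hE -> EC hE -> EC hE).
Proof.
by move=> P; rewrite Eadd_comm; apply/val_inj; apply: Eadd_rawN.
Qed.

HB.instance Definition _ :=
  GRing.isZmodule.Build (EC hE) Eadd_assoc Eadd_comm Eadd_zero Eadd_opp.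

Lemma EmulE n (P : EC hE) : Emul n P = P *+ n.
Proof. by elim: n => [|n IH] //; rewrite mulrS /Emul /= -/(Emul n P) IH. Qed.

Lemma val_EN P : val (- P : EC hE) = Eopp_raw (val P).
Proof. by []. Qed.

Lemma val_ED P Q : val (P + Q : EC hE) = Eadd_raw a4 (val P) (val Q).
Proof. by []. Qed.

End EllipticGroup.

(** * Sums and differences of coordinates *)

Lemma dvdzD d m n : (d %| m)%Z -> (d %| n)%Z -> (d %| m + n)%Z.
Proof. exact: rpredD. Qed.

Lemma dvdzB d m n : (d %| m)%Z -> (d %| n)%Z -> (d %| m - n)%Z.
Proof. exact: rpredB. Qed.

(** Gauss's lemma for a product of two primitive linear forms. The product of the two Bezout
    relations is w + e x z', where [w] lies in the ideal of the three coefficients; so does the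
    square of x z', as it equals x z' (x z' + x' z) - x x' z z'. Hence the square of the product,
    which is 1, lies there too. *)
Lemma primitive_pair (x z x' z' r : int) : coprimez x z -> coprimez x' z' ->
    (r %| z * z')%Z -> (r %| x * z' + x' * z)%Z -> (r %| x * x')%Z ->
  (r %| 1)%Z.
Proof.
move=> /coprimezP [[u v] /= h] /coprimezP [[u' v'] /= h'] h1 h2 h3.
pose w := u * u' * (x * x') + v * v' * (z * z') + v * u' * (x * z' + x' * z).
pose e := u * v' - v * u'.
have rw : (r %| w)%Z by do 2?[apply: dvdzD]; apply: dvdz_mull.
change (r %| (1 : int)%R)%Z.
have -> : 1 = w * (w + 2 * (e * (x * z'))) +
    e ^+ 2 * ((x * z') * (x * z' + x' * z) - (x * x') * (z * z')).
  transitivity (((u * x + v * z) * (u' * x' + v' * z')) ^+ 2).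
    by rewrite h h'; ring.
  by rewrite /w /e; ring.
apply: dvdzD; first exact: dvdz_mulr.
by apply/dvdz_mull/dvdzB; apply: dvdz_mull.
Qed.

Section Coordinates.
Variables (a4 a6 : int) (hE : elliptic a4 a6).
Implicit Types P Q V W : EC hE.

(** The point at infinity gets the projective abscissa (1 : 0), so that the identities between
    coordinates hold for all points. *)
Definition xnum V : int := if val V is Some (x, _) then numq x else 1.
Definition xden V : int := if val V is Some (x, _) then denq x else 0.

Lemma naive_height_xE V : naive_height V = Num.max `|xnum V| (xden V).
Proof. by rewrite /naive_height /xnum /xden; case: (val V) => [[]|]. Qed.

Lemma xden_ge0 V : 0 <= xden V.
Proof. by rewrite /xden; case: (val V) => [[]|]. Qed.

Lemma coprime_x V : coprimez (xnum V) (xden V).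
Proof.
rewrite /xnum /xden; case: (val V) => [[x y]|] //.
by rewrite coprimezE; have := coprime_num_den x.
Qed.

Lemma xnum_le V : `|xnum V| <= naive_height V.
Proof. by rewrite naive_height_xE le_max lexx. Qed.

Lemma xden_le V : `|xden V| <= naive_height V.
Proof. by rewrite naive_height_xE ger0_norm ?xden_ge0 // le_max lexx orbT. Qed.

Lemma naive_height_ge1 V : 1 <= naive_height V.
Proof.
rewrite /naive_height; case: (val V) => [[x y]|] //.
by rewrite le_max orbC -gtz0_ge1 denq_gt0.
Qed.

Lemma xN V : ((xnum (- V) = xnum V) * (xden (- V) = xden V))%type.
Proof. by rewrite /xnum /xden val_EN; case: (val V) => [[]|]. Qed.

Lemma naive_heightN V : naive_height (- V) = naive_height V.
Proof. by rewrite !naive_height_xE !xN. Qed.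

Definition pair_den (x z x' z' : int) := (x * z' - x' * z) ^+ 2.
Definition pair_sum (x z x' z' : int) :=
  2 * ((x * z' + x' * z) * (a4 * z * z' + x * x') + 2 * a6 * (z * z') ^+ 2).
Definition pair_prod (x z x' z' : int) :=
  (x * x' - a4 * z * z') ^+ 2 - 4 * a6 * (z * z') * (x * z' + x' * z).

(* The two coordinates x(V + W), x(V - W) are the roots of the quadratic
   form with coefficients [pair_den], [pair_sum], [pair_prod]. *)
Lemma pair_proportional V W :
  let D := pair_den (xnum V) (xden V) (xnum W) (xden W) in
  let S := pair_sum (xnum V) (xden V) (xnum W) (xden W) in
  let Q := pair_prod (xnum V) (xden V) (xnum W) (xden W) in
  let d := xden (V + W) * xden (V - W) in
  let s := xnum (V + W) * xden (V - W) + xnum (V - W) * xden (V + W) in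
  let q := xnum (V + W) * xnum (V - W) in
  [/\ D * s = S * d, D * q = Q * d & S * q = Q * s].
Proof.
rewrite /pair_den /pair_sum /pair_prod.
case eV: (val V) (valP V) => [[x1 y1]|] hV; last first.
  have -> : V = 0 by apply/val_inj.
  rewrite add0r sub0r !xN /xnum /xden /=.
  case: (val W) => [[x2 y2]|]; last by split; ring.
  by split; ring.
case eW: (val W) (valP W) => [[x2 y2]|] hW; last first.
  have -> : W = 0 by apply/val_inj.
  rewrite addr0 subr0 /xnum /xden /= eV.
  by split; ring.
have intz (z : int) : (z == 0) = (z%:~R == 0 :> rat) by rewrite intr_eq0.
have nd (x : rat) : (numq x)%:~R = x * (denq x)%:~R :> rat.
  by rewrite -{2}(divq_num_den x) divfK // intr_eq0 denq_neq0.
have eW' : val (- W) = Some (x2, - y2) by rewrite val_EN eW.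
case: (eqVneq x1 x2) => [e|ne].
  (* For [W = V] or [W = - V], one of [V + W], [V - W] is the point at infinity, and the claim
     reduces to the duplication formula. *)
  have gen (U : EC hE) : val U = Some (x1, y1) -> 
      pair_sum (numq x1) (denq x1) (numq x1) (denq x1) * xnum (U + U) = 
      pair_prod (numq x1) (denq x1) (numq x1) (denq x1) * xden (U + U).
    move=> eU; rewrite /xnum /xden val_ED eU /=.
    move: hV => /eqP hV.
    case: (eqVneq y1 (- y1)) => [ey|ny]; rewrite eqxx /=.
      rewrite /pair_sum mulr0 mulr1; apply/eqP; rewrite intz; apply/eqP.
      rewrite !(rmorphD, rmorphM, rmorphXn) /= !nd.
      have y0 : y1 = 0 by lra.
      have hb : a6%:~R = - x1 ^+ 3 - a4%:~R * x1 :> rat.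
        by move: hV; rewrite y0 expr0n /=; lra.
      by rewrite hb; ring.
    have y0 : y1 != 0 by apply: contraNneq ny => ->; rewrite oppr0.
    set x3 := _ - x1 - x1.
    have hb : a6%:~R = y1 ^+ 2 - x1 ^+ 3 - a4%:~R * x1 :> rat by rewrite hV; ring.
    have e3 : 4 * (x1 ^+ 3 + a4%:~R * x1 + a6%:~R) * x3 -
              ((x1 ^+ 2 - a4%:~R) ^+ 2 - 8 * a6%:~R * x1) = 0.
      by rewrite hb /x3; field.
    clearbody x3; apply: (@intr_inj rat).
    rewrite /pair_sum /pair_prod !(rmorphB, rmorphD, rmorphM, rmorphXn) /= !nd.
    move: (denq x1)%:~R (denq x3)%:~R => z1 z3.
    apply/eqP; rewrite -subr_eq0; apply/eqP.
    transitivity (z1 ^+ 4 * z3 * (4 * (x1 ^+ 3 + a4%:~R * x1 + a6%:~R) * x3 -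
              ((x1 ^+ 2 - a4%:~R) ^+ 2 - 8 * a6%:~R * x1))); first by ring.
    by rewrite e3 mulr0.
  have hy : (y1 - y2) * (y1 + y2) = 0.
    rewrite -e in hW; move: hV hW => /eqP h1 /eqP h2.
    by transitivity (y1 ^+ 2 - y2 ^+ 2); [ring | rewrite h1 h2; ring].
  have xe : (xnum V = numq x1) * (xden V = denq x1) *
            (xnum W = numq x1) * (xden W = denq x1).
    by rewrite /xnum /xden eV eW -e.
  have hVW : W = V \/ W = - V.
    move/eqP: hy; rewrite mulf_eq0 subr_eq0 addr_eq0 => /orP[]/eqP ey.
      by left; apply/val_inj; rewrite /= eV eW e ey.
    by right; apply/val_inj; rewrite val_EN eV eW /= e ey opprK.
  have g := gen V eV.
  have x00 : (xnum (0 : EC hE) = 1) * (xden (0 : EC hE) = 0) by [].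
  rewrite /pair_sum /pair_prod in g.
  case: hVW => ->; rewrite ?subrr ?opprK !(xe, x00, xN) ?subrr expr0n /=;
    rewrite !(mul1r, mulr1, mulr0, addr0, add0r, mul0r); split=> //; exact: g.
have d0 : x2 - x1 != 0 by rewrite subr_eq0 eq_sym.
move/eqP: hV => hV; move/eqP: hW => hW.
pose x3 := ((y2 - y1) / (x2 - x1)) ^+ 2 - x1 - x2.
pose x4 := ((- y2 - y1) / (x2 - x1)) ^+ 2 - x1 - x2.
have ea : a4%:~R = (y2 ^+ 2 - y1 ^+ 2 - (x2 ^+ 3 - x1 ^+ 3)) / (x2 - x1) :> rat.
  by rewrite hV hW; field.
have eb : a6%:~R = y1 ^+ 2 - x1 ^+ 3 - a4%:~R * x1 :> rat by rewrite hV; ring.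
have esum : (x1 - x2) ^+ 2 * (x3 + x4) =
    2 * ((x1 + x2) * (a4%:~R + x1 * x2) + 2 * a6%:~R).
  by rewrite eb ea /x3 /x4; field.
have eprod : (x1 - x2) ^+ 2 * (x3 * x4) =
    (x1 * x2 - a4%:~R) ^+ 2 - 4 * a6%:~R * (x1 + x2).
  by rewrite eb ea /x3 /x4; field.
have [[-> ->] [-> ->]] : (xnum V = numq x1 /\ xden V = denq x1) /\
               (xnum W = numq x2 /\ xden W = denq x2).
  by rewrite /xnum /xden eV eW.
have [[-> ->] [-> ->]] : (xnum (V + W) = numq x3 /\ xden (V + W) = denq x3) /\
               (xnum (V - W) = numq x4 /\ xden (V - W) = denq x4).
  by rewrite /xnum /xden !val_ED val_EN eV eW /= (negbTE ne).
move/eqP: esum; rewrite -subr_eq0 => /eqP esum.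
move/eqP: eprod; rewrite -subr_eq0 => /eqP eprod.
clearbody x3 x4; clear - nd esum eprod.
split; apply: (@intr_inj rat); rewrite !(rmorphB, rmorphD, rmorphM, rmorphXn) /= !nd;
  move: (denq x1)%:~R (denq x2)%:~R (denq x3)%:~R (denq x4)%:~R => z1 z2 z3 z4;
  apply/eqP; rewrite -subr_eq0; apply/eqP.
- transitivity ((z1 * z2) ^+ 2 * (z3 * z4) * ((x1 - x2) ^+ 2 * (x3 + x4) -
     2 * ((x1 + x2) * (a4%:~R + x1 * x2) + 2 * a6%:~R))); first by ring.
  by rewrite esum mulr0.
- transitivity ((z1 * z2) ^+ 2 * (z3 * z4) * ((x1 - x2) ^+ 2 * (x3 * x4) -
     ((x1 * x2 - a4%:~R) ^+ 2 - 4 * a6%:~R * (x1 + x2)))); first by ring.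
  by rewrite eprod mulr0.
have e : (2 * ((x1 + x2) * (a4%:~R + x1 * x2) + 2 * a6%:~R)) * (x3 * x4) =
   ((x1 * x2 - a4%:~R) ^+ 2 - 4 * a6%:~R * (x1 + x2)) * (x3 + x4).
  move/eqP: esum; rewrite subr_eq0 => /eqP <-.
  move/eqP: eprod; rewrite subr_eq0 => /eqP <-; ring.
transitivity ((z1 * z2) ^+ 2 * (z3 * z4) *
  ((2 * ((x1 + x2) * (a4%:~R + x1 * x2) + 2 * a6%:~R)) * (x3 * x4) -
   ((x1 * x2 - a4%:~R) ^+ 2 - 4 * a6%:~R * (x1 + x2)) * (x3 + x4))); first by ring.
by rewrite e subrr mulr0.
Qed.

Lemma xcoord_neq0 V : (xnum V != 0) || (xden V != 0).
Proof.
have := coprime_x V; case: eqP => //= ->.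
by apply: contraTneq => ->.
Qed.

Lemma pair_den0 V W :
    pair_den (xnum V) (xden V) (xnum W) (xden W) = 0 ->
  xnum V = xnum W /\ xden V = xden W.
Proof.
move/eqP; rewrite sqrf_eq0 subr_eq0 => /eqP e.
have d1 : (xden V %| xden W)%Z.
  have := coprime_x V; rewrite coprimez_sym => /(Gauss_dvdzr (xden W)) <-.
  by rewrite e dvdz_mull.
have d2 : (xden W %| xden V)%Z.
  have := coprime_x W; rewrite coprimez_sym => /(Gauss_dvdzr (xden V)) <-.
  by rewrite -e dvdz_mull.
have ed : xden V = xden W.
  have := xden_ge0 V; have := xden_ge0 W => h1 h2.
  rewrite -(gez0_abs h1) -(gez0_abs h2); congr Posz.
  by apply/eqP; rewrite eqn_dvd -!dvdzE d1 d2.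
split=> //; case: (eqVneq (xden W) 0) => [e0|n0]; last first.
  by apply: (mulIf n0); rewrite e -ed.
have : forall U : EC hE, xden U = 0 -> xnum U = 1.
  move=> U; rewrite /xnum /xden; case: (val U) => [[x y]|] //.
  by move/eqP; rewrite (negbTE (denq_neq0 x)).
by move=> h; rewrite !h // ed.
Qed.

(** With equal arguments, [pair_prod] and [pair_sum] are the numerator and the denominator of the
    duplication formula. These Bezout identities show that they have no common zero and that at a
    coprime pair their common factors divide 4 (4 a4^3 + 27 a6^2). *)
Lemma resultant_den (x z : int) :
  (12 * x ^+ 2 * z + 16 * a4 * z ^+ 3) * pair_prod x z x z -
  (3 * x ^+ 3 - 5 * a4 * x * z ^+ 2 - 27 * a6 * z ^+ 3) * pair_sum x z x z =
  4 * (4 * a4 ^+ 3 + 27 * a6 ^+ 2) * z ^+ 7.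
Proof. by rewrite /pair_prod /pair_sum; ring. Qed.

Lemma resultant_num (x z : int) :
  (4 * (4 * a4 ^+ 3 + 27 * a6 ^+ 2) * x ^+ 3 - 4 * a4 ^+ 2 * a6 * x ^+ 2 * z +
   4 * a4 * (3 * a4 ^+ 3 + 22 * a6 ^+ 2) * x * z ^+ 2 +
   12 * a6 * (a4 ^+ 3 + 8 * a6 ^+ 2) * z ^+ 3) * pair_prod x z x z +
  (a4 ^+ 2 * a6 * x ^+ 3 + a4 * (5 * a4 ^+ 3 + 32 * a6 ^+ 2) * x ^+ 2 * z +
   2 * a6 * (13 * a4 ^+ 3 + 96 * a6 ^+ 2) * x * z ^+ 2 -
   3 * a4 ^+ 2 * (a4 ^+ 3 + 8 * a6 ^+ 2) * z ^+ 3) * pair_sum x z x z =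
  4 * (4 * a4 ^+ 3 + 27 * a6 ^+ 2) * x ^+ 7.
Proof. by rewrite /pair_prod /pair_sum; ring. Qed.

(** The coefficients on the right are coprime by [primitive_pair], so proportionality makes the left
    side an integral multiple of them. If [k] were 0, V and W would share their abscissa and both
    duplication polynomials would vanish there, against the resultant identities. *)
Lemma pair_factor V W : exists2 k : int, k != 0 &
  [/\ pair_den (xnum V) (xden V) (xnum W) (xden W) =
        k * (xden (V + W) * xden (V - W)),
      pair_sum (xnum V) (xden V) (xnum W) (xden W) =
        k * (xnum (V + W) * xden (V - W) + xnum (V - W) * xden (V + W)) &
      pair_prod (xnum V) (xden V) (xnum W) (xden W) =
        k * (xnum (V + W) * xnum (V - W))].
Proof.
have [] := pair_proportional V W.
set D := pair_den _ _ _ _; set S := pair_sum _ _ _ _; set Q := pair_prod _ _ _ _.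
move=> h1 h2 h3.
have [u [v [w huvw]]] : exists u v w, u * (xden (V + W) * xden (V - W)) +
    v * (xnum (V + W) * xden (V - W) + xnum (V - W) * xden (V + W)) +
    w * (xnum (V + W) * xnum (V - W)) = 1.
  set d := _ * xden _; set s := _ + _ * xden _; set q := _ * xnum (V - W).
  have [u [v e1]] := Bezoutz d s; have [u' [v' e2]] := Bezoutz (gcdz d s) q.
  exists (u' * u), (u' * v), v'.
  transitivity (u' * (u * d + v * s) + v' * q); first by ring.
  rewrite e1 e2; set r := gcdz _ _.
  have rs : (r %| gcdz d s)%Z by apply: dvdz_gcdl.
  have : (r %| 1)%Z.
    apply: (primitive_pair (coprime_x (V + W)) (coprime_x (V - W))).
    - exact: dvdz_trans rs (dvdz_gcdl _ _).
    - exact: dvdz_trans rs (dvdz_gcdr _ _).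
    - exact: dvdz_gcdr.
  by rewrite dvdzE dvdn1 /r /gcdz /= => /eqP ->.
move: huvw h1 h2 h3; set d := _ * xden (V - W); set s := _ + _ * xden _.
set q := xnum (V + W) * xnum _ => huvw h1 h2 h3.
pose k := u * D + v * S + w * Q.
have expand e : e = u * (e * d) + v * (e * s) + w * (e * q).
  by rewrite -{1}[e]mulr1 -huvw; ring.
have eD : D = k * d by rewrite [LHS]expand h1 h2 /k; ring.
have eS : S = k * s by rewrite [LHS]expand -h1 h3 /k; ring.
have eQ : Q = k * q by rewrite [LHS]expand -h2 -h3 /k; ring.
exists k; last by [].
apply/eqP => k0.
have [ex ez] : xnum V = xnum W /\ xden V = xden W.
  by apply: pair_den0; rewrite -/D eD k0 mul0r.
have S0 : pair_sum (xnum V) (xden V) (xnum V) (xden V) = 0.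
  by rewrite {2}ex {2}ez -/S eS k0 mul0r.
have Q0 : pair_prod (xnum V) (xden V) (xnum V) (xden V) = 0.
  by rewrite {2}ex {2}ez -/Q eQ k0 mul0r.
have := resultant_den (xnum V) (xden V); rewrite S0 Q0 !mulr0 subr0.
have := resultant_num (xnum V) (xden V); rewrite S0 Q0 !mulr0 addr0.
have D0 : 4 * (4 * a4 ^+ 3 + 27 * a6 ^+ 2) != 0 by rewrite mulf_neq0.
move=> /esym/eqP; rewrite mulf_eq0 (negbTE D0) expf_eq0 => /andP[_ /eqP ex0].
move=> /esym/eqP; rewrite mulf_eq0 (negbTE D0) expf_eq0 => /andP[_ /eqP ez0].
by have := xcoord_neq0 V; rewrite ex0 ez0.
Qed.

End Coordinates.

(** * Naive heights of sums, differences and doubles *)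

Section PolyBounds.
Variable h : int.
Hypothesis h1 : 1 <= h.

Definition bounded n (c e : int) := 0 <= c /\ `|e| <= c * h ^+ n.

Lemma boundedD n c c' e e' :
  bounded n c e -> bounded n c' e' -> bounded n (c + c') (e + e').
Proof.
move=> [c0 l] [c0' l']; split; first exact: addr_ge0.
by rewrite mulrDl (le_trans (ler_normD _ _)) // lerD.
Qed.

Lemma boundedN n c e : bounded n c e -> bounded n c (- e).
Proof. by rewrite /bounded normrN. Qed.

Lemma boundedM n n' c c' e e' :
  bounded n c e -> bounded n' c' e' -> bounded (n + n') (c * c') (e * e').
Proof.
move=> [c0 l] [c0' l']; split; first exact: mulr_ge0.
by rewrite normrM exprD mulrACA ler_pM.
Qed.

Lemma boundedC e : bounded 0 `|e| e.
Proof. by split; rewrite ?expr0 ?mulr1. Qed.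

Lemma boundedX n m c e : bounded n c e -> bounded (n * m) (c ^+ m) (e ^+ m).
Proof.
move=> [c0 l]; split; first exact: exprn_ge0.
by rewrite normrX exprM -exprMn lerXn2r // ?nnegrE ?mulr_ge0 ?exprn_ge0 // (le_trans _ h1).
Qed.

Lemma bounded1 e : `|e| <= h -> bounded 1 1 e.
Proof. by split; rewrite // mul1r expr1. Qed.

End PolyBounds.

(** For linear forms the maximum of the coefficients is multiplicative up to the factor 2. *)
Lemma max_mul_le (x z x' z' m : int) : 0 <= z -> 0 <= z' ->
    z * z' <= m -> `|x * x'| <= m -> `|x * z' + x' * z| <= m ->
  Num.max `|x| z * Num.max `|x'| z' <= 2 * m.
Proof.
move=> z0 z0' h1; rewrite normrM => h2 h3.
have m0 : 0 <= m by apply: le_trans h1; apply: mulr_ge0.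
have h4 : `|x| * z' <= m + `|x'| * z.
  rewrite -{1}(ger0_norm z0') -{1}(ger0_norm z0) -!normrM.
  by rewrite -[x * z'](addrK (x' * z)) (le_trans (ler_normB _ _)) // lerD2r.
have h5 : `|x'| * z <= m + `|x| * z'.
  rewrite -{1}(ger0_norm z0') -{1}(ger0_norm z0) -!normrM.
  rewrite -[x' * z](addrK (x * z')) (le_trans (ler_normB _ _)) // lerD2r.
  by rewrite addrC.
move: (`|x|) (`|x'|) (normr_ge0 x) (normr_ge0 x') h2 h4 h5 => a b a0 b0 h2 h4 h5.
by rewrite /Num.max; case: ifP => c1; case: ifP => c2; nia.
Qed.

Section HeightBounds.
Variables (a4 a6 : int) (hE : elliptic a4 a6).
Implicit Types P Q V W : EC hE.

Lemma naive_height_addP V W (m : int) :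
    let D := pair_den (xnum V) (xden V) (xnum W) (xden W) in
    let S := pair_sum a4 a6 (xnum V) (xden V) (xnum W) (xden W) in
    let Q := pair_prod a4 a6 (xnum V) (xden V) (xnum W) (xden W) in
    `|D| <= m -> `|S| <= m -> `|Q| <= m ->
  naive_height (V + W) * naive_height (V - W) <= 2 * m.
Proof.
have [k k0 [-> -> ->]] := pair_factor V W => /= h1 h2 h3.
have k1 e : `|k * e| <= m -> `|e| <= m.
  apply: le_trans; rewrite normrM ler_peMl //.
  by rewrite -gtz0_ge1 normr_gt0.
rewrite !naive_height_xE; apply: max_mul_le.
- exact: xden_ge0.
- exact: xden_ge0.
- exact: le_trans (ler_norm _) (k1 _ h1).
- exact: k1.
exact: k1.
Qed.

Lemma naive_height_add_le : exists2 c : int, 0 < c & forall V W,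
  naive_height (V + W) * naive_height (V - W) <=
  c * (naive_height V * naive_height W) ^+ 2.
Proof.
have [c cP] : exists c : int, forall (h p q r s : int), 1 <= h ->
    `|p| <= h -> `|q| <= h -> `|r| <= h -> `|s| <= h ->
    [/\ bounded h 2 c ((p - q) ^+ 2),
        bounded h 2 c (2 * ((p + q) * (a4 * r + s) + 2 * a6 * r ^+ 2)) &
        bounded h 2 c ((s - a4 * r) ^+ 2 - 4 * a6 * r * (p + q))].
  have weaken h n c c' e : 1 <= h -> c <= c' -> bounded h n c e -> bounded h n c' e.
    move=> h1 cc [c0 l]; split; first exact: le_trans cc.
    by rewrite (le_trans l) // ler_wpM2r // exprn_ge0 // (le_trans _ h1).
  pose c1 : int := (1 + 1) ^+ 2.
  pose c2 : int := `|2| * ((1 + 1) * (`|a4| * 1 + 1) + `|2 * a6| * 1 ^+ 2).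
  pose c3 : int := (1 + `|a4| * 1) ^+ 2 + `|4 * a6| * 1 * (1 + 1).
  have [c10 c20 c30] : [/\ 0 <= c1, 0 <= c2 & 0 <= c3].
    by rewrite /c1 /c2 /c3; split; rewrite ?(exprn_ge0, addr_ge0, mulr_ge0).
  have [l1 l2 l3] : [/\ c1 <= c1 + c2 + c3, c2 <= c1 + c2 + c3 & c3 <= c1 + c2 + c3].
    by move: c1 c2 c3 c10 c20 c30 => *; split; lia.
  exists (c1 + c2 + c3) => h p q r s h1 hp hq hr hs.
  have [bp bq br bs] : [/\ bounded h 1 1 p, bounded h 1 1 q, bounded h 1 1 r & bounded h 1 1 s].
    by split; apply: bounded1.
  split.
  - apply: (weaken _ _ c1) => //.
    by apply: (@boundedX h h1 1 2); apply: boundedD => //; apply: boundedN.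
  - apply: (weaken _ _ c2) => //.
    apply: (@boundedM h 0 2); first exact: boundedC.
    apply: boundedD.
      apply: (@boundedM h 1 1); apply: boundedD => //.
      by apply: (@boundedM h 0 1); first exact: boundedC.
    apply: (@boundedM h 0 2); first exact: boundedC.
    exact: (@boundedX h h1 1 2).
  apply: (weaken _ _ c3) => //.
  apply: boundedD.
    apply: (@boundedX h h1 1 2); apply: boundedD => //; apply: boundedN.
    by apply: (@boundedM h 0 1); first exact: boundedC.
  apply: boundedN; apply: (@boundedM h 1 1); last exact: boundedD.
  by apply: (@boundedM h 0 1); first exact: boundedC.
exists (2 * (`|c| + 1)); first by lia.
move=> V W; set h := naive_height V * naive_height W.
have [v1 w1] := (naive_height_ge1 V, naive_height_ge1 W).
have h1 : 1 <= h by rewrite /h; nia.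
have le x y : `|x| <= naive_height V -> `|y| <= naive_height W -> `|x * y| <= h.
  by move=> *; rewrite normrM ler_pM.
have [xv zv xw zw] := And4 (xnum_le V) (xden_le V) (xnum_le W) (xden_le W).
have [[_ b1] [_ b2] [_ b3]] := cP h (xnum V * xden W) (xnum W * xden V)
  (xden V * xden W) (xnum V * xnum W) h1 (le _ _ xv zw)
  (eq_ind _ (fun z => `|z| <= h) (le _ _ zv xw) _ (mulrC _ _)) (le _ _ zv zw) (le _ _ xv xw).
have cc : c * h ^+ 2 <= (`|c| + 1) * h ^+ 2.
  apply: ler_wpM2r; first exact: sqr_ge0.
  by apply: le_trans (ler_norm c) _; rewrite lerDl.
rewrite -mulrA; apply: naive_height_addP.
- by apply: le_trans cc; apply: le_trans b1; rewrite /pair_den.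
- apply: le_trans cc; apply: le_trans b2; rewrite /pair_sum.
  by rewrite -(mulrA a4).
apply: le_trans cc; apply: le_trans b3; rewrite /pair_prod.
by rewrite -(mulrA a4).
Qed.

(** The cancellation [k] in the duplication formula divides the constant of the resultant
    identities. Whichever of x and z attains H, the identity for its seventh power, whose cubic
    cofactors are at most c H^3, gives H^7 <= 2 c H^3 H(2V). *)
Lemma naive_height_dbl_ge : exists2 c : int, 0 < c & forall V,
  naive_height V ^+ 4 <= c * naive_height (V + V).
Proof.
have [c cP] : exists c : int, forall (h x z : int), 1 <= h -> `|x| <= h -> `|z| <= h ->
   [/\ bounded h 3 c (12 * x ^+ 2 * z + 16 * a4 * z ^+ 3),
       bounded h 3 c (3 * x ^+ 3 - 5 * a4 * x * z ^+ 2 - 27 * a6 * z ^+ 3),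
       bounded h 3 c (4 * (4 * a4 ^+ 3 + 27 * a6 ^+ 2) * x ^+ 3 - 4 * a4 ^+ 2 * a6 * x ^+ 2 * z +
   4 * a4 * (3 * a4 ^+ 3 + 22 * a6 ^+ 2) * x * z ^+ 2 +
   12 * a6 * (a4 ^+ 3 + 8 * a6 ^+ 2) * z ^+ 3) &
       bounded h 3 c (a4 ^+ 2 * a6 * x ^+ 3 + a4 * (5 * a4 ^+ 3 + 32 * a6 ^+ 2) * x ^+ 2 * z +
   2 * a6 * (13 * a4 ^+ 3 + 96 * a6 ^+ 2) * x * z ^+ 2 -
   3 * a4 ^+ 2 * (a4 ^+ 3 + 8 * a6 ^+ 2) * z ^+ 3)].
  have cubic (u v w t : int) : exists2 c : int, 0 <= c & forall (h x z : int), 1 <= h ->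
      `|x| <= h -> `|z| <= h ->
      bounded h 3 c (u * x ^+ 3 + v * x ^+ 2 * z + w * x * z ^+ 2 + t * z ^+ 3).
    exists (`|u| * 1 ^+ 3 + `|v| * 1 ^+ 2 * 1 + `|w| * 1 * 1 ^+ 2 + `|t| * 1 ^+ 3).
      by rewrite !expr1n; lia.
    move=> h x z h1 /bounded1 bx /bounded1 bz.
    have bX e n : bounded h 1 1 e -> bounded h n (1 ^+ n) (e ^+ n).
      by move=> be; have := boundedX h1 n be; rewrite mul1n.
    do 3?[apply: boundedD].
    - by apply: (@boundedM h 0 3); [exact: boundedC | exact: (bX _ 3 bx)].
    - apply: (@boundedM h 2 1) => //.
      by apply: (@boundedM h 0 2); [exact: boundedC | exact: (bX _ 2 bx)].
    - apply: (@boundedM h 1 2); last exact: bX _ 2 bz.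
      by apply: (@boundedM h 0 1); first exact: boundedC.
    by apply: (@boundedM h 0 3); [exact: boundedC | exact: (bX _ 3 bz)].
  have [c1 c10 h1] := cubic 0 12 0 (16 * a4).
  have [c2 c20 h2] := cubic 3 0 (- 5 * a4) (- 27 * a6).
  have [c3 c30 h3] := cubic (4 * (4 * a4 ^+ 3 + 27 * a6 ^+ 2)) (- 4 * a4 ^+ 2 * a6)
    (4 * a4 * (3 * a4 ^+ 3 + 22 * a6 ^+ 2)) (12 * a6 * (a4 ^+ 3 + 8 * a6 ^+ 2)).
  have [c4 c40 h4] := cubic (a4 ^+ 2 * a6) (a4 * (5 * a4 ^+ 3 + 32 * a6 ^+ 2))
   (2 * a6 * (13 * a4 ^+ 3 + 96 * a6 ^+ 2)) (- 3 * a4 ^+ 2 * (a4 ^+ 3 + 8 * a6 ^+ 2)).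
  have weaken h n c c' e : 1 <= h -> c <= c' -> bounded h n c e -> bounded h n c' e.
    move=> hh cc [c0 l]; split; first exact: le_trans cc.
    by rewrite (le_trans l) // ler_wpM2r // exprn_ge0 // (le_trans _ hh).
  exists (c1 + c2 + c3 + c4) => h x z hh hx hz; split.
  - apply: (weaken _ _ c1) => //; first by lia.
    by have := h1 h x z hh hx hz; rewrite !mul0r addr0 add0r.
  - apply: (weaken _ _ c2) => //; first by lia.
    by have := h2 h x z hh hx hz; rewrite !mul0r addr0 !mulNr.
  - apply: (weaken _ _ c3) => //; first by lia.
    by have := h3 h x z hh hx hz; rewrite !mulNr.
  apply: (weaken _ _ c4) => //; first by lia.
  by have := h4 h x z hh hx hz; rewrite !mulNr.
exists (2 * (`|c| + 1)); first by lia.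
move=> V; set h := naive_height V; have h1 : 1 <= h := naive_height_ge1 V.
have [[_ b1] [_ b2] [_ b3] [_ b4]] := cP h _ _ h1 (xnum_le V) (xden_le V).
have [k k0 [_ eS eQ]] := pair_factor V V.
rewrite subrr in eS eQ.
have [x0 z0] : xnum (0 : EC hE) = 1 /\ xden (0 : EC hE) = 0 by [].
rewrite x0 z0 mulr0 add0r mul1r mulr1 in eS eQ.
have := resultant_den a4 a6 (xnum V) (xden V); have := resultant_num a4 a6 (xnum V) (xden V).
rewrite eS eQ.
set D := 4 * (4 * a4 ^+ 3 + 27 * a6 ^+ 2).
move: b1 b2 b3 b4; set f1 := 12 * _ * _ + _; set g1 := 3 * _ - _ - _.
set f2 := _ + 12 * _ * _ * _; set g2 := _ - 3 * _ * _ * _ => b1 b2 b3 b4 en ed.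
have D0 : D != 0 by rewrite mulf_neq0.
set X := xnum (V + V) in en ed *; set Z := xden (V + V) in en ed *.
have kD : (k %| D)%Z.
  have cxz : coprimez (xnum V ^+ 7) (xden V ^+ 7).
    by rewrite coprimezXl // coprimezXr // coprime_x.
  have k1 : (k %| D * xnum V ^+ 7)%Z.
    by rewrite -en; apply: dvdzD; apply: dvdz_mull; apply: dvdz_mulr.
  have k2 : (k %| D * xden V ^+ 7)%Z.
    by rewrite -ed; apply: dvdzB; apply: dvdz_mull; apply: dvdz_mulr.
  have /coprimezP[[u v] /= e] := cxz.
  rewrite -[D]mulr1 -e mulrDr; apply: dvdzD.
    by rewrite mulrCA dvdz_mull.
  by rewrite mulrCA dvdz_mull.
have kle : `|k| <= `|D|.
  by rewrite -!abszE lez_nat dvdn_leq // absz_gt0.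
have hX : `|X| <= naive_height (V + V) := xnum_le _.
have hZ : `|Z| <= naive_height (V + V) := xden_le _.
set H2 := naive_height (V + V) in hX hZ *.
have H20 : 0 <= H2 by apply: le_trans hZ.
clearbody D.
have main (f g w : int) : `|f| <= c * h ^+ 3 -> `|g| <= c * h ^+ 3 ->
    `|w| = h -> `|f * (k * X) + g * (k * Z)| = `|D * w ^+ 7| -> h ^+ 4 <= 2 * (`|c| + 1) * H2.
  move=> hf hg hw e.
  have D1 : 0 < `|D| by rewrite normr_gt0.
  have hp : 0 < h ^+ 3 by rewrite exprn_gt0 // (lt_le_trans _ h1).
  have c0 : 0 <= c by have := le_trans (normr_ge0 f) hf; rewrite pmulr_lge0.
  have : `|D| * (h ^+ 3 * h ^+ 4) <= `|D| * (h ^+ 3 * (2 * (`|c| + 1) * H2)).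
    rewrite -exprD -{1}hw -normrX -normrM -e.
    apply: le_trans (ler_normD _ _) _; rewrite !normrM.
    apply: (@le_trans _ _ (c * h ^+ 3 * (`|D| * H2) + c * h ^+ 3 * (`|D| * H2))).
      by apply: lerD; apply: ler_pM => //; rewrite ?mulr_ge0 //; apply: ler_pM.
    have -> : c * h ^+ 3 * (`|D| * H2) + c * h ^+ 3 * (`|D| * H2) =
              `|D| * (h ^+ 3 * (2 * c * H2)) by ring.
    apply: ler_wpM2l => //; apply: ler_wpM2l; first exact: ltW.
    apply: ler_wpM2r => //; rewrite (ger0_norm c0) ler_wpM2l // lerDl //.
  by rewrite (ler_pM2l D1) (ler_pM2l hp).
have : `|xnum V| = h \/ `|xden V| = h.
  rewrite /h naive_height_xE (ger0_norm (xden_ge0 V)) /Num.max.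
  by case: ifP; [right | left].
case=> hv.
  by apply: (main f2 g2 _ b3 b4 hv); rewrite en.
by apply: (main f1 (- g1) _ b1 _ hv); rewrite ?normrN // mulNr ed.
Qed.

End HeightBounds.

(** * The canonical height *)

Section QuadraticHeight.
Import numFieldNormedType.Exports.
Local Open Scope classical_set_scope.
Variables (R : realType) (G : zmodType) (h : G -> R) (C : R).
Hypothesis h_para : forall x y,
  `|h (x + y) + h (x - y) - 2 * h x - 2 * h y| <= C.

Let u (x : G) (k : nat) : R := h (x *+ (2 ^ k)) / 4 ^+ k.

Let C0 : 0 <= C.
Proof. exact: le_trans (normr_ge0 _) (h_para 0 0). Qed.

Let h0 : `|h 0| <= C / 2.
Proof.
by have := h_para 0 0; rewrite addr0 subr0 !ler_norml; lra.
Qed.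

Let h_dbl x : `|h (x + x) - 4 * h x| <= 3 / 2 * C.
Proof.
have := h_para x x; rewrite subrr; move: h0; rewrite !ler_norml; lra.
Qed.

Let u_step x k : `|u x k.+1 - u x k| <= 3 / 2 * C / 4 ^+ k.+1.
Proof.
rewrite /u expnS mul2n -addnn mulrnDr.
have e4 : 4 ^+ k.+1 != 0 :> R by rewrite expf_neq0 //; lra.
have -> (a b : R) : a / 4 ^+ k.+1 - b / 4 ^+ k = (a - 4 * b) / 4 ^+ k.+1.
  by rewrite exprS; field; rewrite expf_neq0 //; lra.
rewrite normrM normfV (@ger0_norm _ (4 ^+ k.+1)) ?exprn_ge0 //.
by apply: ler_wpM2r; rewrite ?invr_ge0 ?exprn_ge0.
Qed.

(** The term C / 2 / 4^k is the sum of all later bounds in [u_step]. Adding it makes the sequence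
    decreasing and subtracting it makes it increasing, which yields both the limit and the bound C /
    2. *)
Let up x k := u x k + C / 2 / 4 ^+ k.
Let lo x k := u x k - C / 2 / 4 ^+ k.

Let step_eq k : 3 / 2 * C / 4 ^+ k.+1 = C / 2 / 4 ^+ k - C / 2 / 4 ^+ k.+1.
Proof. by rewrite exprS; field; rewrite expf_neq0 //; lra. Qed.

Let up_le x : nonincreasing_seq (up x).
Proof.
apply/nonincreasing_seqP => k; rewrite /up.
have := u_step x k; rewrite ler_norml step_eq; lra.
Qed.

Let lo_le x : nondecreasing_seq (lo x).
Proof.
apply/nondecreasing_seqP => k; rewrite /lo.
have := u_step x k; rewrite ler_norml step_eq; lra.
Qed.

Let eps0 k : 0 <= C / 2 / 4 ^+ k.
Proof. by rewrite divr_ge0 ?exprn_ge0 // divr_ge0. Qed.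

Let eps_cvg (c : R) : c / 4 ^+ k @[k --> \oo] --> (0 : R).
Proof.
have -> : (fun k => c / 4 ^+ k) = (fun k => c * (4^-1) ^+ k).
  by apply/funext => k; rewrite exprVn.
rewrite -[X in _ --> X](mulr0 c); apply: cvgMr.
by apply: cvg_expr; rewrite ger0_norm ?invr_ge0 // invf_lt1 //; lra.
Qed.

Definition quad_lim x := lim (u x k @[k --> \oo]).

Let u_cvg x : u x k @[k --> \oo] --> quad_lim x.
Proof.
suff : cvg (u x k @[k --> \oo]) by [].
have c1 : cvg (up x k @[k --> \oo]).
  apply: nonincreasing_is_cvgn => //; exists (lo x 0) => _ [k _ <-].
  apply: le_trans (lo_le x (leq0n k)) _; rewrite /lo /up; have := eps0 k; lra.
have -> : u x = (fun k => up x k - C / 2 / 4 ^+ k).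
  by apply/funext => k; rewrite /up addrK.
by apply: is_cvgB => //; apply/cvg_ex; exists 0; apply: eps_cvg.
Qed.

Lemma quad_lim_close x : `|h x - quad_lim x| <= C / 2.
Proof.
have cu : up x k @[k --> \oo] --> quad_lim x.
  by rewrite -[X in _ --> X]addr0; apply: cvgD => //; apply: eps_cvg.
have cl : lo x k @[k --> \oo] --> quad_lim x.
  by rewrite -[X in _ --> X]subr0; apply: cvgB => //; apply: eps_cvg.
have l1 : quad_lim x <= up x 0.
  rewrite -(cvg_lim _ cu) //; apply: nonincreasing_cvgn_ge => //.
  by apply/cvg_ex; exists (quad_lim x).
have l2 : lo x 0 <= quad_lim x.
  rewrite -(cvg_lim _ cl) //; apply: nondecreasing_cvgn_le => //.
  by apply/cvg_ex; exists (quad_lim x).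
move: l1 l2; rewrite /up /lo /u expn0 mulr1n expr0 !divr1 ler_norml; lra.
Qed.

Lemma quad_limD x y :
  quad_lim (x + y) + quad_lim (x - y) = 2 * quad_lim x + 2 * quad_lim y.
Proof.
apply/eqP; rewrite -subr_eq0; apply/eqP.
pose w k := u (x + y) k + u (x - y) k - (2 * u x k + 2 * u y k).
have cw : w k @[k --> \oo] -->
    quad_lim (x + y) + quad_lim (x - y) - (2 * quad_lim x + 2 * quad_lim y).
  apply: cvgB; first exact: cvgD.
  by apply: cvgD; apply: cvgMr.
rewrite -(cvg_lim _ cw) //; apply: cvg_lim => //.
apply: (@squeeze_cvgr _ _ _ _ (fun k => - (C / 4 ^+ k)) (fun k => C / 4 ^+ k)).
- apply: nearW => k; rewrite -ler_norml /w /u.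
  have -> (a b c d f : R) : a / f + b / f - (2 * (c / f) + 2 * (d / f)) =
    (a + b - 2 * c - 2 * d) / f by ring.
  rewrite mulrnDl mulrnBl normrM normfV (@ger0_norm _ (4 ^+ k)) ?exprn_ge0 //.
  by apply: ler_wpM2r; rewrite ?invr_ge0 ?exprn_ge0.
- by rewrite -oppr0; apply: cvgN; apply: eps_cvg.
exact: eps_cvg.
Qed.

Lemma quad_lim0 : quad_lim 0 = 0.
Proof. by have := quad_limD 0 0; rewrite addr0 subr0; lra. Qed.

Lemma quad_limN x : quad_lim (- x) = quad_lim x.
Proof. by have := quad_limD 0 x; rewrite add0r sub0r quad_lim0; lra. Qed.

Lemma quad_limMn x n : quad_lim (x *+ n) = n%:R ^+ 2 * quad_lim x.
Proof.
suff : quad_lim (x *+ n) = n%:R ^+ 2 * quad_lim x /\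
       quad_lim (x *+ n.+1) = n.+1%:R ^+ 2 * quad_lim x by case.
elim: n => [|n [IH1 IH2]].
  by rewrite mulr0n quad_lim0 mulr1n; split; ring.
split=> //; have := quad_limD (x *+ n.+1) x.
have e1 : x *+ n.+1 - x = x *+ n by rewrite mulrSr addrK.
rewrite e1 -mulrSr IH1 IH2 => e.
have -> : quad_lim (x *+ n.+2) = 2 * (n.+1%:R ^+ 2 * quad_lim x) + 2 * quad_lim x
  - n%:R ^+ 2 * quad_lim x by lra.
by rewrite -!natr1; ring.
Qed.

Lemma quad_limMz x (n : int) : quad_lim (x *~ n) = n%:~R ^+ 2 * quad_lim x.
Proof.
case: n => n; first by rewrite -pmulrn quad_limMn.
by rewrite NegzE mulrNz quad_limN -pmulrn quad_limMn mulrNz sqrrN.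
Qed.

(** The canonical height is a limit over all multiples, whereas [quad_lim] uses powers of 2. They
    agree because [quad_lim] is exactly quadratic on multiples and stays within C / 2 of [h]. *)
Lemma quad_lim_cvg x : h (x *+ n) / n%:R ^+ 2 @[n --> \oo] --> quad_lim x.
Proof.
rewrite -(cvg_shiftS (fun n => h (x *+ n) / n%:R ^+ 2)).
pose e n : R := C / 2 / n.+1%:R.
have ce : e n @[n --> \oo] --> (0 : R).
  rewrite -[X in _ --> X](mulr0 (C / 2)); apply: cvgMr.
  exact: cvg_harmonic.
apply: (@squeeze_cvgr _ _ _ _ (fun n => quad_lim x - e n) (fun n => quad_lim x + e n)).
- apply: nearW => n; rewrite -ler_distlC.
  have n0 : 0 < n.+1%:R :> R by rewrite ltr0n.
  have -> : quad_lim x - h (x *+ n.+1) / n.+1%:R ^+ 2 =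
      (quad_lim (x *+ n.+1) - h (x *+ n.+1)) / n.+1%:R ^+ 2.
    by rewrite quad_limMn; field; rewrite gt_eqF // ltr0n.
  rewrite normrM normfV distrC (@ger0_norm _ (_ ^+ 2)) ?sqr_ge0 //.
  rewrite /e; apply: ler_pM; rewrite ?invr_ge0 ?sqr_ge0 //; first exact: quad_lim_close.
  rewrite lef_pV2 ?posrE ?exprn_gt0 //.
  by rewrite expr2 ler_pMr // ler1n.
- by rewrite -[X in _ --> X]subr0; apply: cvgB => //; apply: cvg_cst.
by rewrite -[X in _ --> X]addr0; apply: cvgD => //; apply: cvg_cst.
Qed.

End QuadraticHeight.

(** * The canonical height of the curve and its distance [delta] to the Weil height *)

Section CanonicalHeight.
Import numFieldNormedType.Exports.
Local Open Scope classical_set_scope.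
Variables (R : realType) (a4 a6 : int) (hE : elliptic a4 a6).
Implicit Types P Q T V W : EC hE.

Lemma naive_height_gt0 V : 0 < (naive_height V)%:~R :> R.
Proof. by rewrite ltr0z (lt_le_trans _ (naive_height_ge1 V)). Qed.

Lemma weil_height_ge0 V : 0 <= weil_height R V.
Proof. by rewrite /weil_height ln_ge0 // ler1z naive_height_ge1. Qed.

Lemma weil_height0 : weil_height R (0 : EC hE) = 0.
Proof. by rewrite /weil_height /naive_height /= ln1. Qed.

Lemma weil_height_para : exists C : R, forall V W,
  `|weil_height R (V + W) + weil_height R (V - W)
    - 2 * weil_height R V - 2 * weil_height R W| <= C.
Proof.
have [c c0 cP] := naive_height_add_le hE; have [d d0 dP] := naive_height_dbl_ge hE.
have rpos (z : int) : 0 < z -> (z%:~R : R) \is Num.pos by move=> z0; rewrite posrE ltr0z.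
have hpos V : ((naive_height V)%:~R : R) \is Num.pos by rewrite posrE naive_height_gt0.
have upper V W : weil_height R (V + W) + weil_height R (V - W) <=
    ln c%:~R + 2 * weil_height R V + 2 * weil_height R W.
  have := cP V W; rewrite -(ler_int R) !(rmorphM, rmorphXn) /= => le.
  rewrite /weil_height -lnM //.
  have -> : ln c%:~R + 2 * ln (naive_height V)%:~R + 2 * ln (naive_height W)%:~R =
     ln (c%:~R * ((naive_height V)%:~R * (naive_height W)%:~R) ^+ 2) :> R.
    rewrite lnM ?rpos ?posrE ?exprn_gt0 ?mulr_gt0 ?naive_height_gt0 // ?ltr0z //.
    by rewrite lnXn ?mulr_gt0 ?naive_height_gt0 // lnM //; ring.
  by rewrite ler_ln // posrE ?mulr_gt0 ?exprn_gt0 ?mulr_gt0 ?naive_height_gt0 // ltr0z.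
have dbl V : 4 * weil_height R V <= ln d%:~R + weil_height R (V + V).
  have := dP V; rewrite -(ler_int R) !(rmorphM, rmorphXn) /= => le.
  rewrite /weil_height -lnM ?posrE ?naive_height_gt0 ?ltr0z //.
  have -> : 4 * ln (naive_height V)%:~R = ln ((naive_height V)%:~R ^+ 4) :> R.
    by rewrite lnXn ?naive_height_gt0 //; ring.
  by rewrite ler_ln // posrE ?exprn_gt0 ?mulr_gt0 ?naive_height_gt0 // ltr0z.
pose K : R := `|ln (c%:~R : R)| + `|ln (d%:~R : R)|.
exists K => V W; rewrite ler_norml /K.
(* The lower half of the parallelogram law is the upper half at V + W and V - W, whose sum and
   difference are 2V and 2W, combined with the lower bound for duplication. *)
have u1 := upper V W; have u2 := upper (V + W) (V - W).
have e1 : (V + W) + (V - W) = V + V by rewrite addrACA subrr addr0.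
have e2 : (V + W) - (V - W) = W + W by rewrite opprB addrACA addrC addrA addrNK.
rewrite e1 e2 in u2; have d1 := dbl V; have d2 := dbl W.
have n1 := ler_norm (ln c%:~R : R); have n2 := ler_norm (ln d%:~R : R).
have n3 := normr_ge0 (ln c%:~R : R); have n4 := normr_ge0 (ln d%:~R : R).
lra.
Qed.

Let height_const : {C : R | forall V W,
  `|weil_height R (V + W) + weil_height R (V - W)
    - 2 * weil_height R V - 2 * weil_height R W| <= C}.
Proof. exact: (cid weil_height_para). Qed.

Let C := sval height_const.
Let hC := svalP height_const.
Let L : EC hE -> R := quad_lim (fun V : EC hE => weil_height R V).

Lemma canonical_heightE V : canonical_height R V = 2^-1 * L V.
Proof.
rewrite /canonical_height; congr (_ * _).
have -> : (fun n => weil_height R (Emul n V) / n%:R ^+ 2) =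
          (fun n => weil_height R (V *+ n : EC hE) / n%:R ^+ 2).
  by apply/funext => n; rewrite (EmulE (hE := hE)).
exact/cvg_lim/(quad_lim_cvg hC).
Qed.

Lemma canonical_heightMz V (n : int) :
  canonical_height R (V *~ n : EC hE) = n%:~R ^+ 2 * canonical_height R V.
Proof. by rewrite !canonical_heightE /L (quad_limMz hC) mulrCA. Qed.

Lemma canonical_heightD V W :
  canonical_height R (V + W : EC hE) + canonical_height R (V - W : EC hE) =
  2 * canonical_height R V + 2 * canonical_height R W.
Proof.
by rewrite !canonical_heightE -mulrDr /L (quad_limD hC) mulrDr !(mulrCA _ 2).
Qed.

Lemma canonical_height_ge0 V : 0 <= canonical_height R V.
Proof.
rewrite canonical_heightE mulr_ge0 //.
have cv := quad_lim_cvg hC (x := V); rewrite -/L in cv.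
rewrite -(cvg_lim _ cv) //; apply: limr_ge; first by apply/cvg_ex; exists (L V).
by apply: nearW => n; rewrite divr_ge0 ?weil_height_ge0 ?sqr_ge0.
Qed.

Lemma canonical_height_torsion V T : Etor (T : Ept a4 a6) ->
  canonical_height R (V + T : EC hE) = canonical_height R V.
Proof.
move=> [n [n0]]; rewrite (EmulE (hE := hE)) => nT.
have n1 : (n%:~R : R) ^+ 2 != 0 by rewrite expf_neq0 // intr_eq0 -lt0n.
apply: (mulfI n1); rewrite -!canonical_heightMz; congr canonical_height.
by rewrite mulrzDl -[T *~ n]/(T *+ n) nT addr0.
Qed.

(** Boundedness is what makes the [sup] in [delta] an upper bound; attainment is not involved. *)
Let delta_ub : has_ubound
  (range (fun V => 2^-1 * weil_height R V - canonical_height R (V : EC hE))).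
Proof.
exists (C / 2 / 2) => _ [V _ <-].
have := quad_lim_close hC V; rewrite -/L canonical_heightE -/C ler_norml; lra.
Qed.

Lemma weil_height_le V :
  2^-1 * weil_height R V <= canonical_height R V + delta a4 a6 R.
Proof.
by rewrite -lerBlDl; apply: (ub_le_sup delta_ub); exists V.
Qed.

Lemma delta_ge0 : 0 <= delta a4 a6 R.
Proof.
have := weil_height_le (0 : EC hE).
by rewrite weil_height0 canonical_heightE /L (quad_lim0 hC) !mulr0 add0r.
Qed.

End CanonicalHeight.

(** * Binary quadratic forms *)

Section BinaryForms.
Local Open Scope classical_set_scope.
Implicit Types (f g : bqf) (M N : 'M[int]_2) (a b c p q r s x y m : int).

Lemma mulz_eq1 p s : p * s = 1 -> p = 1 /\ s = 1 \/ p = -1 /\ s = -1.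
Proof.
move=> e; have : (`|p| * `|s| == 1)%N by rewrite -abszM e.
rewrite muln_eq1 => /andP[/eqP hp /eqP hs].
have [ep|ep] : p = 1 \/ p = -1 by lia.
  by left; move: e; rewrite ep mul1r.
by right; move: e; rewrite ep mulN1r; lia.
Qed.

Lemma ord2P (i : 'I_2) : i = 0 \/ i = 1.
Proof. by case: i => [[|[|//]] h]; [left | right]; apply/val_inj. Qed.

Definition mx22 p q r s : 'M[int]_2 :=
  \matrix_(i, j) if i == 0 then (if j == 0 then p else q)
                 else (if j == 0 then r else s).

Lemma mx22E p q r s : ((mx22 p q r s 0 0 = p) * (mx22 p q r s 0 1 = q) *
  (mx22 p q r s 1 0 = r) * (mx22 p q r s 1 1 = s))%type.
Proof. by rewrite !mxE. Qed.

Lemma det_mx22 M : \det M = M 0 0 * M 1 1 - M 0 1 * M 1 0.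
Proof.
rewrite (expand_det_row _ 0) !big_ord_recl big_ord0 addr0.
rewrite /cofactor !det_mx11 !mxE /= expr0 mul1r expr1 mulN1r.
rewrite (_ : lift 0 0 = 1); last by apply/val_inj.
rewrite (_ : lift 1 0 = 0); last by apply/val_inj.
by rewrite mulrN.
Qed.

Lemma mulmx22 M N i j : (M *m N) i j = M i 0 * N 0 j + M i 1 * N 1 j.
Proof.
rewrite mxE !big_ord_recl big_ord0 addr0.
by rewrite (_ : lift 0 0 = 1) //; apply/val_inj.
Qed.

Lemma mx22_eta M : M = mx22 (M 0 0) (M 0 1) (M 1 0) (M 1 1).
Proof.
apply/matrixP => i j; rewrite mxE.
case: (ord2P i) => ->; case: (ord2P j) => -> //=.
Qed.

Lemma bqf_actM f M N : bqf_act (bqf_act f M) N = bqf_act f (M *m N).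
Proof.
case: f => [[a b] c]; rewrite /bqf_act !mulmx22.
by congr (_, _, _); ring.
Qed.

Lemma bqf_act1 f : bqf_act f 1%:M = f.
Proof.
case: f => [[a b] c]; rewrite /bqf_act !mxE /=.
by congr (_, _, _); ring.
Qed.

Lemma SL2Z_unit M : SL2Z M -> M \in unitmx.
Proof. by rewrite /SL2Z unitmxE /= => ->; rewrite unitr1. Qed.

Lemma SL2ZM M N : SL2Z M -> SL2Z N -> SL2Z (M *m N).
Proof. by rewrite /SL2Z /= det_mulmx => -> ->; rewrite mulr1. Qed.

Lemma SL2ZV M : SL2Z M -> SL2Z (invmx M).
Proof. by rewrite /SL2Z /= det_inv => ->; rewrite invr1. Qed.

Lemma bqf_class_act f M : SL2Z M -> bqf_class (bqf_act f M) = bqf_class f.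
Proof.
move=> hM; apply/seteqP; split=> _ [N hN <-].
  by exists (M *m N); [exact: SL2ZM | rewrite bqf_actM].
exists (invmx M *m N); first exact/SL2ZM/hN/SL2ZV.
by rewrite bqf_actM mulmxA mulmxV ?SL2Z_unit // mul1mx.
Qed.

Lemma bqf_class_refl f : bqf_class f f.
Proof. by exists 1%:M; [rewrite /SL2Z /= det1 | rewrite bqf_act1]. Qed.

Definition act4 f p q r s : bqf := let: (a, b, c) := f in
  (a * p ^+ 2 + b * p * r + c * r ^+ 2,
   2 * a * p * q + b * (p * s + q * r) + 2 * c * r * s,
   a * q ^+ 2 + b * q * s + c * s ^+ 2).

Lemma bqf_class_eqP f g : bqf_class f = bqf_class g ->
  exists p q r s, p * s - q * r = 1 /\ g = act4 f p q r s.
Proof.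
move=> e; have := bqf_class_refl g; rewrite -e => -[M].
rewrite /SL2Z /= det_mx22 => hM eg.
by exists (M 0 0), (M 0 1), (M 1 0), (M 1 1).
Qed.

Definition rigid f := forall p q r s,
  p * s - q * r = 1 -> act4 f p q r s = f -> q = 0 /\ r = 0.

(** The automorphisms are counted on the representative that [xget] picks. Conjugation by a matrix
    [M] leading from [f] to it carries them to automorphisms of [f], which are the identity up to
    sign. *)
Lemma rigid_aut f : rigid f -> bqf_class_aut (bqf_class f) = 1%N.
Proof.
move=> rf; rewrite /bqf_class_aut.
have := xgetPex (0, 0, 0) (ex_intro _ f (bqf_class_refl f)).
set g := xget _ _ => -[M hM eg].
suff -> : bqf_aut g = [set [set 1%:M; - 1%:M]].
  by rewrite fset_set1 cardfs1.
apply/seteqP; split=> [_ [N [hN eN] <-]|_ ->]; last first.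
  by exists 1%:M => //; split; [rewrite /SL2Z /= det1 | exact: bqf_act1].
have uM := SL2Z_unit hM.
pose K := M *m N *m invmx M.
have hK : SL2Z K by apply/SL2ZM/SL2ZV/hM/SL2ZM.
have eK : bqf_act f K = f.
  rewrite /K -bqf_actM -bqf_actM eg eN -eg bqf_actM.
  by rewrite mulmxV // bqf_act1.
have [q0 r0] : K 0 1 = 0 /\ K 1 0 = 0.
  apply: (rf (K 0 0) _ _ (K 1 1)); first by rewrite -det_mx22.
  by rewrite -[RHS]eK; case: (f) => [[a b] c].
have d1 : K 0 0 * K 1 1 = 1 by move: hK; rewrite /SL2Z /= det_mx22 q0 mul0r subr0.
have eN' : N = invmx M *m K *m M.
  by rewrite /K !mulmxA mulVmx // mul1mx -mulmxA mulVmx // mulmx1.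
have [k1|k1] : K = 1%:M \/ K = - 1%:M.
  case: (mulz_eq1 d1) => -[k k']; [left | right]; rewrite [LHS]mx22_eta k k' q0 r0;
    apply/matrixP => i j; rewrite !mxE;
    by case: (ord2P i) => ->; case: (ord2P j) => ->; rewrite ?oppr0.
- by rewrite eN' k1 mulmx1 mulVmx.
rewrite eN' k1 mulmxN mulmx1 mulNmx mulVmx // opprK.
by apply/seteqP; split=> x /=; tauto.
Qed.

(* Forms (a, 2 b, c) with a c - b ^ 2 = m: completing the square, a times a
   value at (p, r) is (a p + b r) ^ 2 + m r ^ 2. *)
Lemma cusp_act a b c p q r s m : 0 < m -> 0 < a -> a * c - b ^+ 2 = m -> p * s - q * r = 1 ->
    a * (a * p ^+ 2 + 2 * b * p * r + c * r ^+ 2) < m ->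
  r = 0 /\ p * s = 1.
Proof.
move=> m0 a0 em d lt.
have r0 : r = 0.
  apply/eqP; apply: contraTT lt => r0; rewrite -leNgt.
  have -> : a * (a * p ^+ 2 + 2 * b * p * r + c * r ^+ 2) =
    (a * p + b * r) ^+ 2 + m * r ^+ 2 by rewrite -em; ring.
  have r1 : 1 <= r ^+ 2 by rewrite -gtz0_ge1 exprn_even_gt0.
  by have := sqr_ge0 (a * p + b * r); nia.
by split=> //; rewrite -d r0 mulr0 subr0.
Qed.

(** The transforming matrix has r = 0, so it fixes the cusp at infinity: up to sign it is a
    translation, which preserves the first coefficient and moves [b] by a multiple of [a]. *)
Lemma cusp_class_eq a b c a' b' c' m : 0 < m -> 0 < a -> a * c - b ^+ 2 = m ->
    a * a' < m -> bqf_class (a, 2 * b, c) = bqf_class (a', 2 * b', c') ->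
  a' = a /\ (a %| b' - b)%Z.
Proof.
move=> m0 a0 em lt /bqf_class_eqP[p [q [r [s [d [e1 e2 _]]]]]].
have [r0 ps] : r = 0 /\ p * s = 1.
  by apply: (cusp_act m0 a0 em d); rewrite -e1.
have p2 : p ^+ 2 = 1.
  by case: (mulz_eq1 ps) => -[-> _].
split; first by rewrite e1 r0 p2; ring.
have -> : b' - b = a * (p * q).
  apply: (@mulfI _ 2) => //; rewrite mulrBr e2 r0.
  have -> : p * s + q * 0 = 1 by rewrite ps mulr0 addr0.
  by ring.
exact: dvdz_mulr.
Qed.

Lemma cusp_rigid a b c m : 0 < m -> 0 < a -> a * c - b ^+ 2 = m -> a ^+ 2 < m ->
  rigid (a, 2 * b, c).
Proof.
move=> m0 a0 em lt p q r s d [e1 e2 _].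
have [r0 ps] : r = 0 /\ p * s = 1.
  by apply: (cusp_act m0 a0 em d); rewrite e1 -expr2.
split=> //; move: e2; rewrite r0 mulr0 addr0 ps mulr1 => e2.
have p0 : p != 0 by apply/eqP => p0; move: ps; rewrite p0 mul0r.
have : 2 * a * p * q = 0 by clear - e2; lia.
by move/eqP; rewrite !mulf_eq0 (gt_eqF a0) (negbTE p0) /= => /eqP.
Qed.

(** * Reduced forms and their automorphisms *)

Lemma reduced_val a b c p r : `|b| <= a -> a <= c -> r != 0 ->
  c <= a * p ^+ 2 + b * p * r + c * r ^+ 2.
Proof.
move=> ba ac r0.
have r1 : 1 <= `|r| by rewrite -gtz0_ge1 normr_gt0.
have l : - (`|b| * `|p| * `|r|) <= b * p * r.
  by rewrite lerNl -!normrM -normrN ler_norm.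
rewrite -(real_normK (num_real p)) -(real_normK (num_real r)).
have P0 := normr_ge0 p; have b0 := normr_ge0 b.
move: (`|p|) (`|r|) (`|b|) (b * p * r) P0 r1 l ba b0 => P r' B X P0 r1 l ba b0.
have : c <= a * P ^+ 2 - B * P * r' + c * r' ^+ 2; last by lia.
have c0 : 0 <= c by lia.
case: (lerP r' P) => h.
  have h1 : 0 <= (a - B) * P * r' by rewrite !mulr_ge0 //; lia.
  have h2 : 0 <= a * P * (P - r') by rewrite !mulr_ge0 //; lia.
  have h3 : 0 <= c * (r' ^+ 2 - 1) by rewrite mulr_ge0 //; nia.
  by lia.
have h1 : 0 <= (c - B) * P * r' by rewrite !mulr_ge0 //; lia.
have h2 : 0 <= c * (r' * (r' - P) - 1) by rewrite mulr_ge0 //; nia.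
have h3 : 0 <= a * P ^+ 2 by rewrite mulr_ge0 ?sqr_ge0 //; lia.
by lia.
Qed.

(** The outer coefficients of a reduced form are its two successive minima, and those of any
    equivalent form are its values at the columns of an invertible matrix. *)
Lemma reduced_le a b c a' b' c' : 0 < a -> `|b| <= a -> a <= c ->
    bqf_class (a, b, c) = bqf_class (a', b', c') ->
  a <= a' /\ (a' <= c' -> c <= c').
Proof.
move=> a0 ba ac /bqf_class_eqP[p [q [r [s [d [e1 _ e3]]]]]].
have le1 : r != 0 -> c <= a' by rewrite e1; apply: reduced_val.
have le2 : s != 0 -> c <= c' by rewrite e3; apply: reduced_val.
split.
  case: (eqVneq r 0) => [r0|/le1]; last exact: le_trans.
  have p1 : 1 <= p ^+ 2.
    rewrite -gtz0_ge1 exprn_even_gt0 //=; apply: contra_eq_neq d => ->.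
    by rewrite r0 mulr0 mul0r.
  rewrite e1 r0 mulr0 expr0n mulr0 !addr0.
  by rewrite ler_peMr // ltW.
case: (eqVneq s 0) => [s0|/le2 //] le; apply: le_trans le.
by apply: le1; apply: contra_eq_neq d => ->; rewrite s0 !mulr0.
Qed.

Lemma reduced_rigid a b c : 0 < a -> `|b| <= a -> a < c -> rigid (a, b, c).
Proof.
move=> a0 ba ac p q r s d [e1 e2 _].
have r0 : r = 0.
  have ac' := ltW ac; apply/eqP; apply: contraTT ac => r0; rewrite -leNgt.
  by rewrite -{1}e1; apply: reduced_val.
move: d e2; rewrite r0 !(mulr0, mul0r, subr0, addr0) => ps.
rewrite ps mulr1 => e2; split=> //.
have p0 : p != 0 by apply/eqP => p0; move: ps; rewrite p0 mul0r.
have : 2 * a * p * q = 0 by clear - e2; lia.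
by move/eqP; rewrite !mulf_eq0 (gt_eqF a0) (negbTE p0) /= => /eqP.
Qed.

(** With equal outer coefficients the minimum [a] is attained at both basis vectors, so a rotation
    by a right angle is possible as well. It replaces b by - b and is excluded by 0 < b. *)
Lemma symmetric_rigid a b : 0 < b -> b < a -> rigid (a, b, a).
Proof.
move=> b0 ba p q r s d [e1 e2 e3].
have a0 : 0 <= a by lia.
have ab0 : 0 <= 2 * a - b by lia.
have key x y : a * x ^+ 2 + b * x * y + a * y ^+ 2 = a -> x * y = 0.
  clear e1 e2 e3 d.
  move=> e; apply/eqP; apply: contraPT e => n0.
  have n1 : 1 <= `|x * y| by rewrite -gtz0_ge1 normr_gt0.
  have h : - (b * `|x * y|) <= b * (x * y).
    by rewrite -mulrN ler_pM2l // lerNl -normrN ler_norm.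
  have h2 : 2 * `|x * y| <= x ^+ 2 + y ^+ 2.
    rewrite normrM -(real_normK (num_real x)) -(real_normK (num_real y)).
    by have := sqr_ge0 (`|x| - `|y|); lia.
  have h3 : a * (2 * `|x * y|) <= a * (x ^+ 2 + y ^+ 2) by rewrite ler_wpM2l.
  have h4 : (2 * a - b) * 1 <= (2 * a - b) * `|x * y| by rewrite ler_wpM2l.
  apply/eqP; rewrite gt_eqF //; move: (`|x * y|) (x ^+ 2) (y ^+ 2) h h3 h4 => n X Y h h3 h4.
  by rewrite -mulrA; move: (b * (x * y)) h; lia.
have pr := key _ _ e1; have qs := key _ _ e3.
case: (eqVneq r 0) => [r0|r0].
  move: d e2; rewrite r0 !(mulr0, mul0r, subr0, addr0) => ps.
  rewrite ps mulr1 => e2; split=> //.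
  have p0 : p != 0 by apply/eqP => p0; move: ps; rewrite p0 mul0r.
  have a1 : 0 < a by apply: lt_trans ba.
  have : 2 * a * p * q = 0 by clear - e2; lia.
  by move/eqP; rewrite !mulf_eq0 (gt_eqF a1) (negbTE p0) /= => /eqP.
have p0 : p = 0 by move/eqP: pr; rewrite mulf_eq0 (negbTE r0) orbF => /eqP.
have qr : q * r = -1 by move/eqP: d; rewrite p0 mul0r sub0r eqr_oppLR => /eqP.
have s0 : s = 0.
  move/eqP: qs; rewrite mulf_eq0 => /orP[]/eqP // q0.
  by move: qr; rewrite q0 mul0r.
by move: e2; rewrite p0 s0 !(mulr0, mul0r) !add0r addr0 qr; clear - b0; lia.
Qed.

(** * Reduction, finiteness of the set of classes, and the class number *)

Lemma bqf_disc_act f M : SL2Z M -> bqf_disc (bqf_act f M) = bqf_disc f.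
Proof.
case: f => [[a b] c]; rewrite /SL2Z /= det_mx22 => hM.
transitivity ((b ^+ 2 - 4 * a * c) * (M 0 0 * M 1 1 - M 0 1 * M 1 0) ^+ 2); first by ring.
by rewrite hM expr1n mulr1.
Qed.

Lemma bqf_posdef_act f M : SL2Z M -> bqf_posdef f -> bqf_posdef (bqf_act f M).
Proof.
rewrite /SL2Z /= det_mx22 => hM pf x y xy; rewrite bqf_actE; apply: pf.
apply: contraNneq xy => -[h1 h2]; apply/eqP; congr (_, _).
  transitivity (M 1 1 * (M 0 0 * x + M 0 1 * y) - M 0 1 * (M 1 0 * x + M 1 1 * y)).
    by transitivity ((M 0 0 * M 1 1 - M 0 1 * M 1 0) * x); [rewrite hM mul1r | ring].
  by rewrite h1 h2 !mulr0 subr0.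
transitivity (M 0 0 * (M 1 0 * x + M 1 1 * y) - M 1 0 * (M 0 0 * x + M 0 1 * y)).
  by transitivity ((M 0 0 * M 1 1 - M 0 1 * M 1 0) * y); [rewrite hM mul1r | ring].
by rewrite h1 h2 !mulr0 subr0.
Qed.

Lemma bqf_reduce f : bqf_posdef f -> exists a b c,
  [/\ 0 < a, `|b| <= a, a <= c, bqf_disc (a, b, c) = bqf_disc f &
      bqf_class (a, b, c) = bqf_class f].
Proof.
case: f => [[a b] c]; have [n] := ubnP `|a|%N.
elim: n a b c => // n IH a b c; rewrite ltnS => an pf.
have a0 : 0 < a.
  by have := pf 1 0 isT; rewrite /= expr1n expr0n /=; lia.
have [k hk] : exists k : int, `|b + 2 * a * k| <= a.
  have a2 : 0 < 2 * a by lia.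
  exists (- ((b + a) %/ (2 * a))%Z).
  have := divz_eq (b + a) (2 * a); have := modz_ge0 (b + a) (lt0r_neq0 a2).
  have := ltz_pmod (b + a) a2; move: (_ %/ _)%Z (_ %% _)%Z => u v.
  by rewrite ler_norml; lia.
pose M := mx22 1 k 0 1.
have hM : SL2Z M by rewrite /SL2Z /= det_mx22 !mx22E; ring.
pose b1 := b + 2 * a * k; pose c1 := a * k ^+ 2 + b * k + c.
have eM : bqf_act (a, b, c) M = (a, b1, c1).
  by rewrite /bqf_act !mx22E; congr (_, _, _); rewrite /b1 /c1; ring.
have pf1 : bqf_posdef (a, b1, c1) by rewrite -eM; apply: bqf_posdef_act.
have e1 : bqf_class (a, b1, c1) = bqf_class (a, b, c) by rewrite -eM bqf_class_act.
have d1 : bqf_disc (a, b1, c1) = bqf_disc (a, b, c) by rewrite -eM bqf_disc_act.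
case: (lerP a c1) => ac; first by exists a, b1, c1.
have c0 : 0 < c1.
  by have := pf1 0 1 isT; rewrite /= expr1n expr0n /=; lia.
pose N := mx22 0 (-1) 1 0.
have hN : SL2Z N by rewrite /SL2Z /= det_mx22 !mx22E; ring.
have eN : bqf_act (a, b1, c1) N = (c1, - b1, a).
  by rewrite /bqf_act !mx22E; congr (_, _, _); ring.
have [||a' [b' [c' [h1 h2 h3 h4 h5]]]] := IH c1 (- b1) a.
- by lia.
- by rewrite -eN; apply: bqf_posdef_act.
exists a', b', c'; split=> //.
  by rewrite h4 -eN bqf_disc_act.
by rewrite h5 -eN bqf_class_act.
Qed.

(** A reduced form satisfies 3 a c <= |D|, so its coefficients lie in a box. Finiteness lets the sum
    over a set in [hurwitz] be read as an ordinary finite sum. *)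
Lemma bqf_classes_finite (D : int) : D < 0 -> finite_set (bqf_classes D).
Proof.
move=> D0; pose n := `|D|%N.
pose box := [set: 'I_(n + n).+1 * 'I_(n + n).+1 * 'I_(n + n).+1].
pose F (u : 'I_(n + n).+1 * 'I_(n + n).+1 * 'I_(n + n).+1) : set bqf :=
  bqf_class ((u.1.1 : nat)%:Z - n%:Z, (u.1.2 : nat)%:Z - n%:Z, (u.2 : nat)%:Z - n%:Z).
apply: (@sub_finite_set _ _ (F @` box)); last exact/finite_image/finite_finset.
move=> _ [f [pf df] <-].
have [a [b [c [a0 ba ac dd <-]]]] := bqf_reduce pf.
rewrite df /= in dd.
have b2 : b ^+ 2 <= a ^+ 2 by rewrite -(real_normK (num_real b)) lerXn2r ?nnegrE //; lia.
have acn : a <= n%:Z /\ c <= n%:Z by rewrite /n; nia.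
have ord (z : int) : `|z| <= n%:Z -> {u : 'I_(n + n).+1 | (u : nat)%:Z - n%:Z = z}.
  move=> hz; have hl : (absz (z + n%:Z)%R < (n + n).+1)%N by clear - hz; lia.
  by exists (Ordinal hl) => /=; clear - hz; lia.
have [|u1 e1] := ord a; first by clear - a0 ba ac acn; lia.
have [|u2 e2] := ord b; first by clear - a0 ba ac acn; lia.
have [|u3 e3] := ord c; first by clear - a0 ba ac acn; lia.
by exists (u1, u2, u3) => //; rewrite /F /= e1 e2 e3.
Qed.

Lemma form_class_mem a b c m : 0 < m -> 0 < a -> a * c - b ^+ 2 = m ->
  bqf_classes (- (4 * m)) (bqf_class (a, 2 * b, c)).
Proof.
move=> m0 a0 em; exists (a, 2 * b, c) => //; split; last by rewrite /= -em; ring.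
move=> x y xy /=; rewrite -(pmulr_rgt0 _ a0).
have -> : a * (a * x ^+ 2 + 2 * b * x * y + c * y ^+ 2) =
  (a * x + b * y) ^+ 2 + m * y ^+ 2 by rewrite -em; ring.
case: (eqVneq y 0) => [y0|y0].
  have x1 : x != 0 by apply: contra xy => /eqP ->; rewrite y0.
  have -> : (a * x + b * y) ^+ 2 + m * y ^+ 2 = (a * x) ^+ 2 by rewrite y0; ring.
  by rewrite exprn_even_gt0 //= mulf_neq0 // gt_eqF.
by rewrite ltr_wpDl ?sqr_ge0 // mulr_gt0 // exprn_even_gt0.
Qed.

Lemma hurwitz_ge (R : realType) (D : int) (X : {fset (set bqf)}) : D < 0 ->
    (forall C, C \in X -> bqf_classes D C /\ bqf_class_aut C = 1%N) ->
  (#|` X|%:R : R) <= hurwitz R D.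
Proof.
move=> D0 hX; have fD := bqf_classes_finite D0.
rewrite /hurwitz fsbig_finite //=.
have sub : (X `<=` fset_set (bqf_classes D))%fset.
  by apply/fsubsetP => C /hX[h _]; rewrite in_fset_set // inE.
rewrite (big_fsetID _ (mem X)) /=.
rewrite (_ : [fset x in fset_set (bqf_classes D) | x \in X]%fset = X); last first.
  apply/fsetP => C; rewrite !inE /= andbC; case: (boolP (C \in X)) => //= CX.
  exact: (fsubsetP sub).
rewrite -[X in X <= _]addr0; apply: lerD; last first.
  by apply: sumr_ge0 => C _; rewrite invr_ge0.
rewrite (eq_big_seq (fun=> 1)); last by move=> C /hX[_ ->]; rewrite invr1.
by rewrite big_const_seq count_predT iter_addr_0 cardfE.
Qed.

End BinaryForms.

(** * Integral coordinates and chords *)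

Section IntegralCoordinates.
Variables (a4 a6 : int) (hE : elliptic a4 a6).
Implicit Types P Q V W U : EC hE.

Definition ynum V : int := if val V is Some (_, y) then numq y else 1.
(** The denominators of y and x are C^3 and C^2, so their quotient is C. With the default values the
    point at infinity is (A, B, C) = (1, 1, 0), which satisfies the integral equation [curve_eq]. *)
Definition xysqrt V : int :=
  if val V is Some (x, y) then (denq y %/ denq x)%Z else 0.

Local Notation A := xnum.
Local Notation B := ynum.
Local Notation C := xysqrt.

Lemma point_affine V : V != 0 ->
  [/\ 0 < C V, xden V = C V ^+ 2, coprimez (A V) (C V), coprimez (B V) (C V) &
  val V = Some ((A V)%:~R / (C V)%:~R ^+ 2, (B V)%:~R / (C V)%:~R ^+ 3)].
Proof.
case eV: (val V) => [[x y]|] V0; last by case/eqP: V0; apply/val_inj.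
have [a [b [c [c0 ca cb ex ey]]]] := naive_heightP eV.
wlog cp : b c c0 ca cb ex ey / 0 < c.
  move=> H; case: (ltrP 0 c) => cp; first exact: (H b c).
  apply: (H (- b) (- c)); rewrite ?oppr_eq0 ?coprimezN ?coprimeNz //.
  - by rewrite rmorphN /= sqrrN.
  - by rewrite !rmorphN /= ey; field; rewrite intr_eq0.
  by rewrite oppr_gt0 lt_neqAle c0.
have c2 : coprime `|a| `|c ^+ 2| by rewrite abszX coprimeXr.
have c3 : coprime `|b| `|c ^+ 3| by rewrite abszX coprimeXr.
have C2 : 0 < c ^+ 2 by rewrite exprn_gt0.
have C3 : 0 < c ^+ 3 by rewrite exprn_gt0.
have dx : denq x = c ^+ 2.
  by rewrite ex -rmorphXn /= coprimeq_den // gt_eqF // gtr0_norm.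
have dy : denq y = c ^+ 3.
  by rewrite ey -rmorphXn /= coprimeq_den // gt_eqF // gtr0_norm.
have nx : numq x = a.
  by rewrite ex -rmorphXn /= coprimeq_num // gtr0_sg // mul1r.
have ny : numq y = b.
  by rewrite ey -rmorphXn /= coprimeq_num // gtr0_sg // mul1r.
have eC : C V = c.
  by rewrite /C eV dx dy exprSr mulKz // gt_eqF.
have eA : A V = a by rewrite /A eV nx.
have eB : B V = b by rewrite /B eV ny.
by rewrite eC eA eB /xden eV dx -ex -ey; split.
Qed.

Lemma ynum0 : [/\ A (0 : EC hE) = 1, B (0 : EC hE) = 1, C (0 : EC hE) = 0 & xden (0 : EC hE) = 0].
Proof. by []. Qed.

Lemma xysqrt_ge0 V : 0 <= C V.
Proof. by case: (eqVneq V 0) => [->|/point_affine[/ltW]]. Qed.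

Lemma xysqrt_eq0 V : (C V == 0) = (V == 0).
Proof.
by case: (eqVneq V 0) => [->//|/point_affine[c0 _ _ _ _]]; rewrite gt_eqF.
Qed.

Lemma xden_sqr V : xden V = C V ^+ 2.
Proof. by case: (eqVneq V 0) => [->//|/point_affine[]]. Qed.

Lemma coprime_xC V : coprimez (A V) (C V).
Proof. by case: (eqVneq V 0) => [->//|/point_affine[]]. Qed.

Lemma coprime_yC V : coprimez (B V) (C V).
Proof. by case: (eqVneq V 0) => [->//|/point_affine[]]. Qed.

Lemma curve_eq V :
  B V ^+ 2 = A V ^+ 3 + a4 * A V * C V ^+ 4 + a6 * C V ^+ 6.
Proof.
case: (eqVneq V 0) => [->|V0].
  by have [-> -> -> _] := ynum0; rewrite !expr1n; ring.
have [c0 _ _ _ eV] := point_affine V0.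
have := valP V; rewrite eV /= => /eqP e.
have cr : (C V)%:~R != 0 :> rat by rewrite intr_eq0 gt_eqF.
apply: (@intr_inj rat); rewrite !(rmorphD, rmorphM, rmorphXn) /=.
move: (A V)%:~R (B V)%:~R (C V)%:~R cr e => x y c cr e.
transitivity ((y / c ^+ 3) ^+ 2 * c ^+ 6); first by field.
by rewrite e; field.
Qed.

Lemma naive_height_xC V : naive_height V = Num.max `|A V| (C V ^+ 2).
Proof. by rewrite naive_height_xE xden_sqr. Qed.

Lemma pointN V : ((A (- V) = A V) * (B (- V) = if V == 0 then 1 else - B V) * (C (- V) = C V))%type.
Proof.
rewrite !xN /C /B val_EN; case: (eqVneq V 0) => [->//|V0].
case eV: (val V) => [[x y]|] /=; last by case/eqP: V0; apply/val_inj.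
by rewrite numqN denqN.
Qed.

Lemma point_eq V W : A V = A W -> C V = C W -> B V = B W -> V = W.
Proof.
move=> eA eC eB; apply/val_inj.
case: (eqVneq V 0) => [V0|V0].
  by have := xysqrt_eq0 W; rewrite -eC V0 eqxx => /esym/eqP ->.
have W0 : W != 0 by rewrite -xysqrt_eq0 -eC xysqrt_eq0.
have [_ _ _ _ ->] := point_affine V0; have [_ _ _ _ ->] := point_affine W0.
by rewrite eA eB eC.
Qed.

Lemma point_eqN V W : A V = A W -> C V = C W -> V = W \/ V = - W.
Proof.
move=> eA eC; have := curve_eq V; rewrite eA eC -curve_eq => /eqP.
rewrite eqf_sqr => /orP[]/eqP eB; first by left; apply: point_eq.
case: (eqVneq W 0) => [W0|W0].
  by left; have := xysqrt_eq0 V; rewrite eC W0 eqxx => /esym/eqP.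
by right; apply: point_eq; rewrite !pointN // (negbTE W0).
Qed.

Variables t m : int.
Hypothesis hm : m = t ^+ 3 + a4 * t - a6.

(** The numerator of x(V) + t, that is, of the distance to the abscissa at which the cubic takes the
    value - m. *)
Definition alpha V : int := A V + t * C V ^+ 2.

Lemma alphaN V : alpha (- V) = alpha V.
Proof. by rewrite /alpha !pointN. Qed.

Lemma coprime_alphaC V : coprimez (alpha V) (C V).
Proof.
rewrite /alpha coprimez_sym /coprimez expr2 mulrA addrC gcdzMDl -/(coprimez _ _).
by rewrite coprimez_sym coprime_xC.
Qed.

(** The cubic plus m vanishes at - t, hence is divisible by x + t. Modulo [alpha] this makes - m the
    square of B / C^3. *)
Lemma alpha_curve V : B V ^+ 2 + m * C V ^+ 6 =
  alpha V * (A V ^+ 2 - A V * t * C V ^+ 2 + (t ^+ 2 + a4) * C V ^+ 4).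
Proof. by rewrite curve_eq /alpha hm; ring. Qed.

Lemma rat_int_of_sqr (x : rat) (n : int) : x ^+ 2 = n%:~R -> exists k : int, x = k%:~R.
Proof.
move=> e; exists (numq x); suff d1 : denq x = 1 by rewrite -[LHS]divq_num_den d1 divr1.
have e2 : numq x ^+ 2 = n * denq x ^+ 2.
  apply: (@intr_inj rat); rewrite !(rmorphXn, rmorphM) /= -e -exprMn.
  by rewrite -{2}(divq_num_den x) divfK // intr_eq0 denq_neq0.
have cx : coprimez (denq x) (numq x ^+ 2).
  by rewrite coprimezXr // coprimezE coprime_sym coprime_num_den.
have : (denq x %| 1)%Z.
  rewrite -(Gauss_dvdzr _ cx) mulr1 e2 expr2.
  by apply: dvdz_mull; apply: dvdz_mull.
rewrite dvdzE dvdn1 => /eqP d1.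
by rewrite -(gez0_abs (denq_ge0 x)) d1.
Qed.

(* The chord through V and W meets the curve again in - (V + W); n and k are
   its value at x = - t and its slope, cleared of denominators. *)
Lemma chord V W : V != 0 -> W != 0 -> V != W -> V != - W ->
  let U := V + W in let c := C U * C V * C W in
  exists n k : int,
  [/\ n ^+ 2 + m * c ^+ 2 = alpha U * alpha V * alpha W,
      C V ^+ 2 * n = C U * C W * B V - k * alpha V,
      C W ^+ 2 * n = C U * C V * B W - k * alpha W &
      C U ^+ 2 * n = - (C V * C W * B U) - k * alpha U].
Proof.
move=> V0 W0 VW VNW U c.
have U0 : U != 0 by rewrite /U addr_eq0.
have [cV _ _ _ eV] := point_affine V0; have [cW _ _ _ eW] := point_affine W0.
have [cU _ _ _ eU] := point_affine U0.
have := val_ED V W; rewrite -/U eU eV eW.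
have := valP V; have := valP W; rewrite eV eW.
have r0 (P : EC hE) : 0 < C P -> (C P)%:~R != 0 :> rat by move=> ?; rewrite intr_eq0 gt_eqF.
have [cV0 cW0 cU0] := And3 (r0 _ cV) (r0 _ cW) (r0 _ cU).
set x1 := (A V)%:~R / _; set y1 := (B V)%:~R / _.
set x2 := (A W)%:~R / _; set y2 := (B W)%:~R / _.
set x3 := (A U)%:~R / _; set y3 := (B U)%:~R / _ => /eqP hW /eqP hV.
have nx : x1 != x2.
  apply/eqP => ex; have /eqP : y1 ^+ 2 = y2 ^+ 2 by rewrite hV hW ex.
  rewrite eqf_sqr => /orP[]/eqP ey.
    by case/eqP: VW; apply/val_inj; rewrite eV eW -/x1 -/y1 ex ey.
  by case/eqP: VNW; apply/val_inj; rewrite val_EN eV eW -/x1 -/y1 ex ey.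
rewrite /Eadd_raw (negbTE nx) /= => -[e3 f3].
have d0 : x2 - x1 != 0 by rewrite subr_eq0 eq_sym.
pose l := (y2 - y1) / (x2 - x1); rewrite -/l in e3 f3.
pose N := y1 - l * (x1 + t%:~R).
have hy2 : y2 = y1 + l * (x2 - x1) by rewrite /l; field.
have ea : a4%:~R = l * (y1 + y2) - (x1 ^+ 2 + x1 * x2 + x2 ^+ 2) :> rat.
  have h : l * (y1 + y2) * (x2 - x1) = (x1 ^+ 2 + x1 * x2 + x2 ^+ 2 + a4%:~R) * (x2 - x1).
    transitivity (y2 ^+ 2 - y1 ^+ 2); first by rewrite /l; field.
    by rewrite hV hW; ring.
  by rewrite (mulIf d0 h); ring.
have eb : a6%:~R = y1 ^+ 2 - x1 ^+ 3 - a4%:~R * x1 :> rat by rewrite hV; ring.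
(* The cubic minus the square of the line is (x - x1) (x - x2) (x - x3). At - t the cubic is - m and
   the line is [N]. *)
have eN : N ^+ 2 + m%:~R = (x3 + t%:~R) * (x1 + t%:~R) * (x2 + t%:~R).
  rewrite hm !(rmorphB, rmorphD, rmorphM, rmorphXn) /= eb ea hy2 e3 /N; ring.
have eal (P : EC hE) : 0 < C P -> (A P)%:~R / (C P)%:~R ^+ 2 + t%:~R =
    (alpha P)%:~R / (C P)%:~R ^+ 2 :> rat.
  by move=> /r0 cP; rewrite /alpha !(rmorphD, rmorphM, rmorphXn) /=; field.
have [x1E x2E x3E] := And3 (eal _ cV) (eal _ cW) (eal _ cU).
rewrite -/x1 in x1E; rewrite -/x2 in x2E; rewrite -/x3 in x3E.
move: (alpha V) (alpha W) (alpha U) x1E x2E x3E => aV aW aU x1E x2E x3E.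
have cE : c%:~R = (C U)%:~R * (C V)%:~R * (C W)%:~R :> rat by rewrite /c !rmorphM.
clearbody c.
(* Both [c * N] and, below, [c * l] are rationals whose squares are integers, hence are integers
   themselves. *)
have [n en] : exists n : int, c%:~R * N = n%:~R.
  apply: (@rat_int_of_sqr _ (aU * aV * aW - m * c ^+ 2)).
  rewrite !(rmorphB, rmorphM, rmorphXn) /= exprMn.
  have -> : N ^+ 2 = (x3 + t%:~R) * (x1 + t%:~R) * (x2 + t%:~R) - m%:~R.
    by rewrite -eN; ring.
  by rewrite x1E x2E x3E cE; field; rewrite cV0 cW0 cU0.
have [k ek] : exists k : int, c%:~R * l = k%:~R.
  apply: (@rat_int_of_sqr _ (A U * (C V * C W) ^+ 2 + A V * (C U * C W) ^+ 2
                             + A W * (C U * C V) ^+ 2)).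
  rewrite !(rmorphD, rmorphM, rmorphXn) /= exprMn.
  have -> : l ^+ 2 = x3 + x1 + x2 by rewrite e3; ring.
  by rewrite cE /x1 /x2 /x3; field; rewrite cV0 cW0 cU0.
have N1 : N = y1 - l * (x1 + t%:~R) by [].
have N2 : N = y2 - l * (x2 + t%:~R) by rewrite hy2 /N; ring.
have N3 : N = - y3 - l * (x3 + t%:~R) by rewrite f3 e3 /N; ring.
exists n, k; split; apply: (@intr_inj rat);
  rewrite !(rmorphN, rmorphB, rmorphD, rmorphM, rmorphXn) /= -?en -?ek.
- have -> : (c%:~R * N) ^+ 2 + m%:~R * c%:~R ^+ 2 = c%:~R ^+ 2 * (N ^+ 2 + m%:~R) by ring.
  by rewrite eN x1E x2E x3E cE; field; rewrite cV0 cW0 cU0.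
- by rewrite N1 x1E cE /y1; field; rewrite cV0.
- by rewrite N2 x2E cE /y2; field; rewrite cW0.
by rewrite N3 x3E cE /y3; field; rewrite cU0.
Qed.

End IntegralCoordinates.

(** * Inequalities between the heights of two points and their sum *)

Section Inequality.
Variable F : realFieldType.
Implicit Types t x y P Q r M k d : F.

(** In the application P and Q are the denominators C^2 of the abscissas x and y. The constant 4
    comes from M^2 / P^2 < 2 k Q / P <= 4 k; the 9 is 2 times 9/2, the largest value of (P + Q)^2 /
    (P Q) when the ratio of P and Q is at most 2. *)
Lemma close_ratio P Q M x y k : 0 < P -> 0 < Q -> P <= 2 * Q -> Q <= 2 * P ->
    `|x| * P <= M -> `|y| * Q <= M -> M ^+ 2 < 2 * P * Q * k ->
  [/\ x ^+ 2 < 4 * k, y ^+ 2 < 4 * k & (x - y) ^+ 2 < 9 * k].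
Proof.
move=> P0 Q0 PQ QP hx hy hM.
have M0 : 0 <= M by apply: le_trans hx; rewrite mulr_ge0 // ltW.
have PQ0 : 0 < P * Q by rewrite mulr_gt0.
have k0 : 0 < k.
  have : 0 < 2 * P * Q * k by apply: le_lt_trans hM; exact: sqr_ge0.
  by rewrite pmulr_rgt0 // !mulr_gt0.
have hx2 : x ^+ 2 * P ^+ 2 <= M ^+ 2.
  rewrite -(real_normK (num_real x)) -exprMn lerXn2r ?nnegrE ?mulr_ge0 //; exact: ltW.
have hy2 : y ^+ 2 * Q ^+ 2 <= M ^+ 2.
  rewrite -(real_normK (num_real y)) -exprMn lerXn2r ?nnegrE ?mulr_ge0 //; exact: ltW.
have q1 : 0 <= 2 * P - Q by rewrite subr_ge0.
have q2 : 0 <= 2 * Q - P by rewrite subr_ge0.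
have hPk : 2 * P * Q * k <= 4 * k * P ^+ 2.
  have : 0 <= (2 * P - Q) * P * k by apply: mulr_ge0; [apply: mulr_ge0|]; rewrite // ltW.
  lra.
have hQk : 2 * P * Q * k <= 4 * k * Q ^+ 2.
  have : 0 <= (2 * Q - P) * Q * k by apply: mulr_ge0; [apply: mulr_ge0|]; rewrite // ltW.
  lra.
split.
- by rewrite -(ltr_pM2r (exprn_gt0 2 P0)); lra.
- by rewrite -(ltr_pM2r (exprn_gt0 2 Q0)); lra.
have hd : `|x - y| * (P * Q) <= M * (P + Q).
  apply: (@le_trans _ _ ((`|x| + `|y|) * (P * Q))).
    by apply: ler_wpM2r; [exact: ltW | exact: ler_normB].
  have h1 : `|x| * P * Q <= M * Q by rewrite ler_wpM2r // ltW.
  have h2 : `|y| * Q * P <= M * P by rewrite ler_wpM2r // ltW.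
  lra.
have hd2 : (x - y) ^+ 2 * (P * Q) ^+ 2 <= M ^+ 2 * (P + Q) ^+ 2.
  have S1 : 0 <= P + Q by rewrite addr_ge0 // ltW.
  rewrite -(real_normK (num_real (x - y))) -!exprMn lerXn2r // nnegrE mulr_ge0 //.
  exact: ltW.
have hs : (P + Q) ^+ 2 <= 9 / 2 * (P * Q).
  have : 0 <= (2 * P - Q) * (2 * Q - P) by rewrite mulr_ge0.
  lra.
have S0 : 0 < (P + Q) ^+ 2 by rewrite exprn_gt0 // addr_gt0.
rewrite -(ltr_pM2r (exprn_gt0 2 PQ0)).
apply: le_lt_trans hd2 _.
apply: (@lt_le_trans _ _ (2 * P * Q * k * (P + Q) ^+ 2)); first by rewrite ltr_pM2r.
have -> : 9 * k * (P * Q) ^+ 2 = 2 * P * Q * k * (9 / 2 * (P * Q)) by field.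
by rewrite ler_wpM2l // -!mulrA !mulr_ge0 // ltW.
Qed.

(** Since 4 k <= (1 + k)^2, both x and y are at most 1 + k. Expanding the product then gives k (t^2
    - 3) < t^2 + 2 t, so k exceeds 1 by about 2 / t at most. *)
Lemma product_bound t x y k : 466 <= t -> x ^+ 2 < 4 * k -> y ^+ 2 < 4 * k ->
    (t + x) * (t + y) = k * (t + 1) ^+ 2 ->
  k <= 503 / 500.
Proof.
move=> t4 hx hy e.
have k0 : 0 < k by have := sqr_ge0 x; lra.
have b (z : F) : z ^+ 2 < 4 * k -> z <= 1 + k.
  move=> hz; rewrite leNgt; apply/negP => lt.
  have : (1 + k) ^+ 2 < z ^+ 2 by rewrite ltrXn2r ?nnegrE //; lra.
  by have := sqr_ge0 (1 - k); lra.
have bx := b x hx; have by_ := b y hy.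
have xy : x * y < 4 * k by have := sqr_ge0 (x - y); lra.
have h1 : t * (x + y) <= t * (2 * (1 + k)) by rewrite ler_wpM2l //; lra.
have h2 : k * (t ^+ 2 - 3) < t ^+ 2 + 2 * t by lra.
rewrite leNgt; apply/negP => lt.
have t2 : 400 * t <= t ^+ 2 by rewrite expr2 ler_wpM2r //; lra.
have : 503 / 500 * (t ^+ 2 - 3) < k * (t ^+ 2 - 3) by rewrite ltr_pM2r //; lra.
lra.
Qed.

Lemma low_bound t x y r : 466 <= t -> - (201 / 100) <= x <= 201 / 100 ->
    - (201 / 100) <= y <= 201 / 100 -> r <= 17 / 20 * t ->
  12 / 100 * t ^+ 2 <= (t + x) * (3 * t - (t + x) - (t + y)) - r * (t + y).
Proof.
move=> t4 /andP[x1 x2] /andP[y1 y2] hr.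
have [g eg] : exists g, g = t - r by exists (t - r).
have g0 : 15 / 100 * t <= g by rewrite eg; clear - hr; lra.
have -> : (t + x) * (3 * t - (t + x) - (t + y)) - r * (t + y) =
    g * (t + y) - 2 * t * y - (x ^+ 2 + x * y) by rewrite eg; ring.
have h0 : 0 <= g by clear - g0 t4; lra.
have ty : t - 201 / 100 <= t + y by clear - y1; lra.
have h1 := ler_wpM2l h0 ty.
have t2 : 0 <= t - 201 / 100 by clear - t4; lra.
have h2 := ler_wpM2r t2 g0.
have t0 : 0 <= t by clear - t4; lra.
have h3 := ler_wpM2l t0 y2.
have h4 : x ^+ 2 + x * y <= 9.
  have a1 : 0 <= (201 / 100 - x) * (201 / 100 + x) by apply: mulr_ge0; clear - x1 x2; lra.
  have a2 : 0 <= (201 / 100 - y) * (201 / 100 + y) by apply: mulr_ge0; clear - y1 y2; lra.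
  have a3 := sqr_ge0 (x - y); clear - a1 a2 a3; lra.
have h5 := ler_wpM2r t0 t4.
clear - h1 h2 h3 h4 h5 t4; lra.
Qed.

(** The origin of the threshold 466. The right side is at most 1003/1000 * 736/1000 * 9 * 503/500 *
    t^3, and the square of 12/100 times t^4 exceeds this once t > 464.2. *)
Lemma up_bound t s e : 466 <= t -> 0 <= s -> s <= 856 / 1000 * t -> 0 <= e -> e <= 9 * (503 / 500) ->
  (12 / 100 * t ^+ 2) ^+ 2 <= (t + 1) * (t + s ^+ 2) * e -> False.
Proof.
move=> t4 s0 s1 e0 e1 h.
have t0 : 0 <= t by clear - t4; lra.
have tt := ler_wpM2r t0 t4.
have s2 : s ^+ 2 <= 856 / 1000 * t * (856 / 1000 * t) by rewrite expr2; exact: (ler_pM s0 s0 s1 s1).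
have a1 : t + s ^+ 2 <= 736 / 1000 * t ^+ 2 by clear - s2 tt t4; lra.
have a2 : t + 1 <= 1003 / 1000 * t by clear - t4; lra.
have b1 : 0 <= t + 1 by clear - t4; lra.
have b2 : 0 <= t + s ^+ 2 by rewrite addr_ge0 // sqr_ge0.
have up := ler_pM (mulr_ge0 b1 b2) e0 (ler_pM b1 b2 a2 a1) e1.
have t3 := ler_wpM2r (exprn_ge0 3 t0) t4.
have t30 : 0 < t ^+ 3 by rewrite exprn_gt0 //; clear - t4; lra.
have fin := le_trans h up.
clear - fin t3 t30; lra.
Qed.

(** Without [M] the last hypothesis bounds r (t - r) below by 2/9 of t^2, which keeps r under 2 t /
    3. As [M] has the order of the square root of t, it is at most t / 19, and 17/20 leaves room for
    it. *)
Lemma radius_bound t M r : 466 <= t -> 0 <= M -> 0 <= t + M - r -> M ^+ 2 <= 503 / 500 * r ->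
  2 * (t + 1) ^+ 2 <= 9 * r * (t + M - r) -> r <= 17 / 20 * t.
Proof.
move=> t4 M0 p0 M2 hr.
have M19 : 19 * M <= t.
  rewrite leNgt; apply/negP => lt.
  have M21 : 21 <= M by clear - lt t4; lra.
  have h := ler_wpM2r M0 M21.
  clear - h M2 lt p0 M21; lra.
rewrite leNgt; apply/negP => lt.
have l1 : r <= 20 / 19 * t by clear - p0 M19; lra.
have l2 : t + M - r <= 20 / 19 * t - 17 / 20 * t by clear - lt M19; lra.
have h1 := ler_wpM2r p0 l1.
have t0 : 0 <= t by clear - t4; lra.
have h2 := ler_wpM2l t0 l2.
have tt : 0 < t * t by apply: mulr_gt0; clear - t4; lra.
clear - h1 h2 hr tt t4; lra.
Qed.

(* The first inequality on [r] keeps it away from [t], the second forces it close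
   to [t]; for t < 466 the constants fail, and [small_pairs] enumerates instead. *)
Lemma large_contradiction t x y P Q M : 466 <= t ->
    0 < P -> 0 < Q -> P <= 2 * Q -> Q <= 2 * P ->
    `|x| * P <= M -> `|y| * Q <= M ->
    let r := 2 * P * Q in let X := t + x in let Y := t + y in
    0 < X -> 0 < Y ->
    let s := r * X * Y / (t + 1) ^+ 2 in
    M ^+ 2 < s -> 2 * X * Y <= r * (X - Y) ^+ 2 * (t + M - r) ->
    (r * Y - X * (3 * t - X - Y)) ^+ 2 <= (t + 1) * (t + s ^+ 2) * (X - Y) ^+ 2 ->
  False.
Proof.
move=> t4 P0 Q0 PQ QP hx hy r X Y X0 Y0 s hM I1 I2.
have t0 : 0 < (t + 1) ^+ 2 by rewrite exprn_gt0 //; lra.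
pose k := X * Y / (t + 1) ^+ 2.
have es : s = r * k by rewrite /s /k; field; rewrite gt_eqF //; lra.
have r0 : 0 < r by rewrite /r !mulr_gt0.
have M0 : 0 <= M by apply: le_trans hx; rewrite mulr_ge0 // ltW.
have ek : X * Y = k * (t + 1) ^+ 2 by rewrite /k divfK // gt_eqF.
have k0 : 0 < k by rewrite /k divr_gt0 // mulr_gt0.
have hMk : M ^+ 2 < 2 * P * Q * k by rewrite -/r -es.
have [x2 y2 d2] := close_ratio P0 Q0 PQ QP hx hy hMk.
have k1 := product_bound t4 x2 y2 ek.
have ed : X - Y = x - y by rewrite /X /Y; ring.
rewrite ed in I1 I2.
have hr : 2 * (t + 1) ^+ 2 <= 9 * r * (t + M - r).
  have p0 : 0 < t + M - r.
    have : 0 < r * (x - y) ^+ 2 * (t + M - r).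
      apply: lt_le_trans I1; rewrite -mulrA; apply: mulr_gt0 => //; exact: mulr_gt0.
    rewrite pmulr_rgt0 // pmulr_rgt0 //.
    rewrite lt_neqAle sqr_ge0 andbT eq_sym; apply/eqP => z0.
    have h : 0 < 2 * X * Y by rewrite -mulrA; apply: mulr_gt0 => //; exact: mulr_gt0.
    by move: (lt_le_trans h I1); rewrite z0 mulr0 mul0r ltxx.
  rewrite -(ler_pM2r k0); apply: (@le_trans _ _ (2 * X * Y)).
    by rewrite -mulrA ek; lra.
  apply: (le_trans I1); have h : r * (t + M - r) * (x - y) ^+ 2 <= r * (t + M - r) * (9 * k).
    by rewrite ler_wpM2l ?ltW // mulr_gt0.
  lra.
have M2 : M ^+ 2 <= 503 / 500 * r by apply: (le_trans (ltW hM)); rewrite es [r * k]mulrC; apply: ler_wpM2r => //; exact: ltW.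
have p0 : 0 <= t + M - r.
  rewrite leNgt; apply/negP => lt.
  have : r * (t + M - r) < 0 by rewrite pmulr_rlt0.
  lra.
have r84 := radius_bound t4 M0 p0 M2 hr.
have bnd (z : F) : z ^+ 2 < 4 * k -> - (201 / 100) <= z <= 201 / 100.
  move=> hz; rewrite -ler_norml leNgt; apply/negP => lt.
  have q0 : 0 < 201 / 100 :> F by clear; lra.
  have h := ltr_pM (ltW q0) (ltW q0) lt lt.
  rewrite -normrM ger0_norm -?expr2 ?sqr_ge0 // in h; clear - h hz k1; lra.
have low := low_bound t4 (bnd _ x2) (bnd _ y2) r84; rewrite -/X -/Y in low.
have L0 : 0 <= 12 / 100 * t ^+ 2 by have := sqr_ge0 t; clear; lra.
have low2 : (12 / 100 * t ^+ 2) ^+ 2 <= (r * Y - X * (3 * t - X - Y)) ^+ 2.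
  rewrite -[X in _ <= X]sqrrN opprB lerXn2r ?nnegrE //; exact: le_trans low.
have s0 : 0 <= s by rewrite es; apply: mulr_ge0; exact: ltW.
have s1 : s <= 856 / 1000 * t.
  rewrite es; apply: (@le_trans _ _ (17 / 20 * t * (503 / 500))); last by clear - t4; lra.
  by apply: ler_pM => //; exact: ltW.
apply: (up_bound t4 s0 s1 (sqr_ge0 (x - y)) _ (le_trans low2 I2)).
by apply: le_trans (ltW d2) _; clear - k1; lra.
Qed.

End Inequality.

(** * Integer inequalities excluding [a' = 2 * a] *)

Lemma sqr_near_double (p q : int) (e : int) : 0 < p -> 0 < q ->
  2 * p ^+ 2 - q ^+ 2 = e -> `|e| = 1 -> (p = 1 /\ q = 1) \/ 3 <= q.
Proof.
move=> p0 q0 h e1; have [q3|q3] := lerP 3 q; [by right | left].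
have [qE|qE] : q = 1 \/ q = 2 by lia.
all: rewrite qE in h *.
all: have p5 : 2 * p ^+ 2 <= 5 by lia.
all: have p2 : p <= 2 by nia.
all: have [pE|pE] : p = 1 \/ p = 2 by lia.
all: by rewrite pE in h *; lia.
Qed.

Lemma cube_bound (t M : int) : 1 <= M -> 2 * M < t -> t <= 3 * M ->
  (t + M) ^+ 3 <= 9 * M * (t + 1) ^+ 2.
Proof.
move=> M1 Mt tM; have S0 : 0 <= t + M by lia.
have h1 : (2 * (t + M)) ^+ 2 <= (3 * (t + 1)) ^+ 2 by rewrite lerXn2r ?nnegrE //; lia.
have := ler_pM S0 (sqr_ge0 _) (_ : t + M <= 4 * M) h1; lia.
Qed.

Lemma shift_le (t M A p : int) : `|A| <= M -> 0 < p -> A + t * p ^+ 2 <= p ^+ 2 * (t + M).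
Proof.
move=> hA p0; have p1 : 1 <= p ^+ 2 by rewrite -gtz0_ge1 exprn_gt0.
have M0 : 0 <= M by apply: le_trans hA.
by have := ler_wpM2l M0 p1; lia.
Qed.

(** The case in which both points are integral. The bounds combine to 2 (t + 1)^2 M^2 < (t + M)^3
    with t <= 3 M, which leaves M <= 5 and finitely many t; parity of [a] is needed there, as t = 3,
    M = 1, a = 2 shows. *)
Lemma no_double_small (t M a k : int) : 1 <= M -> 2 * M < t -> t <= 3 * M ->
    2 * a <= t + M -> (t + 1) ^+ 2 * M ^+ 2 < (t + M) * (2 * a ^+ 2) ->
    a = 2 * k + 1 -> 0 < a -> False.
Proof.
move=> M1 Mt t3M a2 lo2 odd a0.
have aa : 4 * a ^+ 2 <= (t + M) ^+ 2.
  by rewrite (_ : 4 * a ^+ 2 = (2 * a) ^+ 2) ?lerXn2r ?nnegrE //; [lia| lia| ring].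
have M5 : M <= 5.
  rewrite leNgt; apply/negP => M6.
  have h1 : (t + M) * (4 * a ^+ 2) <= (t + M) * (t + M) ^+ 2 by rewrite ler_wpM2l //; lia.
  have h4 := cube_bound M1 Mt t3M.
  have h5 : 6 * M * (t + 1) ^+ 2 <= M * M * (t + 1) ^+ 2.
    by apply: ler_wpM2r; [exact: sqr_ge0 | apply: ler_wpM2r; lia].
  have h6 := mulr_ge0 (_ : 0 <= M) (sqr_ge0 (t + 1)).
  clear - h1 h4 h5 h6 lo2 M6 M1; have {}h6 := h6 _; lia.
have [u eu] : exists u, u = t - 2 * M by exists (t - 2 * M).
have u1 : 1 <= u by lia.
have u5 : u <= M by lia.
have {}eu : t = 2 * M + u by lia.
clear - M5 M1 u1 u5 eu a2 a0 lo2 odd aa.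
have [eM|[eM|[eM|[eM|eM]]]] : M = 1 \/ M = 2 \/ M = 3 \/ M = 4 \/ M = 5 by lia.
all: subst M.
all: have [ee|[ee|[ee|[ee|ee]]]] : u = 1 \/ u = 2 \/ u = 3 \/ u = 4 \/ u = 5 by lia.
all: subst u t; try by lia.
all: try by nia.
Qed.

(** Here p and q are the values of C, and A' = 2 A + t e with e = 2 p^2 - q^2. The size of A and A'
    forces |e| <= 1; e = 0 would make A' and q both even. In the Pell equation e = 1 or e = -1,
    either p = q = 1, or q >= 3 and M >= 9, and then m <= (t + M)^3 <= 9 M (t + 1)^2 contradicts the
    lower bound for m. *)
Lemma no_double_int (t M m A p A' q a a' k : int) :
    0 < p -> 0 < q -> `|A| <= M -> `|A'| <= M -> p ^+ 2 <= M -> q ^+ 2 <= M ->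
    1 <= M -> 2 * M < t -> (t + 1) ^+ 2 * M ^+ 2 < m ->
    a = A + t * p ^+ 2 -> a' = A' + t * q ^+ 2 -> coprimez A' q ->
    m * (p ^+ 2 * q ^+ 2) <= (t + M) * (a * a') -> a' = 2 * a -> a = 2 * k + 1 ->
  False.
Proof.
move=> p0 q0 hA hA' pM qM M1 Mt lo ea ea' co hm e2 odd.
pose e := 2 * p ^+ 2 - q ^+ 2.
have eA : A' = 2 * A + t * e.
  by rewrite /e; move: ea'; rewrite e2 ea => h; lia.
have te : `|t * e| <= 3 * M by lia.
have e0 : e != 0.
  apply/eqP => e0; move: eA co; rewrite e0 mulr0 addr0 => eA.
  have : (2 %| q ^+ 2)%Z by apply/dvdzP; exists (p ^+ 2); lia.
  rewrite dvdzE abszX Euclid_dvdX // andbT => dq.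
  have dA : (2 %| `|A'|%N)%N by rewrite eA abszM dvdn_mulr.
  by rewrite coprimezE /coprime => /eqP g; have := dvdn_gcd 2 `|A'| `|q|; rewrite g dq dA.
have e1 : `|e| = 1.
  have : `|e| < 2.
    rewrite ltNge; apply/negP => h.
    have : t * 2 <= `|t * e| by rewrite normrM gtr0_norm ?ler_wpM2l //; lia.
    by lia.
  have : 0 < `|e| by rewrite normr_gt0.
  by lia.
have t3M : t <= 3 * M by move: te; rewrite normrM e1 mulr1 gtr0_norm //; lia.
have [[p1 q1]|q3] := sqr_near_double p0 q0 (erefl : 2 * p ^+ 2 - q ^+ 2 = e) e1.
  have ee : e = 1 by rewrite /e p1 q1.
  move: hm ea eA; rewrite p1 q1 ee !(mulr1, expr1n) e2 => hm ea eA.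
  have a2 : 2 * a <= t + M by lia.
  have lo2 : (t + 1) ^+ 2 * M ^+ 2 < (t + M) * (2 * a ^+ 2) by lia.
  by apply: (no_double_small M1 Mt t3M a2 lo2 odd); lia.
have M9 : 9 <= M by clear - q3 qM; nia.
have h1 : a <= p ^+ 2 * (t + M) by rewrite ea; apply: shift_le.
have h2 : a' <= q ^+ 2 * (t + M) by rewrite ea'; apply: shift_le.
have a0 : 0 < a.
  have : t * 1 <= t * p ^+ 2 by apply: ler_wpM2l; [|rewrite -gtz0_ge1 exprn_gt0]; lia.
  clear - ea hA Mt M1; lia.
have h3 : a * a' <= (p ^+ 2 * q ^+ 2) * (t + M) ^+ 2.
  have -> : (p ^+ 2 * q ^+ 2) * (t + M) ^+ 2 = p ^+ 2 * (t + M) * (q ^+ 2 * (t + M)) by ring.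
  by apply: ler_pM => //; clear - a0 e2; lia.
have pq0 : 0 < p ^+ 2 * q ^+ 2 by rewrite mulr_gt0 ?exprn_gt0.
have h4 : m <= (t + M) ^+ 3.
  rewrite -(ler_pM2r pq0); apply: (le_trans hm).
  apply: (@le_trans _ _ ((t + M) * (p ^+ 2 * q ^+ 2 * (t + M) ^+ 2))).
    by apply: ler_wpM2l => //; clear - M1 Mt; lia.
  by rewrite (_ : _ * (_ * _) = (t + M) ^+ 3 * (p ^+ 2 * q ^+ 2)) //; ring.
have h6 := cube_bound M1 Mt t3M.
have h7 : 9 * M * (t + 1) ^+ 2 <= M * M * (t + 1) ^+ 2.
  by apply: ler_wpM2r; [exact: sqr_ge0 | apply: ler_wpM2r; lia].
by clear - h4 h6 h7 lo; lia.
Qed.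

(** * Integer inequalities excluding [m = 2 * (a * a')] for small [t] *)

Lemma shift_bounds (t M A P : int) : `|A| <= M -> 1 <= P -> P <= M -> 2 * M < t ->
  [/\ 0 < t * P - M, t * P - M <= A + t * P & A + t * P <= t * P + M].
Proof.
move=> hA P1 PM Mt; have : t * 1 <= t * P by rewrite ler_wpM2l //; lia.
by split; lia.
Qed.

(** As Q <= M, the second factor is at most M (t + 1). Cancelling it leaves M (t + 1) < 2 (t P + M),
    which fails when M >= Q > 2 P. *)
Lemma ratio_bound (t M P Q : int) : 1 <= P -> 1 <= Q -> P <= M -> Q <= M ->
    2 * M < t -> M ^+ 2 * (t + 1) ^+ 2 < 2 * ((t * P + M) * (t * Q + M)) ->
  Q <= 2 * P.
Proof.
move=> P1 Q1 PM QM Mt h; rewrite leNgt; apply/negP => lt.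
have tP : 0 < t * P + M.
  have : t * 1 <= t * P by rewrite ler_wpM2l //; lia.
  by lia.
have hQ : (t * P + M) * (t * Q + M) <= (t * P + M) * (M * (t + 1)).
  apply: ler_wpM2l; first exact: ltW.
  have : t * Q <= t * M by rewrite ler_wpM2l //; lia.
  by lia.
have M1 : 0 < M * (t + 1) by apply: mulr_gt0; lia.
have : (M * (t + 1)) * (M * (t + 1)) < (2 * (t * P + M)) * (M * (t + 1)).
  by apply: le_lt_trans (lt_le_trans h _); lia.
rewrite ltr_pM2r // => h2.
have : t * 1 <= t * (M - 2 * P) by rewrite ler_wpM2l //; lia.
by lia.
Qed.

(* [(t P / M + 1) (t Q / M + 1)] decreases with [M], so a bound [k] violating
   the hypothesis at [M = k] bounds [M]. *)
Lemma height_lt (t M P Q k : int) : 0 < k -> 0 < t -> 0 <= P -> 0 <= Q -> 0 < M ->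
    M ^+ 2 * (t + 1) ^+ 2 < 2 * ((t * P + M) * (t * Q + M)) ->
    2 * ((t * P + k) * (t * Q + k)) <= k ^+ 2 * (t + 1) ^+ 2 -> M < k.
Proof.
move=> k0 t0 P0 Q0 M0 h hk; rewrite ltNge; apply/negP => kM.
have tP : 0 <= t * P by apply: mulr_ge0 => //; exact: ltW.
have tQ : 0 <= t * Q by apply: mulr_ge0 => //; exact: ltW.
have e1 : (t * P + M) * k <= (t * P + k) * M by have := ler_wpM2l tP kM; lia.
have e2 : (t * Q + M) * k <= (t * Q + k) * M by have := ler_wpM2l tQ kM; lia.
have e3 := ler_pM (_ : 0 <= (t * P + M) * k) (_ : 0 <= (t * Q + M) * k) e1 e2.
have {}e3 : ((t * P + M) * (t * Q + M)) * k ^+ 2 <= ((t * P + k) * (t * Q + k)) * M ^+ 2.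
  by have := e3 _ _; rewrite !mulr_ge0 //; try lia.
have k2 : 0 < k ^+ 2 by exact: exprn_gt0.
have M2 : 0 < M ^+ 2 by exact: exprn_gt0.
have := ltr_pM2r k2 (M ^+ 2 * (t + 1) ^+ 2) (2 * ((t * P + M) * (t * Q + M))).
rewrite h => /= h2.
have := ler_wpM2r (ltW M2) hk; lia.
Qed.

Lemma small_pairs (t M p q A A' a a' k k' : int) :
    let P := p ^+ 2 in let Q := q ^+ 2 in
    0 < p -> 0 < q -> `|A| <= M -> `|A'| <= M -> P <= M -> Q <= M ->
    2 * M < t -> t < 466 ->
    a = A + t * P -> a' = A' + t * Q -> M ^+ 2 * (t + 1) ^+ 2 < 2 * (a * a') ->
    a * a' <= (A' * P - A * Q) ^+ 2 * (t + M - 2 * (P * Q)) ->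
    a = 2 * k + 1 -> a' = 2 * k' + 1 -> False.
Proof.
move=> P Q p0 q0 hA hA' PM QM Mt t4 ea ea' lo I1 ok ok'.
have P1 : 1 <= P by rewrite -gtz0_ge1 exprn_gt0.
have Q1 : 1 <= Q by rewrite -gtz0_ge1 exprn_gt0.
have [eP eQ] : P = p ^+ 2 /\ Q = q ^+ 2 by [].
clearbody P Q.
have [l0 l1 l2] := shift_bounds hA P1 PM Mt; rewrite -ea in l1 l2.
have [l0' l1' l2'] := shift_bounds hA' Q1 QM Mt; rewrite -ea' in l1' l2'.
have up : a * a' <= (t * P + M) * (t * Q + M) by apply: ler_pM => //; clear - l0 l0' l1 l1'; lia.
have lo2 : (t * P - M) * (t * Q - M) <= a * a' by apply: ler_pM => //; exact: ltW.
have hM : M ^+ 2 * (t + 1) ^+ 2 < 2 * ((t * P + M) * (t * Q + M)).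
  by apply: (lt_le_trans lo); rewrite ler_pM2l.
have hM' : M ^+ 2 * (t + 1) ^+ 2 < 2 * ((t * Q + M) * (t * P + M)) by rewrite [_ * (t * P + M)]mulrC.
have QP := ratio_bound P1 Q1 PM QM Mt hM.
have PQ := ratio_bound Q1 P1 QM PM Mt hM'.
have M0 : 0 < M by clear - P1 PM; lia.
have r0 : 0 < t + M - 2 * (P * Q).
  have aa : 0 < a * a' by apply: mulr_gt0; [exact: lt_le_trans l1 | exact: lt_le_trans l1'].
  have := lt_le_trans aa I1; rewrite pmulr_rgt0 // lt_neqAle sqr_ge0 andbT eq_sym.
  by apply: contraL aa => /eqP z; move: I1; rewrite z mul0r -leNgt.
have d2 : (A' * P - A * Q) ^+ 2 <= (M * (P + Q)) ^+ 2.
  rewrite -(real_normK (num_real (A' * P - A * Q))) lerXn2r ?nnegrE //.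
    by apply: mulr_ge0; clear - M0 P1 Q1; lia.
  apply: le_trans (ler_normB _ _) _; rewrite !normrM (gtr0_norm (x := P)) ?(gtr0_norm (x := Q)); try (clear - P1 Q1; lia).
  have := ler_wpM2r (_ : 0 <= P) hA'; have := ler_wpM2r (_ : 0 <= Q) hA.
  by clear - P1 Q1; lia.
have I2 : (t * P - M) * (t * Q - M) <= (M * (P + Q)) ^+ 2 * (t + M - 2 * (P * Q)).
  by apply: (le_trans lo2); apply: (le_trans I1); apply: ler_wpM2r => //; exact: ltW.
have t0 : 0 < t by clear - M0 Mt; lia.
have P0 : 0 <= P by clear - P1; lia.
have Q0 : 0 <= Q by clear - Q1; lia.
(* Indeed 2 P Q < t + M < 3 t / 2 < 699, while 2 * 19^2 = 722. *)
have pq4 : p * q < 19.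
  rewrite ltNge; apply/negP => h.
  have : 19 ^+ 2 <= (p * q) ^+ 2 by rewrite lerXn2r ?nnegrE //; clear - h; lia.
  by rewrite exprMn -eP -eQ; clear - t4 Mt r0; lia.
have p4 : p <= 4 by clear - pq4 p0 q0 PQ eP eQ; nia.
have q4 : q <= 4 by clear - pq4 p0 q0 QP eP eQ; nia.
have lt_k k0 (k1 : 0 < k0) := @height_lt t M P Q k0 k1 t0 P0 Q0 M0 hM.
clear l0 l1 l2 l0' l1' l2' up lo2 hM hM' d2 P0 Q0 P1 Q1 pq4.
have cp : [\/ p = 1, p = 2, p = 3 | p = 4] by clear - p0 p4; case: p p0 p4 => // -[|[|[|[|[|n]]]]] // _ _; constructor.
have cq : [\/ q = 1, q = 2, q = 3 | q = 4] by clear - q0 q4; case: q q0 q4 => // -[|[|[|[|[|n]]]]] // _ _; constructor.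
clear p0 q0 p4 q4.
(* The ratio bounds leave the pairs (1, 1), (2, 2), (3, 3), (3, 4), (4, 3), (4, 4). In each of them
   [lt_k] bounds M above, P and Q bound it below, and I2 or r0 becomes an inequality in t alone,
   except for (1, 1), where I1 and parity decide. *)
case: cp eP => -> eP; case: cq eQ => -> eQ; rewrite {}eP {}eQ in QP PQ ea ea' I1 I2 PM QM r0 lt_k => //.
- have M2 : M < 2 by apply: lt_k => //; clear - Mt PM; nia.
  have M1 : M = 1 by clear - M2 M0; lia.
  clear lt_k lo I2; rewrite !(expr1n, mulr1, mul1r) M1 in ea ea' I1 hA hA' Mt.
  have cA : A = -1 \/ A = 0 \/ A = 1 by clear - hA; lia.
  have cA' : A' = -1 \/ A' = 0 \/ A' = 1 by clear - hA'; lia.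
  by move: I1 ea ea'; case: cA => [|[|]] ->; case: cA' => [|[|]] -> I1 ea ea'; clear - I1 ea ea' ok ok' Mt; nia.
- have M2 : M < 6 by apply: lt_k => //; clear - Mt PM; nia.
  have eM : M = 4 \/ M = 5 by clear - M2 PM; lia.
  by case: eM => eM; rewrite {}eM in I2; clear - I2; have := sqr_ge0 (t - 50); nia.
- have t1 : 100 < t by clear - Mt r0; lia.
  have M2 : M < 13 by apply: lt_k => //; clear - Mt PM t1; nia.
  have eM : M = 9 \/ M = 10 \/ M = 11 \/ M = 12 by clear - M2 PM; lia.
  (* For M = 9, 10, 11, 12, I2 is a quadratic inequality in t with negative discriminant; the
     squares are centred near the four vertices. *)
  by case: eM => [|[|[|]]] eM; rewrite {}eM in I2; clear - I2 t4 t1; have := sqr_ge0 (t - 163); have := sqr_ge0 (t - 201);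
    have := sqr_ge0 (t - 243); have := sqr_ge0 (t - 289); lia.
- have t1 : 100 < t by clear - Mt r0; lia.
  have M3 : M < 18 by apply: lt_k => //; clear - Mt QM t1; nia.
  (* The bound 17 on M needs t >= 274. Below that, M = 17 and 2 P Q = 288 < t + M leave only t = 272
     and t = 273. *)
  have M2 : M < 17.
    have [t2|t2] := lerP 274 t; first by apply: lt_k => //; clear - t2; nia.
    rewrite ltNge; apply/negP => M17; have eM : M = 17 by clear - M17 M3; lia.
    rewrite eM in I2 r0; have t3 : t = 272 \/ t = 273 by clear - r0 t2; lia.
    by clear - I2 t3; case: t3 => t3; rewrite t3 in I2; lia.
  have eM : M = 16 by clear - M2 QM; lia.
  by rewrite eM in I2; clear - I2 t4; nia.
- have t1 : 100 < t by clear - Mt r0; lia.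
  have M3 : M < 18 by apply: lt_k => //; clear - Mt PM t1; nia.
  have M2 : M < 17.
    have [t2|t2] := lerP 274 t; first by apply: lt_k => //; clear - t2; nia.
    rewrite ltNge; apply/negP => M17; have eM : M = 17 by clear - M17 M3; lia.
    rewrite eM in I2 r0; have t3 : t = 272 \/ t = 273 by clear - r0 t2; lia.
    by clear - I2 t3; case: t3 => t3; rewrite t3 in I2; lia.
  have eM : M = 16 by clear - M2 PM; lia.
  by rewrite eM in I2; clear - I2 t4; nia.
have t1 : 100 < t by clear - Mt r0; lia.
  have M2 : M < 23 by apply: lt_k => //; clear - Mt PM t1; nia.
by clear - M2 r0 t4; lia.
Qed.

(** * The same exclusion for large [t], over an ordered field *)

Section LargePairs.
Variable F : realFieldType.
Implicit Types t m M A P Q a b h : F.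

(** Dividing by P and Q passes to the abscissas and to the hypotheses of [large_contradiction]. The
    coefficient [c] of the curve is uncontrolled and has to be eliminated between [ecur] and
    [pair]. *)
Lemma large_pairs t m M A A' P Q a a' b c h :
    466 <= t -> 2 * M < t -> 0 < P -> 0 < Q -> P <= 2 * Q -> Q <= 2 * P -> 1 <= P -> 1 <= Q ->
    `|A| <= M -> `|A'| <= M -> 0 < a -> 0 < a' -> a = A + t * P -> a' = A' + t * Q ->
    m = 2 * (a * a') -> (t + 1) ^+ 2 * M ^+ 2 < m ->
    a * a' <= (A' * P - A * Q) ^+ 2 * (t + M - 2 * (P * Q)) ->
    b ^+ 2 + m * P ^+ 3 = a * (A ^+ 2 - A * t * P + (t ^+ 2 + c) * P ^+ 2) ->
    (a * a' - (3 * t ^+ 2 + c) * P * Q) ^+ 2 +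
      4 * m * P * Q * (a * Q + a' * P - 3 * t * P * Q) <=
      (t + 1) * (t + h) * (A * Q - A' * P) ^+ 2 ->
    (t + 1) ^+ 4 * h < m ^+ 2 -> False.
Proof.
move=> t4 Mt P0 Q0 PQ QP P1 Q1 hA hA' a0 a0' ea ea' em sM I1 ecur pair hh.
have Pn : P != 0 by rewrite gt_eqF.
have Qn : Q != 0 by rewrite gt_eqF.
have t1 : t + 1 != 0 by rewrite gt_eqF //; lra.
have tt : 0 < (t + 1) ^+ 2 by rewrite exprn_gt0 //; lra.
pose x := A / P; pose y := A' / Q.
have eX : t + x = a / P by rewrite ea /x; field.
have eY : t + y = a' / Q by rewrite ea' /y; field.
have X0 : 0 < t + x by rewrite eX divr_gt0.
have Y0 : 0 < t + y by rewrite eY divr_gt0.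
have exy : t + x - (t + y) = (A * Q - A' * P) / (P * Q) by rewrite /x /y; field; rewrite Pn Qn.
have hx : `|x| * P <= M by rewrite -[X in _ * X](gtr0_norm P0) -normrM /x divfK.
have hy : `|y| * Q <= M by rewrite -[X in _ * X](gtr0_norm Q0) -normrM /y divfK.
have es : 2 * P * Q * (t + x) * (t + y) = m by rewrite em eX eY; field; rewrite Pn Qn.
have PQ0 : 0 < P * Q by exact: mulr_gt0.
apply: (large_contradiction t4 P0 Q0 PQ QP hx hy X0 Y0); rewrite ?es.
- by rewrite ltr_pdivlMr // mulrC.
- rewrite exy eX eY.
  have -> : 2 * (a / P) * (a' / Q) = 2 / (P * Q) * (a * a') by field; rewrite Pn Qn.
  have -> : 2 * P * Q * ((A * Q - A' * P) / (P * Q)) ^+ 2 * (t + M - 2 * P * Q) =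
    2 / (P * Q) * ((A' * P - A * Q) ^+ 2 * (t + M - 2 * (P * Q))) by field; rewrite Pn Qn.
  by apply: ler_wpM2l => //; rewrite divr_ge0 // ltW.
pose w := 3 * t - (t + x) - (t + y).
pose u := m / (t + x) + (t + x) * w.
pose v := (3 * t ^+ 2 + c) - (t + x) * (t + y).
have m0 : 0 < m by rewrite em !mulr_gt0.
have w0 : 0 <= w.
  have b1 (z R : F) : 1 <= R -> `|z| * R <= M -> z <= M.
    move=> R1 hz; apply: le_trans (ler_norm z) _; apply: le_trans hz.
    by rewrite ler_peMr.
  by have := b1 _ _ P1 hx; have := b1 _ _ Q1 hy; rewrite /w; lra.
have u0 : 0 <= u by apply: addr_ge0; [apply: divr_ge0; exact: ltW | apply: mulr_ge0 => //; exact: ltW].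
(* The curve equation says that v - u is b^2 / (P^3 (t + x)), which is nonnegative. So [v], which
   contains [c], can be replaced by [u], which does not. *)
have uv : u <= v.
  have -> : v = u + b ^+ 2 / P ^+ 3 / (t + x).
    rewrite /u /v /w.
    have -> : b ^+ 2 = a * (A ^+ 2 - A * t * P + (t ^+ 2 + c) * P ^+ 2) - m * P ^+ 3.
      by rewrite -ecur addrK.
    have eA : A = a - t * P by rewrite ea addrK.
    have an : a != 0 by rewrite gt_eqF.
    by rewrite eX eY eA; field; rewrite Pn Qn an.
  by rewrite lerDl; apply: divr_ge0; [apply: divr_ge0; [exact: sqr_ge0 | exact/exprn_ge0/ltW] | exact: ltW].
have u2 : u ^+ 2 <= v ^+ 2 by rewrite lerXn2r ?nnegrE //; exact: le_trans uv.
have pair2 : v ^+ 2 - 4 * m * w <= (t + 1) * (t + h) * (t + x - (t + y)) ^+ 2.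
  have q0 : 0 < (P * Q) ^+ 2 by rewrite exprn_gt0.
  rewrite -(ler_pM2r q0); apply: le_trans (le_trans _ pair) _.
    by rewrite le_eqVlt; apply/orP; left; apply/eqP; rewrite /v /w eX eY; field; rewrite Pn Qn.
  by rewrite le_eqVlt; apply/orP; left; apply/eqP; rewrite exy; field; rewrite Pn Qn.
have h2 : h <= (m / (t + 1) ^+ 2) ^+ 2.
  have -> : (m / (t + 1) ^+ 2) ^+ 2 = m ^+ 2 / (t + 1) ^+ 4 by field.
  by rewrite ler_pdivlMr ?exprn_gt0 //; [rewrite mulrC ltW | lra].
have -> : (2 * P * Q * (t + y) - (t + x) * (3 * t - (t + x) - (t + y))) ^+ 2 = u ^+ 2 - 4 * m * w.
  have -> : 2 * P * Q * (t + y) = m / (t + x) by rewrite -es; field; rewrite gt_eqF.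
  by rewrite /u -/w; field; rewrite gt_eqF.
apply: (@le_trans _ _ (v ^+ 2 - 4 * m * w)); first by rewrite lerD2r.
apply: le_trans pair2 _; apply: ler_wpM2r; first exact: sqr_ge0.
by apply: ler_wpM2l; [lra | rewrite lerD2l].
Qed.

End LargePairs.

(** * Points of small height *)

Section SmallPoints.
Variables (a4 a6 : int) (hE : elliptic a4 a6).
Implicit Types P Q V W U : EC hE.
Variables t m : int.
Hypothesis hm : m = t ^+ 3 + a4 * t - a6.
Hypotheses (t0 : 0 < t) (hlow : (t + 1) ^+ 2 < m).
Hypothesis (hup : 4 * m < (t + 1) ^+ 2 * t ^+ 2).

Local Notation A := xnum.
Local Notation B := ynum.
Local Notation C := xysqrt.
Local Notation H := naive_height.
Local Notation al := (alpha t).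

Definition small V := (t + 1) ^+ 2 * H V ^+ 2 < m.

Lemma sqr_lt_half (M : int) : 0 <= M -> (t + 1) ^+ 2 * M ^+ 2 < m -> 2 * M < t.
Proof.
move=> M0 h; rewrite ltNge; apply/negP => tM.
have h1 : t ^+ 2 <= (2 * M) ^+ 2 by rewrite lerXn2r ?nnegrE //; lia.
have h2 := ler_wpM2l (sqr_ge0 (t + 1)) h1.
by clear - h h2 hup; lia.
Qed.

Lemma small_half V : small V -> 2 * H V < t.
Proof. by apply: sqr_lt_half; have := naive_height_ge1 V; lia. Qed.

Lemma heights V : `|A V| <= H V /\ C V ^+ 2 <= H V.
Proof. by rewrite naive_height_xC !le_max !lexx orbT. Qed.

Lemma xysqrt_gt0 V : V != 0 -> 0 < C V.
Proof. by move=> V0; rewrite lt_neqAle xysqrt_ge0 eq_sym xysqrt_eq0 V0. Qed.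

Lemma alpha0 : al (0 : EC hE) = 1.
Proof. by rewrite /alpha; have [-> _ -> _] := ynum0 hE; rewrite expr0n /= mulr0 addr0. Qed.

Lemma alpha_gt V : V != 0 -> small V -> t < 2 * al V.
Proof.
move=> V0 sV; have [h1 h2] := heights V; have h3 := small_half sV.
have h4 : t * 1 <= t * C V ^+ 2 by apply: ler_wpM2l; [exact: ltW | rewrite -gtz0_ge1 exprn_gt0 // xysqrt_gt0].
by rewrite /alpha; lia.
Qed.

Lemma alpha_gt0 V : small V -> 0 < al V.
Proof.
case: (eqVneq V 0) => [->|V0 sV]; first by rewrite alpha0.
by have := alpha_gt V0 sV; clear - t0; lia.
Qed.

Lemma alpha_le V : al V <= (t + 1) * H V.
Proof.
have [h1 h2] := heights V; have := ler_wpM2l (ltW t0) h2.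
by rewrite /alpha; lia.
Qed.

Lemma alpha_sqr_lt V : small V -> al V ^+ 2 < m.
Proof.
move=> sV; apply: (le_lt_trans _ sV); rewrite -exprMn lerXn2r ?nnegrE ?alpha_le //.
  exact/ltW/alpha_gt0.
by have h := naive_height_ge1 V; apply: mulr_ge0; clear - h t0; lia.
Qed.

(** Both |A| are below t / 2, so A is determined by [alpha] modulo t, and then so is C^2. *)
Lemma alpha_inj V W : small V -> small W -> al V = al W -> V = W \/ V = - W.
Proof.
move=> sV sW e; have [h1 _] := heights V; have [h2 _] := heights W.
have := small_half sV; have := small_half sW => h3 h4.
have e1 : A V - A W = t * (C W ^+ 2 - C V ^+ 2) by move: e; rewrite /alpha; lia.
have e2 : C W ^+ 2 - C V ^+ 2 = 0.
  apply/eqP; apply: contraT => n0; have : 1 <= `|C W ^+ 2 - C V ^+ 2| by rewrite -gtz0_ge1 normr_gt0.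
  move/(ler_wpM2l (ltW t0)); rewrite -{2}(gtr0_norm t0) -normrM -e1.
  by clear - h1 h2 h3 h4; lia.
apply: point_eqN; first by move: e1; rewrite e2; lia.
by apply: (pexpIrn (n := 2)); rewrite ?nnegrE ?xysqrt_ge0 //; lia.
Qed.

Lemma common_bound V W U : small V -> small W -> small U -> exists M,
  [/\ [/\ 1 <= M, 2 * M < t & (t + 1) ^+ 2 * M ^+ 2 < m],
      H V <= M, H W <= M & H U <= M].
Proof.
move=> sV sW sU; exists (Num.max (H V) (Num.max (H W) (H U))).
have sM : (t + 1) ^+ 2 * (Num.max (H V) (Num.max (H W) (H U))) ^+ 2 < m.
  pose S (x : int) := (t + 1) ^+ 2 * x ^+ 2 < m.
  have mx x y : S x -> S y -> S (Num.max x y) by move=> h1 h2; case: (leP x y).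
  by apply: (mx _ _ sV); apply: mx.
have M1 : 1 <= Num.max (H V) (Num.max (H W) (H U)) by rewrite le_max naive_height_ge1.
have M0 := le_trans (ler01 : 0 <= 1 :> int) M1.
have M2 := sqr_lt_half M0 sM.
by split; [| rewrite !le_max lexx ?orbT | rewrite !le_max lexx ?orbT | rewrite !le_max lexx ?orbT].
Qed.

Lemma heights_le M V : H V <= M -> `|A V| <= M /\ C V ^+ 2 <= M.
Proof. by have [h1 h2] := heights V; split; [exact: le_trans h1 _ | exact: le_trans h2 _]. Qed.

(** Dropping the square n^2 in the chord relation bounds m c^2 by the product of three values of
    [alpha]; the factor C(V + W)^2 cancels against the bound [shift_le] for [alpha] at V + W. *)
Lemma no_double V W k : V != 0 -> W != 0 -> V != W -> V != - W ->
    small V -> small W -> small (V + W) -> al V = 2 * k + 1 -> al W = 2 * al V -> False.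
Proof.
move=> V0 W0 VW VNW sV sW sU ok e2.
have [M [[M1 Mt sM] hV hW hU]] := common_bound sV sW sU.
have U0 : V + W != 0 by rewrite addr_eq0.
have [n [l [e _ _ _]]] := chord hm V0 W0 VW VNW.
have [aV cV] := heights_le hV; have [aW cW] := heights_le hW; have [aU cU] := heights_le hU.
have cU0 : 0 < C (V + W) ^+ 2 by rewrite exprn_gt0 // xysqrt_gt0.
apply: (no_double_int (xysqrt_gt0 V0) (xysqrt_gt0 W0) aV aW cV cW M1 Mt sM erefl erefl _ _ e2 ok).
  exact: coprime_xC.
rewrite -(ler_pM2l cU0).
apply: (@le_trans _ _ (al (V + W) * (al V * al W))); last first.
  rewrite [X in _ <= X]mulrA ler_pM2r; first by rewrite /alpha; apply: shift_le => //; exact: xysqrt_gt0.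
  by apply: mulr_gt0; exact: alpha_gt0.
by have h := sqr_ge0 n; clear - e h; lia.
Qed.

Lemma dvdz_le (x y : int) : (x %| y)%Z -> y != 0 -> `|x| <= `|y|.
Proof.
move=> /dvdzP[q ->]; rewrite mulf_eq0 => /norP[q0 _]; rewrite normrM ler_peMl //.
by rewrite -gtz0_ge1 normr_gt0.
Qed.

(* The left side divides d n, where n is the value at - t of the chord of V and W. *)
Lemma mixed_bound V W U n k : let c := C U * C V * C W in
    let d := A W * C V ^+ 2 - A V * C W ^+ 2 in
    0 < al V -> 0 < al W -> (al V %| B V)%Z -> (al W %| B W)%Z -> m = 2 * (al V * al W) ->
    n ^+ 2 + m * c ^+ 2 = al U * al V * al W ->
    C V ^+ 2 * n = C U * C W * B V - k * al V ->
    C W ^+ 2 * n = C U * C V * B W - k * al W ->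
    n != 0 -> d != 0 ->
  al V * al W * C U ^+ 2 <= d ^+ 2 * (al U - 2 * c ^+ 2).
Proof.
move=> c d; have cV := coprime_alphaC t V; have cW := coprime_alphaC t W.
have dE : d = C V ^+ 2 * al W - C W ^+ 2 * al V by rewrite /d /alpha; ring.
clearbody d; clearbody c.
move: (al V) (al W) (al U) cV cW dE => a a' a'' cV cW dE a0 a0' dV dW em e0 e1 e2 n0 d0.
have dn : (a %| n)%Z.
  rewrite -(Gauss_dvdzr _ (coprimezXr 2 cV)) e1.
  by apply: dvdzB; [exact: dvdz_mull | exact: dvdz_mull].
have dn' : (a' %| n)%Z.
  rewrite -(Gauss_dvdzr _ (coprimezXr 2 cW)) e2.
  by apply: dvdzB; [exact: dvdz_mull | exact: dvdz_mull].
case/dvdzP: dV => b eb; case/dvdzP: dW => b' eb'.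
case/dvdzP: dn => u eu; case/dvdzP: dn' => u' eu'.
have f1 : C V ^+ 2 * u = C U * C W * b - k.
  by apply: (mulIf (lt0r_neq0 a0)); transitivity (C V ^+ 2 * n); [rewrite eu; ring | rewrite e1 eb; ring].
have f2 : C W ^+ 2 * u' = C U * C V * b' - k.
  by apply: (mulIf (lt0r_neq0 a0')); transitivity (C W ^+ 2 * n); [rewrite eu'; ring | rewrite e2 eb'; ring].
have f3 : d * n = a * a' * C U * (C W * b - C V * b').
  have -> : d * n = a * a' * (C V ^+ 2 * u - C W ^+ 2 * u').
    have -> : d * n = C V ^+ 2 * a' * n - C W ^+ 2 * a * n by rewrite dE; ring.
    by rewrite {1}eu eu'; ring.
  by rewrite f1 f2; ring.
have h1 : `|a * a' * C U| <= `|d * n|.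
  by apply: dvdz_le; [rewrite f3; exact/dvdz_mulr/dvdzz | rewrite mulf_neq0].
have h2 : (a * a' * C U) ^+ 2 <= (d * n) ^+ 2.
  by rewrite -(real_normK (num_real (_ * C U))) -(real_normK (num_real (d * n))) lerXn2r ?nnegrE.
have aa0 : 0 < a * a' by exact: mulr_gt0.
rewrite -(ler_pM2l aa0); apply: le_trans (_ : (d * n) ^+ 2 <= _); first by apply: le_trans h2; clear; lia.
have -> : (d * n) ^+ 2 = d ^+ 2 * (a'' * a * a' - m * c ^+ 2) by rewrite -e0; ring.
by rewrite em le_eqVlt; apply/orP; left; apply/eqP; ring.
Qed.

Lemma coprime_self_unit (x y : int) : 0 <= y -> coprimez x y -> (y %| x)%Z -> y = 1.
Proof.
move=> y0 /eqP co dv; have : (y %| gcdz x y)%Z by rewrite dvdz_gcd dv dvdzz.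
by rewrite co dvdzE dvdn1; clear - y0; lia.
Qed.

(** If the chord vanishes at - t, then m = 2 alpha(V) alpha(W) forces alpha(U) = 2 (C U C V C W)^2.
    Coprimality then gives C = 1 for U, V and W, so alpha(U) = 2, t = 3 and all heights are 1; the
    odd values alpha(V) and alpha(W) both equal 3, against V and W being distinct up to sign. *)
Lemma mixed_nonzero V W k (n : int) : V != 0 -> W != 0 -> V != W -> V != - W ->
    let U := V + W in small V -> small W -> small U ->
    (al V %| B V)%Z -> (al W %| B W)%Z -> m = 2 * (al V * al W) ->
    (exists j, al V = 2 * j + 1) -> (exists j, al W = 2 * j + 1) ->
    n ^+ 2 + m * (C U * C V * C W) ^+ 2 = al U * al V * al W ->
    C V ^+ 2 * n = C U * C W * B V - k * al V ->
    C W ^+ 2 * n = C U * C V * B W - k * al W ->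
    C U ^+ 2 * n = - (C V * C W * B U) - k * al U ->
  n != 0.
Proof.
move=> V0 W0 VW VNW U sV sW sU dV dW em oV oW e0 e1 e2 e3; apply/eqP => n0.
rewrite n0 expr0n /= add0r !mulr0 in e0 e1 e2 e3.
have U0 : U != 0 by rewrite /U addr_eq0.
have a0 := alpha_gt0 sV; have a0' := alpha_gt0 sW.
have [p0 q0 c0] := And3 (xysqrt_gt0 V0) (xysqrt_gt0 W0) (xysqrt_gt0 U0).
case/dvdzP: (dV) => b eb; case/dvdzP: (dW) => b' eb'.
have cU : C U = 1.
  apply: (coprime_self_unit (xysqrt_ge0 U) (coprime_alphaC t U)).
  apply/dvdzP; exists (2 * C U * (C V * C W) ^+ 2).
  apply: (mulIf (lt0r_neq0 (mulr_gt0 a0 a0'))); rewrite mulrA -e0 em; ring.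
have eU : al U = 2 * (C V * C W) ^+ 2.
  apply: (mulIf (lt0r_neq0 (mulr_gt0 a0 a0'))); rewrite mulrA -e0 em cU; ring.
have f1 : C W * b = k.
  by apply: (mulIf (lt0r_neq0 a0)); move: e1; rewrite cU mul1r eb => e1; clear - e1; lia.
have f2 : C V * b' = k.
  by apply: (mulIf (lt0r_neq0 a0')); move: e2; rewrite cU mul1r eb' => e2; clear - e2; lia.
have co (X : EC hE) (x y : int) : B X = x * y -> coprimez x (C X).
  by move=> e; have := coprime_yC X; rewrite e coprimezMl => /andP[].
have cb := co _ _ _ eb; have cb' := co _ _ _ eb'.
have pq : C V = C W.
  have d1 : (C V %| C W)%Z.
    have cb1 : coprimez (C V) b by rewrite coprimez_sym.
    by rewrite -(Gauss_dvdzr (C W) cb1) [b * _]mulrC f1 -f2 dvdz_mulr // dvdzz.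
  have d2 : (C W %| C V)%Z.
    have cb1 : coprimez (C W) b' by rewrite coprimez_sym.
    by rewrite -(Gauss_dvdzr (C V) cb1) [b' * _]mulrC f2 -f1 dvdz_mulr // dvdzz.
  apply/eqP; rewrite eq_le.
  have h1 := dvdz_le d1 (lt0r_neq0 q0); have h2 := dvdz_le d2 (lt0r_neq0 p0).
  by rewrite !gtr0_norm // in h1 h2; rewrite h1 h2.
rewrite -pq in eU f1 e3; clear f2.
have eBU : B U = - (2 * b * C V ^+ 3).
  have h : C V ^+ 2 * B U = C V ^+ 2 * (- (2 * b * C V ^+ 3)).
    by move: e3; rewrite eU -f1 => e3; clear - e3; lia.
  by apply: mulfI h; rewrite expf_neq0 // gt_eqF.
have p1 : C V = 1.
  have := alpha_curve hm U; rewrite cU eU eBU em !expr1n !mulr1.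
  set z := (_ + _ in RHS) => h.
  have h4 : al V * al W = C V ^+ 4 * (z - 2 * b ^+ 2 * C V ^+ 2).
    clearbody z; move: (al V) (al W) (C V) h => x y p h.
    apply: (mulfI (_ : 2 != 0)) => //; apply: (addrI ((- (2 * b * p ^+ 3)) ^+ 2)).
    by rewrite [LHS]h; ring.
  apply: (coprime_self_unit (x := al V * al W) (ltW p0)).
    by rewrite coprimezMl coprime_alphaC pq coprime_alphaC.
  by rewrite h4 exprS -mulrA dvdz_mulr // dvdzz.
have t4 : t < 4.
  by have := alpha_gt U0 sU; rewrite eU p1; clear; lia.
have h1 (X : EC hE) : small X -> H X = 1.
  by move=> sX; have := small_half sX; have := naive_height_ge1 X; clear - t4; lia.
have t3 : t = 3.
  by have := small_half sV; rewrite (h1 V sV); clear - t4; lia.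
suff e : al V = al W.
  case: (alpha_inj sV sW e) => e'; first by rewrite e' eqxx in VW.
  by rewrite e' eqxx in VNW.
have := heights V; have := heights W; rewrite (h1 V sV) (h1 W sW).
move: oV oW; rewrite /alpha -pq p1 t3 expr1n mulr1 => -[j ej] [j' ej'] [g1 _] [g2 _].
by clear - ej ej' g1 g2; lia.
Qed.

(** For U = V + W and U' = V - W only the product of the heights is controlled; the inequality k +
    k' <= 1 + k k' for k, k' >= 1 expresses the bound through it. *)
Lemma alpha_prod_le U U' : 1 <= C U -> 1 <= C U' ->
  al U * al U' <= (t + 1) * (t + H U * H U') * (C U ^+ 2 * C U' ^+ 2).
Proof.
move=> c1 c1'; have [h _] := heights U; have [h' _] := heights U'.
have H1 := naive_height_ge1 U; have H1' := naive_height_ge1 U'.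
have z1 : 1 <= C U ^+ 2 by rewrite -gtz0_ge1 exprn_gt0.
have z1' : 1 <= C U' ^+ 2 by rewrite -gtz0_ge1 exprn_gt0.
rewrite /alpha; move: (A U) (A U') (H U) (H U') (C U ^+ 2) (C U' ^+ 2) h h' H1 H1' z1 z1'.
move=> x x' k k' z z' h h' H1 H1' z1 z1'; clear - t0 h h' H1 H1' z1 z1'.
have Z : 1 <= z * z' by have := ler_pM (ler01 : 0 <= 1 :> int) ler01 z1 z1'; rewrite mulr1.
have K0 : 0 <= k * k' by apply: mulr_ge0; lia.
have h1 : x * x' <= k * k' * (z * z').
  apply: (@le_trans _ _ (k * k')); last by have := ler_wpM2l K0 Z; rewrite mulr1.
  by apply: (le_trans (ler_norm _)); rewrite normrM; apply: ler_pM.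
have h2 : x * z' + x' * z <= (1 + k * k') * (z * z').
  have l1 : x * z' <= k * (z * z').
    have g1 : 0 <= z' by lia.
    have g2 : x <= k by lia.
    have g3 : 0 <= k * z' by apply: mulr_ge0; lia.
    by have := ler_wpM2r g1 g2; have := ler_wpM2l g3 z1; lia.
  have l2 : x' * z <= k' * (z * z').
    have g1 : 0 <= z by lia.
    have g2 : x' <= k' by lia.
    have g3 : 0 <= k' * z by apply: mulr_ge0; lia.
    by have := ler_wpM2r g1 g2; have := ler_wpM2l g3 z1'; lia.
  have l3 : (k + k') * (z * z') <= (1 + k * k') * (z * z').
    apply: ler_wpM2r; first by lia.
    have : 0 <= (k - 1) * (k' - 1) by apply: mulr_ge0; lia.
    lia.
  by lia.
have := ler_wpM2l (ltW t0) h2; lia.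
Qed.

(** The left side is the quadratic form of [pair_factor] evaluated at - t, that is, Q + t S + t^2 D
    = k alpha(V + W) alpha(V - W). *)
Lemma pair_bound V W : V != 0 -> W != 0 -> V != W -> V != - W ->
  (al V * al W - (3 * t ^+ 2 + a4) * C V ^+ 2 * C W ^+ 2) ^+ 2
    + 4 * m * C V ^+ 2 * C W ^+ 2 * (al V * C W ^+ 2 + al W * C V ^+ 2 - 3 * t * C V ^+ 2 * C W ^+ 2) <=
  (t + 1) * (t + H (V + W) * H (V - W)) * (A V * C W ^+ 2 - A W * C V ^+ 2) ^+ 2.
Proof.
move=> V0 W0 VW VNW; set P := C V ^+ 2; set Q := C W ^+ 2.
have c1 : 0 < C (V + W) by apply: xysqrt_gt0; rewrite addr_eq0.
have c2 : 0 < C (V - W) by apply: xysqrt_gt0; rewrite subr_eq0.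
have [k k0 [e1 e2 e3]] := pair_factor V W; rewrite !xden_sqr -/P -/Q in e1 e2 e3.
have d0 : 0 <= pair_den (A V) P (A W) Q by exact: sqr_ge0.
have z0 : 0 < C (V + W) ^+ 2 * C (V - W) ^+ 2 by rewrite mulr_gt0 ?exprn_gt0.
have kp : 0 < k by rewrite lt_neqAle eq_sym k0 -(ler_pM2r z0) mul0r -e1.
rewrite -[(_ - A W * P) ^+ 2]/(pair_den (A V) P (A W) Q) e1.
have -> : (al V * al W - (3 * t ^+ 2 + a4) * P * Q) ^+ 2
    + 4 * m * P * Q * (al V * Q + al W * P - 3 * t * P * Q) =
  k * (al (V + W) * al (V - W)).
  transitivity (pair_prod a4 a6 (A V) P (A W) Q + t * pair_sum a4 a6 (A V) P (A W) Q
    + t ^+ 2 * pair_den (A V) P (A W) Q).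
    by rewrite /pair_prod /pair_sum /pair_den /alpha hm -/P -/Q; ring.
  by rewrite e1 e2 e3 /alpha; ring.
have := ler_wpM2l (ltW kp) (alpha_prod_le c1 c2).
by move=> h; apply: le_trans h _; rewrite le_eqVlt; apply/orP; left; apply/eqP; ring.
Qed.

Lemma no_mixed V W : V != 0 -> W != 0 -> V != W -> V != - W ->
    small V -> small W -> small (V + W) ->
    (al V %| B V)%Z -> (al W %| B W)%Z -> m = 2 * (al V * al W) ->
    (exists j, al V = 2 * j + 1) -> (exists j, al W = 2 * j + 1) ->
    (t + 1) ^+ 4 * (H (V + W) * H (V - W)) < m ^+ 2 -> False.
Proof.
move=> V0 W0 VW VNW sV sW sU dV dW em oV oW hh.
have [M [[M1 Mt sM] hV hW hU]] := common_bound sV sW sU.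
have U0 : V + W != 0 by rewrite addr_eq0.
have a0 := alpha_gt0 sV; have a0' := alpha_gt0 sW.
have [aV cV] := heights_le hV; have [aW cW] := heights_le hW; have [aU cU] := heights_le hU.
have [p0 q0 u0] := And3 (xysqrt_gt0 V0) (xysqrt_gt0 W0) (xysqrt_gt0 U0).
have I1 : al V * al W <= (A W * C V ^+ 2 - A V * C W ^+ 2) ^+ 2 * (t + M - 2 * (C V ^+ 2 * C W ^+ 2)).
  have [n [k [e0 e1 e2 e3]]] := chord hm V0 W0 VW VNW.
  have n0 := mixed_nonzero V0 W0 VW VNW sV sW sU dV dW em oV oW e0 e1 e2 e3.
  have d0 : A W * C V ^+ 2 - A V * C W ^+ 2 != 0.
    apply/eqP => d0; have [] := @pair_den0 _ _ hE V W.
      by rewrite /pair_den !xden_sqr; apply/eqP; rewrite sqrf_eq0 -oppr_eq0 opprB d0.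
    rewrite !xden_sqr => f1 f2; have f3 : C V = C W.
      by apply: (pexpIrn (n := 2)); rewrite ?nnegrE ?xysqrt_ge0.
    case: (point_eqN f1 f3) => f; first by rewrite f eqxx in VW.
    by rewrite f eqxx in VNW.
  have h := mixed_bound a0 a0' dV dW em e0 e1 e2 n0 d0.
  rewrite -(ler_pM2r (exprn_gt0 2 u0)); apply: (le_trans h).
  rewrite -[X in _ <= X]mulrA; apply: ler_wpM2l; first exact: sqr_ge0.
  have : al (V + W) <= C (V + W) ^+ 2 * (t + M) by apply: shift_le.
  by clear; lia.
have [t4|t4] := lerP 466 t; last first.
  case: oV => j ej; case: oW => j' ej'.
  apply: (small_pairs p0 q0 aV aW cV cW Mt t4 (erefl (al V)) (erefl (al W)) _ _ ej ej').
  - by rewrite mulrC -em.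
  - exact: I1.
have P1 : 1 <= C V ^+ 2 by rewrite -gtz0_ge1 exprn_gt0.
have Q1 : 1 <= C W ^+ 2 by rewrite -gtz0_ge1 exprn_gt0.
have hM : M ^+ 2 * (t + 1) ^+ 2 < 2 * ((t * C V ^+ 2 + M) * (t * C W ^+ 2 + M)).
  have [_ l1 l2] := shift_bounds aV P1 cV Mt; have [_ l1' l2'] := shift_bounds aW Q1 cW Mt.
  rewrite mulrC; apply: (lt_le_trans sM); rewrite em ler_pM2l //.
  by apply: ler_pM => //; exact: ltW.
have hM' : M ^+ 2 * (t + 1) ^+ 2 < 2 * ((t * C W ^+ 2 + M) * (t * C V ^+ 2 + M)).
  by rewrite [_ * (t * C V ^+ 2 + M)]mulrC.
have QP := ratio_bound P1 Q1 cV cW Mt hM; have PQ := ratio_bound Q1 P1 cW cV Mt hM'.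
have pair := pair_bound V0 W0 VW VNW.
have ecur : B V ^+ 2 + m * (C V ^+ 2) ^+ 3 =
    al V * (A V ^+ 2 - A V * t * C V ^+ 2 + (t ^+ 2 + a4) * (C V ^+ 2) ^+ 2).
  by have := alpha_curve hm V; rewrite -!exprM.
have [ea ea'] : al V = A V + t * C V ^+ 2 /\ al W = A W + t * C W ^+ 2 by [].
clear - t4 Mt P1 Q1 PQ QP aV aW a0 a0' ea ea' em sM I1 ecur pair hh.
move: (al V) (al W) (A V) (A W) (C V ^+ 2) (C W ^+ 2) (B V) (H (V + W) * H (V - W))
  P1 Q1 PQ QP aV aW a0 a0' ea ea' em I1 ecur pair hh.
move=> a a' x x' P Q b h P1 Q1 PQ QP hx hx' a0 a0' ea ea' em I1 ecur pair hh.
(* The data are moved to the rationals because [large_pairs] divides by P and Q. *)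
have cast (u v : int) : u <= v -> u%:~R <= v%:~R :> rat by rewrite ler_int.
have castlt (u v : int) : u < v -> u%:~R < v%:~R :> rat by rewrite ltr_int.
have casteq (u v : int) : u = v -> u%:~R = v%:~R :> rat by move->.
have rE := (rmorph_nat, rmorph1, rmorphB, rmorphD, rmorphM, rmorphXn).
refine (@large_pairs rat t%:~R m%:~R M%:~R x%:~R x'%:~R P%:~R Q%:~R a%:~R a'%:~R b%:~R a4%:~R h%:~R
  _ _ _ _ _ _ _ _ _ _ _ _ _ _ _ _ _ _ _ _).
- exact: (cast 466).
- by move/castlt: Mt; rewrite !rE /=.
- by rewrite ltr0z; apply: lt_le_trans P1.
- by rewrite ltr0z; apply: lt_le_trans Q1.
- by move/cast: PQ; rewrite !rE /=.
- by move/cast: QP; rewrite !rE /=.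
- exact: (cast 1).
- exact: (cast 1).
- by move/cast: hx; rewrite intr_norm.
- by move/cast: hx'; rewrite intr_norm.
- by rewrite ltr0z.
- by rewrite ltr0z.
- by rewrite ea !rE.
- by rewrite ea' !rE.
- by rewrite em !rE.
- by move/castlt: sM; rewrite !rE /=.
- by move/cast: I1; rewrite !rE /=.
- by move/casteq: ecur; rewrite !rE /=.
- by move/cast: pair; rewrite !rE /=.
by move/castlt: hh; rewrite !rE /=.
Qed.

End SmallPoints.

(** * Forms attached to points *)

(** The ratios at which the other replacements degenerate. For m = 2 al^2 the dual form has first
    coefficient [al] again; for m = 4 al^2 one gets lo = hi; for m = 3 al^2 and 3 m = 4 al^2 one
    gets hi = 3 lo. In the last three cases the reduced form has extra automorphisms. *)
Definition special_twin (m al : int) : Prop :=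
  [\/ m = 2 * al ^+ 2, m = 3 * al ^+ 2, m = 4 * al ^+ 2 | 3 * m = 4 * al ^+ 2].

Inductive cusp_twin (m al be a b : int) : Prop :=
| TwinShift h of al = 4 * h & a = al & b = be + 2 * h
| TwinHalf j of al = 2 * a & a = 2 * j + 1 & b = 0
| TwinDouble j of al = 2 * j + 1 & a = 2 * al & 4 * al ^+ 2 < m
| TwinDual j i of al = 2 * j + 1 & a = 2 * i + 1 & m = 2 * (a * al) & b = 0 & m <> 2 * al ^+ 2
| TwinSpecial j of al = 2 * j + 1 & a = 2 & special_twin m al.

(** The pair (a, c) determines lo and hi; whether m is odd or divisible by 4 then tells which of
    them gives back [al]. *)
Definition reduced_twin (m al a c : int) : Prop := exists lo hi : int,
  [/\ lo * hi = m, 0 < lo, lo < hi,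
      (2 * a = lo + hi /\ a = c) \/ (a = 2 * lo /\ a < c) &
      (lo = al /\ exists j, m = 2 * j + 1) \/ (hi = 2 * al /\ exists j, m = 4 * j)].

(** Odd squares are 1 modulo 8, so two distinct ones cannot satisfy two of the four relations with
    the same m. *)
Lemma special_twin_inj m al al' j j' : 0 < al -> 0 < al' ->
    al = 2 * j + 1 -> al' = 2 * j' + 1 ->
  special_twin m al -> special_twin m al' -> al = al'.
Proof.
move=> a0 a0' e e' h h'.
suff q : al ^+ 2 = al' ^+ 2 by apply: (pexpIrn (n := 2)); rewrite ?nnegrE ?ltW.
have [i ei] : exists i, j * (j + 1) = 2 * i.
  have [k [|]] : exists k, j = 2 * k \/ j = 2 * k + 1 by exists (j %/ 2)%Z; lia.
    by move=> ->; exists (k * (2 * k + 1)); ring.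
  by move=> ->; exists ((2 * k + 1) * (k + 1)); ring.
have [i' ei'] : exists i, j' * (j' + 1) = 2 * i.
  have [k [|]] : exists k, j' = 2 * k \/ j' = 2 * k + 1 by exists (j' %/ 2)%Z; lia.
    by move=> ->; exists (k * (2 * k + 1)); ring.
  by move=> ->; exists ((2 * k + 1) * (k + 1)); ring.
have s1 : al ^+ 2 = 8 * i + 1 by rewrite e; move: ei; clear; lia.
have s2 : al' ^+ 2 = 8 * i' + 1 by rewrite e'; move: ei'; clear; lia.
rewrite /special_twin in h h'; move: (al ^+ 2) (al' ^+ 2) s1 s2 h h' => u v s1 s2; clear - s1 s2.
by case=> h; case=> h'; lia.
Qed.

(** Mostly [a] modulo 4 reveals the constructor, and al > 1 separates 2 al from the special value 2.
    The odd values of TwinHalf and TwinDual can only clash with m = al al', against both squares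
    being below m. *)
Lemma twin_same_al m al al' be be' a b b' : 1 < al -> 1 < al' ->
    al ^+ 2 < m -> al' ^+ 2 < m ->
    cusp_twin m al be a b -> cusp_twin m al' be' a b' -> al = al'.
Proof.
move=> a1 a1' lt lt' [h e1 e2 _|j e1 e2 _|j e1 e2 _|j i e1 e2 e3 _ _|j e1 e2 s]
  [h' f1 f2 _|j' f1 f2 _|j' f1 f2 _|j' i' f1 f2 f3 _ _|j' f1 f2 s'].
all: try by clear - a1 a1' e1 e2 f1 f2; lia.
- have : al * al' < m by clear - a1 a1' lt lt'; nia.
  by rewrite f3 e1; clear; lia.
- have : al * al' < m by clear - a1 a1' lt lt'; nia.
  by rewrite e3 f1; clear; lia.
- have a0 : a != 0 by clear - e2; lia.
  by apply: (mulfI a0); move: e3; rewrite f3; clear; lia.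
by apply: (special_twin_inj _ _ e1 f1 s s'); lia.
Qed.

Lemma reduced_twin_inj m al al' a c :
  reduced_twin m al a c -> reduced_twin m al' a c -> al = al'.
Proof.
move=> [lo [hi [e1 l0 lh h1 h2]]] [lo' [hi' [f1 l0' lh' g1 g2]]].
have [el eh] : lo = lo' /\ hi = hi'.
  case: h1 => -[h1 h3]; case: g1 => -[g1 g3]; try by clear - h3 g3; lia.
    have es : lo + hi = lo' + hi' by rewrite -h1 -g1.
    have : (hi - lo) ^+ 2 = (hi' - lo') ^+ 2.
      transitivity ((lo + hi) ^+ 2 - 4 * m); first by rewrite -e1; ring.
      by rewrite es -f1; ring.
    move=> /eqP; rewrite eqrXn2 ?subr_ge0 ?ltW // => /eqP.
    by clear - es; lia.
  have el : lo = lo' by clear - h1 g1; lia.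
  split=> //; apply: (mulfI (_ : lo != 0)); first by rewrite gt_eqF.
  by rewrite e1 el f1.
by case: h2 => -[h2 [j h3]]; case: g2 => -[g2 [j' g3]]; clear - el eh h2 h3 g2 g3; lia.
Qed.

(* The congruence class of y / c ^ 3 modulo al. *)
Definition tangent (al c y be : int) := (al %| be * c ^+ 3 - y)%Z.

Lemma tangent_ex al c y : coprimez al c -> exists be, tangent al c y be.
Proof.
move=> co; have /coprimezP[[u v] /= e] := coprimezXr 3 co.
exists (y * v); apply/dvdzP; exists (- (y * u)).
have -> : y * v * c ^+ 3 - y = y * (v * c ^+ 3) - y by ring.
have -> : v * c ^+ 3 = 1 - u * al by rewrite -e; ring.
by ring.
Qed.

Lemma tangent_eq al c y be be' : coprimez al c ->
  tangent al c y be -> tangent al c y be' -> (al %| be - be')%Z.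
Proof.
move=> co h h'; rewrite -(Gauss_dvdzr _ (coprimezXr 3 co)).
have -> : c ^+ 3 * (be - be') = (be * c ^+ 3 - y) - (be' * c ^+ 3 - y) by ring.
exact: dvdzB.
Qed.

Lemma tangentN al c y be : tangent al c y be -> tangent al c (- y) (- be).
Proof.
move=> /dvdzP[k e]; apply/dvdzP; exists (- k).
by transitivity (- (be * c ^+ 3 - y)); [ring | rewrite e; ring].
Qed.

Lemma tangent_sqr al c y be m : coprimez al c -> (al %| y ^+ 2 + m * c ^+ 6)%Z ->
  tangent al c y be -> (al %| m + be ^+ 2)%Z.
Proof.
move=> co h t; rewrite -(Gauss_dvdzr _ (coprimezXr 6 co)).
have -> : c ^+ 6 * (m + be ^+ 2) = (y ^+ 2 + m * c ^+ 6) + (be * c ^+ 3 - y) * (be * c ^+ 3 + y) by ring.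
by apply: dvdzD => //; exact: dvdz_mulr.
Qed.

Lemma tangent_dvd al c y be k : coprimez al c -> tangent al c y be ->
  (al %| k * y)%Z -> (al %| k * be)%Z.
Proof.
move=> co h hk; rewrite -(Gauss_dvdzr _ (coprimezXr 3 co)).
have -> : c ^+ 3 * (k * be) = k * y + k * (be * c ^+ 3 - y) by ring.
by apply: dvdzD => //; exact: dvdz_mull.
Qed.

Lemma parity_cases (x : int) : exists k, x = 2 * k \/ x = 2 * k + 1.
Proof. by exists (x %/ 2)%Z; lia. Qed.

Lemma odd_dvd2 (al x j : int) : al = 2 * j + 1 -> (al %| 2 * x)%Z -> (al %| x)%Z.
Proof.
move=> e; rewrite Gauss_dvdzr //; apply/coprimezP; exists (1, - j) => /=; lia.
Qed.

(** The sign selects one point of each colliding pair. A point with y = 0 is its own opposite and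
    keeps its form. *)
Definition bad_point (al y : int) := (al %| 2 * y)%Z && (y < 0).

(** The alternatives are separated by size: a^2 < m in the first one, while in the second m <= a^2
    for the minimum [a] of the class. *)
Definition point_form (m al c y : int) (X : set bqf) : Prop :=
  (exists a b d be, [/\ X = bqf_class (a, 2 * b, d), [/\ a * d - b ^+ 2 = m, 0 < a & a ^+ 2 < m],
     tangent al c y be &
     (~~ bad_point al y /\ a = al /\ b = be) \/ (bad_point al y /\ cusp_twin m al be a b)]) \/
  (exists a b d, [/\ X = bqf_class (a, 2 * b, d), a * d - b ^+ 2 = m,
     [/\ 0 < a, `|2 * b| <= a, a <= d & m <= a ^+ 2], bad_point al y & reduced_twin m al a d]).

(* A point with [al | 2 y] and its opposite give equivalent forms; one of the
   two is sent to a form that no other point uses. *)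
Lemma point_form_ex m al c y : 0 < al -> al ^+ 2 < m -> 4 < m -> coprimez al c ->
    (al %| y ^+ 2 + m * c ^+ 6)%Z ->
  exists X, [/\ point_form m al c y X, bqf_classes (- (4 * m)) X & bqf_class_aut X = 1%N].
Proof.
move=> al0 lt m4 co hy; have m0 : 0 < m by clear - m4; lia.
have [be tb] := tangent_ex y co; have dm := tangent_sqr co hy tb.
have cusp a b d : a * d - b ^+ 2 = m -> 0 < a -> a ^+ 2 < m ->
    (~~ bad_point al y /\ a = al /\ b = be) \/ (bad_point al y /\ cusp_twin m al be a b) ->
  exists X, [/\ point_form m al c y X, bqf_classes (- (4 * m)) X & bqf_class_aut X = 1%N].
  move=> em a0 am h; exists (bqf_class (a, 2 * b, d)); split.
  - by left; exists a, b, d, be.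
  - exact: form_class_mem.
  - by apply: rigid_aut; apply: cusp_rigid em am.
have [bad|ok] := boolP (bad_point al y); last first.
  case/dvdzP: dm => d ed; apply: (cusp al be d) => //; last by left.
  by rewrite mulrC -ed addrK.
move: (bad) => /andP[d2 y0].
have d2b := tangent_dvd co tb d2.
(* For al = 2 h, [h] divides [be]. If h is even, [be + h] is a second square root of - m modulo
   [al]; if h is odd, h divides m and (h, 0, m / h) serves. *)
have [h [eh|eh]] := parity_cases al.
  have [j [ej|ej]] := parity_cases h.
    case/dvdzP: dm => d ed; case/dvdzP: d2b => k ek.
    apply: (cusp al (be + h) (d + be + j)) => //; last first.
      by right; split=> //; apply: (@TwinShift _ _ _ _ _ j) => //; [rewrite eh ej; ring | rewrite ej].
    have eA : al = 4 * j by rewrite eh ej; ring.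
    have eB : be = 2 * k * j by move: ek; rewrite eA; clear; lia.
    have -> : m = d * al - be ^+ 2 by rewrite -ed addrK.
    by rewrite eA ej eB; ring.
  have dh : (h %| m)%Z.
    have hb : (h %| be)%Z by case/dvdzP: d2b => k ek; apply/dvdzP; exists k; move: ek; rewrite eh; clear; lia.
    have hm : (h %| m + be ^+ 2)%Z by apply: dvdz_trans dm; rewrite eh dvdz_mull // dvdzz.
    rewrite (_ : m = (m + be ^+ 2) - be ^+ 2); last by rewrite addrK.
    by apply: dvdzB => //; rewrite expr2 dvdz_mulr.
  case/dvdzP: dh => d ed; apply: (cusp h 0 d).
  - by rewrite ed; ring.
  - by clear - al0 eh; lia.
  - by apply: le_lt_trans lt; rewrite eh exprMn; have := sqr_ge0 h; clear; lia.
  - by right; split=> //; apply: (@TwinHalf _ _ _ _ _ j).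
have db := odd_dvd2 eh d2b.
have dal : (al %| m)%Z.
  rewrite (_ : m = (m + be ^+ 2) - be ^+ 2); last by rewrite addrK.
  by apply: dvdzB => //; rewrite expr2 dvdz_mulr.
case/dvdzP: dal => g eg.
(* For odd [al], m = g al. If 2 al is still below the square root of m, it can be a first
   coefficient, with middle coefficient 0 or 2 al according to the parity of g. *)
have [lt4|le4] := ltrP (4 * al ^+ 2) m.
  have a2 : (2 * al) ^+ 2 < m by rewrite exprMn.
  have a0 : 0 < 2 * al by clear - al0; lia.
  have [k [ek|ek]] := parity_cases g.
    apply: (cusp (2 * al) 0 k) => //; first by rewrite eg ek; ring.
    by right; split=> //; apply: (@TwinDouble _ _ _ _ _ h).
  apply: (cusp (2 * al) al (k + h + 1)) => //; first by rewrite eg ek eh; ring.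
  by right; split=> //; apply: (@TwinDouble _ _ _ _ _ h).
have spec : special_twin m al -> exists X, [/\ point_form m al c y X, bqf_classes (- (4 * m)) X & bqf_class_aut X = 1%N].
  move=> sp; have [k [ek|ek]] := parity_cases m.
    apply: (cusp 2 0 k) => //; first by rewrite ek; ring.
    by right; split=> //; apply: (@TwinSpecial _ _ _ _ _ h).
  apply: (cusp 2 1 (k + 1)) => //; first by rewrite ek; ring.
  by right; split=> //; apply: (@TwinSpecial _ _ _ _ _ h).
have [s2|n2] := eqVneq m (2 * al ^+ 2); first by apply: spec; constructor 1.
have [s3|n3] := eqVneq m (3 * al ^+ 2); first by apply: spec; constructor 2.
have [s4|n4] := eqVneq m (4 * al ^+ 2); first by apply: spec; constructor 3.
have [s5|n5] := eqVneq (3 * m) (4 * al ^+ 2); first by apply: spec; constructor 4.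
clear spec.
(* The form (lo u^2 + hi v^2) / 2 on pairs u, v of equal parity. Its reduced shape depends on
   whether hi < 3 lo. The bound hi <= 4 lo yields m <= a^2 in the second shape; hi = lo and hi = 3
   lo would give multiples of the square and hexagonal forms. *)
have reduced lo hi s : lo * hi = m -> 0 < lo -> lo < hi -> hi <= 4 * lo -> hi != 3 * lo ->
    2 * s = lo + hi -> (lo = al /\ exists j, m = 2 * j + 1) \/ (hi = 2 * al /\ exists j, m = 4 * j) ->
  exists X, [/\ point_form m al c y X, bqf_classes (- (4 * m)) X & bqf_class_aut X = 1%N].
  move=> em lo0 lh h4 h3 es h5.
  have [h6|h6] := ltrP hi (3 * lo).
    have e : s * s - (s - lo) ^+ 2 = m by rewrite -em (_ : hi = 2 * s - lo); [ring | rewrite es; ring].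
    exists (bqf_class (s, 2 * (s - lo), s)); split.
    - right; exists s, (s - lo), s; split=> //; last by exists lo, hi; split=> //; left.
      split=> //; try by clear - lo0 lh h6 es; lia.
      by rewrite -e expr2 lerBlDr lerDl sqr_ge0.
    - by apply: form_class_mem => //; clear - lo0 lh es; lia.
    - by apply/rigid_aut/symmetric_rigid; clear - lo0 lh h6 es; lia.
  have {}h6 : 3 * lo < hi by rewrite lt_neqAle eq_sym h3.
  have e : 2 * lo * s - lo ^+ 2 = m.
    by rewrite -em (_ : 2 * lo * s = lo * (2 * s)); [rewrite es; ring | ring].
  exists (bqf_class (2 * lo, 2 * lo, s)); split.
  - right; exists (2 * lo), lo, s; split=> //.
      split=> //; try by clear - lo0 lh h6 es; lia.
      by rewrite -em exprMn expr2; have := ler_wpM2l (ltW lo0) h4; clear; lia.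
    by exists lo, hi; split=> //; right; split=> //; clear - lo0 lh h6 es; lia.
  - by apply: form_class_mem => //; clear - lo0; lia.
  - by apply/rigid_aut/reduced_rigid; clear - lo0 lh h6 es; lia.
have ag : al < g by rewrite -(ltr_pM2r al0) -expr2 -eg.
have ga : g <= 4 * al by rewrite -(ler_pM2r al0) -eg -mulrA -expr2.
have g3 : g != 3 * al by apply: contra n3 => /eqP g3; apply/eqP; rewrite eg g3; ring.
have [k [ek|ek]] := parity_cases g; last first.
  apply: (reduced al g (k + h + 1)) => //; first by rewrite eg mulrC.
    by rewrite ek eh; ring.
  left; split=> //; exists (2 * h * k + h + k); rewrite eg ek eh; ring.
have kal : k <= 2 * al by clear - ga ek; lia.
(* Now m = 2 k al. For odd [k] the dual form (k, 0, 2 al) has k^2 < m; for even [k] the factors k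
   and 2 al have equal parity and give a reduced form. *)
have [i [ei|ei]] := parity_cases k; last first.
  apply: (cusp k 0 (2 * al)).
  - by rewrite eg ek; ring.
  - by clear - ag ek al0; lia.
  - have k2 : k < 2 * al by clear - kal ei; lia.
    have k0 : 0 < k by clear - ag ek al0; lia.
    by rewrite eg ek; have := ltr_pM2l k0 k (2 * al); rewrite k2 => kk; clear - kk; lia.
  - right; split=> //; apply: (@TwinDual _ _ _ _ _ h i) => //; last exact/eqP.
    by rewrite eg ek; ring.
apply: (reduced k (2 * al) (i + al)).
- by rewrite eg ek; ring.
- by clear - ag ek al0; lia.
- rewrite lt_neqAle kal andbT; apply: contra n4 => /eqP e; apply/eqP.
  by rewrite eg ek e; ring.
- by clear - ag ek; lia.
- apply: contra n5 => /eqP e; apply/eqP; rewrite eg ek.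
  by transitivity (2 * (3 * k) * al); [ring | rewrite -e; ring].
- by rewrite ei; ring.
- by right; split=> //; exists (i * al); rewrite eg ek ei; ring.
Qed.

(** * Distinct points give inequivalent forms *)

Section Injectivity.
Variables (a4 a6 : int) (hE : elliptic a4 a6).
Implicit Types P Q V W U : EC hE.
Variables t m : int.
Hypothesis hm : m = t ^+ 3 + a4 * t - a6.
Hypotheses (t0 : 0 < t) (hlow : (t + 1) ^+ 2 < m).
Hypothesis (hup : 4 * m < (t + 1) ^+ 2 * t ^+ 2).

Local Notation A := xnum.
Local Notation B := ynum.
Local Notation C := xysqrt.
Local Notation H := naive_height.
Local Notation al := (alpha t).
Local Notation sml := (small t m).

Let al_gt V := @alpha_gt _ _ _ _ _ hm t0 hlow hup V.
Let al_gt0 V := @alpha_gt0 _ _ _ _ _ hm t0 hlow hup V.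
Let al_sqr V := @alpha_sqr_lt _ _ _ _ _ hm t0 hlow hup V.
Let al_inj V W := @alpha_inj _ _ _ _ _ hm t0 hlow hup V W.

Lemma t_ge3 : 3 <= t.
Proof.
have h0 : sml (0 : EC hE) by rewrite /small expr1n mulr1.
by have := small_half hm t0 hlow hup h0; rewrite /naive_height /=; clear; lia.
Qed.

Lemma small_three V : t = 3 -> sml V -> V != 0 ->
  [/\ m < 36, 16 < m, C V = 1, `|A V| <= 1 & B V ^+ 2 + m = al V * (A V ^+ 2 - 3 * A V + (9 + a4))].
Proof.
move=> t3 sV V0; have := alpha_curve hm V.
have := small_half hm t0 hlow hup sV; have := naive_height_ge1 V => h1 h2.
have [h3 h4] := heights V; have c0 := xysqrt_gt0 V0.
have H1 : H V = 1 by clear - h1 h2 t3; lia.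
rewrite H1 in h3 h4.
have c1 : C V = 1 by clear - c0 h4; nia.
rewrite c1 !expr1n !mulr1 => ->; split=> //.
- by move: hup; rewrite t3; clear; lia.
- by move: hlow; rewrite t3; clear; lia.
- by rewrite t3; ring.
Qed.

(** Since t < 2 alpha and t >= 3, this happens only at t = 3, where every small point has height 1.
    It is a corner case for collisions with alpha(0) = 1 and with the special coefficient 2. *)
Lemma alpha_lt4 V : sml V -> V != 0 -> al V <= 2 ->
  [/\ t = 3, A V = -1, al V = 2 & B V ^+ 2 + m = 26 + 2 * a4].
Proof.
move=> sV V0 a2; have t3 : t = 3 by have := al_gt V0 sV; have := t_ge3; clear - a2; lia.
have [_ _ c1 A1 e] := small_three t3 sV V0.
have a1 : A V = -1 by move: a2; rewrite /alpha c1 t3 expr1n mulr1; clear - A1; lia.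
have a2' : al V = 2 by rewrite /alpha c1 t3 a1.
by split=> //; rewrite e a2' a1; ring.
Qed.

(** This is alpha(W) = 2 alpha(V) for V = 0, where no chord is available; the duplication formula
    bounds the height of 2W from below instead. *)
Lemma no_double_zero W : sml W -> W != 0 -> B W != 0 -> al W = 2 ->
  (t + 1) ^+ 4 * H (W + W) < m ^+ 2 -> False.
Proof.
move=> sW W0 B0 a2 hh; have [t3 A1 _ e] := alpha_lt4 sW W0 (eq_ind_r (fun z => z <= 2) (lexx _) a2).
have [m1 m2 c1 _ _] := small_three t3 sW W0.
have WW : W + W != 0.
  rewrite addr_eq0; apply: contra B0 => /eqP e'.
  by have := congr1 (@ynum _ _ _) e'; rewrite pointN (negbTE W0); clear; lia.
have [k k0 []] := pair_factor W W.
rewrite subrr !xden_sqr c1 A1; have [-> _ -> _] := ynum0 hE.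
rewrite /pair_sum /pair_prod !expr1n expr0n /= => _.
rewrite !(mulr0, mulr1, mul1r, add0r) => e1 e2.
have [_ h2] := heights (W + W); have cc := xysqrt_gt0 WW.
have [H1 _] := heights (W + W).
rewrite t3 in hh; have ea6 : a6 = 27 + 3 * a4 - m by rewrite hm t3; ring.
have z1 : 1 <= C (W + W) ^+ 2 by rewrite -gtz0_ge1 exprn_gt0.
have w0 : 0 < B W ^+ 2 by rewrite exprn_even_gt0.
move: (A (W + W)) (C (W + W) ^+ 2) (H (W + W)) (B W ^+ 2) e1 e2 H1 h2 hh z1 w0 e.
move=> X Z h w e1 e2 h1 h2 hh z1 w0 e.
have f1 : k * Z = 4 * w by rewrite -e1 (_ : w = 26 + 2 * a4 - m) ?ea6; [ring | rewrite -e; ring].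
have f2 : k * (X - 2 * Z) = (3 + a4) ^+ 2.
  by rewrite mulrBr -e2 mulrCA f1 ea6 (_ : w = 26 + 2 * a4 - m); [ring | rewrite -e; ring].
have Z0 : 0 < Z by apply: lt_le_trans z1.
have kp : 0 < k by rewrite -(pmulr_lgt0 _ Z0) f1 pmulr_rgt0.
have XZ : 0 <= X - 2 * Z by rewrite -(pmulr_rge0 _ kp) f2 sqr_ge0.
have m23 : 23 <= m by clear - XZ z1 h1 hh m2; nia.
have key : Z * (m - 20) <= 4 * (X - 2 * Z).
  rewrite -(ler_pM2l (mulr_gt0 kp w0)).
  have -> : k * w * (Z * (m - 20)) = 4 * w ^+ 2 * (m - 20).
    by transitivity (k * Z * w * (m - 20)); [ring | rewrite f1; ring].
  have -> : k * w * (4 * (X - 2 * Z)) = w * (6 + 2 * a4) ^+ 2.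
    by transitivity (4 * w * (k * (X - 2 * Z))); [ring | rewrite f2; ring].
  have -> : 6 + 2 * a4 = w + (m - 20) by clear - e; lia.
  by have := mulr_ge0 (ltW w0) (sqr_ge0 (w - (m - 20))); clear; lia.
have k2 : m - 20 <= Z * (m - 20) by rewrite ler_peMl //; clear - m23; lia.
(* The height h of 2W is at least 2 + (m - 20) / 4, and 256 times this minus m^2 is - (m - 16) (m -
   48), which is positive for 16 < m < 36, against 256 h < m^2. *)
by clear - k2 key z1 h1 hh m1 m2; nia.
Qed.

(** At t = 3 an odd alpha(W) equals 3, so m is 18 or 27, and then B(V)^2 would be 2 modulo 3. *)
Lemma no_special_two V W : sml V -> V != 0 -> al V = 2 -> sml W -> W != 0 ->
  (exists j, al W = 2 * j + 1) -> (al W %| B W)%Z -> special_twin m (al W) -> False.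
Proof.
move=> sV V0 a2 sW W0 [j ej] dW sp.
have [t3 A1 _ e] := alpha_lt4 sV V0 (eq_ind_r (fun z => z <= 2) (lexx _) a2).
have [m1 m2 c1 hA e'] := small_three t3 sW W0.
have aE : al W = A W + 3 by rewrite /alpha c1 t3 expr1n mulr1.
have A0 : A W = 0 by move: aE; rewrite ej; clear - hA; lia.
have a3 : al W = 3 by rewrite aE A0.
case/dvdzP: dW => k; rewrite a3 => ek.
rewrite a3 A0 ek in e'; rewrite /special_twin a3 in sp.
have [n en] : exists n, B V ^+ 2 = 3 * n + 2.
  have [mE|mE] : m = 18 \/ m = 27 by clear - m1 m2 sp; case: sp; lia.
    exists (2 * k ^+ 2); move: e e'; rewrite mE; clear; lia.
  exists (2 * k ^+ 2 - 1); move: e e'; rewrite mE; clear; lia.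
have [q [r [er r3]]] : exists q r, B V = 3 * q + r /\ (r = 0 \/ r = 1 \/ r = 2).
  by exists (B V %/ 3)%Z, (B V %% 3)%Z; lia.
move: en; rewrite er; case: r3 => [|[]] ->; clear.
- by lia.
- by lia.
by lia.
Qed.

Lemma smallN U : sml (- U) = sml U.
Proof. by rewrite /small naive_heightN. Qed.

Lemma alpha_neq V W : al V != al W -> V != W /\ V != - W.
Proof.
move=> ne; split; apply: contra ne => /eqP ->; first by [].
by rewrite alphaN.
Qed.

(** Either sign suffices because replacing W by - W changes neither [alpha] nor the height. For V =
    W the second condition bounds the height of 2V. *)
Definition compatible V W := (sml (V + W) \/ sml (V - W)) /\
  (t + 1) ^+ 4 * (H (V + W) * H (V - W)) < m ^+ 2.

Lemma compatibleC V W : compatible V W -> compatible W V.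
Proof.
by rewrite /compatible addrC -(opprB W V) smallN naive_heightN.
Qed.

Lemma no_double_pm V W j : V != 0 -> W != 0 -> sml V -> sml W -> compatible V W ->
  al V = 2 * j + 1 -> al W = 2 * al V -> False.
Proof.
move=> V0 W0 sV sW [sU _] ej e2.
have [h1 h2] : V != W /\ V != - W.
  by apply: alpha_neq; apply/eqP => e; have := al_gt0 sV; clear - e e2; lia.
case: sU => sU; first exact: (no_double hm t0 hlow hup V0 W0 h1 h2 sV sW sU ej e2).
apply: (no_double hm t0 hlow hup V0 (W := - W) _ _ _ sV _ sU ej).
- by rewrite oppr_eq0.
- by [].
- by rewrite opprK.
- by rewrite smallN.
by rewrite alphaN.
Qed.

Lemma no_mixed_pm V W : V != 0 -> W != 0 -> al V != al W -> sml V -> sml W -> compatible V W ->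
    (al V %| B V)%Z -> (al W %| B W)%Z -> m = 2 * (al V * al W) ->
    (exists j, al V = 2 * j + 1) -> (exists j, al W = 2 * j + 1) -> False.
Proof.
move=> V0 W0 ne sV sW [sU hh] dV dW em oV oW; have [h1 h2] := alpha_neq ne.
case: sU => sU; first exact: (no_mixed hm t0 hlow hup V0 W0 h1 h2 sV sW sU dV dW em oV oW hh).
have NW : B (- W) = - B W by rewrite pointN (negbTE W0).
apply: (no_mixed hm t0 hlow hup V0 (W := - W) _ _ _ sV _ sU dV).
- by rewrite oppr_eq0.
- by [].
- by rewrite opprK.
- by rewrite smallN.
- by rewrite alphaN NW rpredN.
- by rewrite alphaN.
- exact: oV.
- by rewrite alphaN.
by rewrite opprK [H (V - W) * _]mulrC.
Qed.

Lemma bad_neq0 V : bad_point (al V) (B V) -> V != 0.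
Proof. by case/andP=> _; apply: contraL => /eqP ->. Qed.

Lemma alpha_ge2 V : V != 0 -> sml V -> 2 <= al V.
Proof. by move=> V0 sV; have := al_gt V0 sV; have := t_ge3; clear; lia. Qed.

Lemma dvdz_cancel (x y z : int) : (x %| y)%Z -> (x %| y + z)%Z -> (x %| z)%Z.
Proof. by move=> h1 h2; rewrite -[z](addKr y) addrC; apply: dvdzB. Qed.

(** A shifted form would need V = - W and then [al] to divide al / 2; halves and doubles are
    [no_double_pm], duals [no_mixed_pm], and the special form requires alpha(V) = 2. The point V =
    0, with alpha(V) = 1, is treated apart. *)
Lemma normal_twin V W be be' b' : sml V -> sml W -> compatible V W ->
    (t + 1) ^+ 4 * H (W + W) < m ^+ 2 ->
    tangent (al V) (C V) (B V) be -> tangent (al W) (C W) (B W) be' ->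
    ~~ bad_point (al V) (B V) -> bad_point (al W) (B W) ->
    cusp_twin m (al W) be' (al V) b' -> (al V %| b' - be)%Z -> False.
Proof.
move=> sV sW cVW dbl tV tW nV bW tw db; have W0 := bad_neq0 bW.
have a0 := al_gt0 sV; have a0' := al_gt0 sW; have a2' := alpha_ge2 W0 sW.
have V1 : V = 0 -> al V = 1 by move=> ->; rewrite alpha0.
have dW : (al W %| 2 * B W)%Z by case/andP: bW.
have BW0 : B W != 0 by case/andP: bW => _; rewrite lt_neqAle => /andP[].
case: tw => [h e1 e2 e3|j e1 e2 e3|j e1 e2 e3|j i e1 e2 e3 e4 e5|j e1 e2 e3].
- case: (al_inj sV sW e2) => e; first by move: nV; rewrite e bW.
  have eB : B V = - B W by rewrite e pointN (negbTE W0).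
  have eC : C V = C W by rewrite e pointN.
  have h1 := tangentN tW; rewrite -eB -eC -e2 in h1.
  have h2 := tangent_eq (coprime_alphaC t V) tV h1.
  have h3 := tangent_dvd (coprime_alphaC t W) tW dW; rewrite -e2 in h3.
  have : (al V %| 2 * h)%Z.
    apply: (dvdz_cancel h3); have -> : 2 * be' + 2 * h = (b' - be) + (be - - be') by rewrite e3; ring.
    exact: dvdzD.
  case/dvdzP => k; rewrite e2 e1 => ek; have h0 : h != 0 by clear - a0' e1; lia.
  have : 2 * h * 1 = 2 * h * (2 * k) by rewrite mulr1 [LHS]ek; ring.
  by move/(mulfI (_ : 2 * h != 0)) => /(_ _); clear - h0; lia.
- case: (eqVneq V 0) => [/V1 e|V0].
    by apply: (no_double_zero sW W0 BW0 _ dbl); rewrite e1 e.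
  exact: (no_double_pm V0 W0 sV sW cVW e2 e1).
- have V0 : V != 0 by apply/eqP => /V1 e; move: e2; rewrite e; clear; lia.
  exact: (no_double_pm W0 V0 sW sV (compatibleC cVW) e1 e2).
- have V0 : V != 0.
    apply/eqP => /V1 e; have := al_sqr sW; rewrite e3 e mul1r expr2 ltr_pM2r //.
    by clear - a2'; lia.
  have ne : al V != al W by apply/eqP => e; apply: e5; rewrite e3 e expr2.
  apply: (no_mixed_pm V0 W0 ne sV sW cVW _ _ e3); [| | by exists i | by exists j].
    have dbe : (al V %| be)%Z by move: db; rewrite e4 sub0r rpredN.
    rewrite (_ : B V = be * C V ^+ 3 - (be * C V ^+ 3 - B V)); last by ring.
    by apply: dvdzB => //; exact: dvdz_mulr.
  exact: odd_dvd2 e1 dW.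
have V0 : V != 0 by apply/eqP => /V1 e; move: e2; rewrite e.
by apply: (no_special_two sV V0 e2 sW W0 _ _ e3); [exists j | exact: odd_dvd2 e1 dW].
Qed.

Lemma same_bad V W : sml V -> sml W -> bad_point (al V) (B V) -> bad_point (al W) (B W) ->
  al V = al W -> V = W.
Proof.
move=> sV sW bV bW e; case: (al_inj sV sW e) => // e'; have W0 := bad_neq0 bW.
case/andP: bV => _; case/andP: bW => _; rewrite e' pointN (negbTE W0).
by clear; lia.
Qed.

Lemma lt_mul_sqr (a a' n : int) : 0 < a -> 0 < a' -> a ^+ 2 < n -> a' ^+ 2 < n -> a * a' < n.
Proof.
move=> a0 a0' h h'; have [l|l] := lerP a a'.
  by apply: le_lt_trans h'; rewrite expr2 ler_pM2r.
by apply: le_lt_trans h; rewrite expr2 ler_pM2l // ltW.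
Qed.

Lemma point_form_inj V W X : sml V -> sml W -> compatible V W ->
    (t + 1) ^+ 4 * H (V + V) < m ^+ 2 -> (t + 1) ^+ 4 * H (W + W) < m ^+ 2 ->
    point_form m (al V) (C V) (B V) X -> point_form m (al W) (C W) (B W) X ->
  V = W.
Proof.
move=> sV sW cVW dV dW.
have m0 : 0 < m by apply: lt_trans hlow; rewrite exprn_gt0 //; clear - t0; lia.
(* A reduced form with m <= a'^2 has minimum a', so its class contains no form with a^2 < m. *)
have mixed a b d a' b' d' : 0 < a -> a ^+ 2 < m -> 0 < a' -> `|2 * b'| <= a' -> a' <= d' ->
    m <= a' ^+ 2 -> bqf_class (a', 2 * b', d') = bqf_class (a, 2 * b, d) -> False.
  move=> a0 h a0' b1 d1 h' e; have [h1 _] := reduced_le a0' b1 d1 e.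
  have : a' ^+ 2 <= a ^+ 2 by rewrite lerXn2r ?nnegrE //; exact: ltW.
  by move=> h2; have := lt_le_trans h (le_trans h' h2); rewrite ltxx.
case=> [[a [b [d [be [eX [em a0 am] tV kV]]]]]|[a [b [d [eX em [a0 b1 ad am] bV rV]]]]];
case=> [[a' [b' [d' [be' [eX' [em' a0' am'] tW kW]]]]]|[a' [b' [d' [eX' em' [a0' b1' ad' am'] bW rW]]]]].
- have eq : bqf_class (a, 2 * b, d) = bqf_class (a', 2 * b', d') by rewrite -eX.
  have [ea db] := cusp_class_eq m0 a0 em (lt_mul_sqr a0 a0' am am') eq.
  case: kV => [[nV [ka kb]]|[bV tw]]; case: kW => [[nW [ka' kb']]|[bW tw']].
  + have e : al V = al W by rewrite -ka -ka'.
    case: (al_inj sV sW e) => // e'.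
    case: (eqVneq W 0) => [W0|W0]; first by rewrite e' W0 oppr0.
    have eB : B V = - B W by rewrite e' pointN (negbTE W0).
    have eC : C V = C W by rewrite e' pointN.
    have h1 := tangentN tW; rewrite -eB -eC -e in h1.
    have h2 := tangent_eq (coprime_alphaC t V) tV h1.
    rewrite ka kb kb' in db.
    have h3 : (al V %| 2 * be)%Z.
      have -> : 2 * be = (be - - be') - (be' - be) by ring.
      exact: dvdzB.
    have h4 : (al V %| 2 * B V)%Z.
      rewrite (_ : 2 * B V = 2 * be * C V ^+ 3 - 2 * (be * C V ^+ 3 - B V)); last by ring.
      by apply: dvdzB; [exact: dvdz_mulr | exact: dvdz_mull].
    (* Both B V and B W = - B V pass the divisibility test, so neither of them is negative. *)
    have BV : B V = 0.
      have h5 : (al W %| 2 * B W)%Z by move: h4; rewrite eB e mulrN rpredN.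
      move: nV nW; rewrite /bad_point h4 h5 /= eB; clear; lia.
    by apply: point_eq => //; [rewrite e' pointN | rewrite BV; move: BV; rewrite eB; clear; lia].
  + have twA : cusp_twin m (al W) be' (al V) b' by rewrite -ka -ea.
    have dbA : (al V %| b' - be)%Z by rewrite -ka -kb.
    by case: (normal_twin sV sW cVW dW tV tW nV bW twA dbA).
  + have twB : cusp_twin m (al V) be (al W) b by rewrite -ka' ea.
    have dbB : (al W %| b - be')%Z by rewrite -ka' ea -kb' -opprB rpredN.
    by case: (normal_twin sW sV (compatibleC cVW) dV tW tV nW bV twB dbB).
  rewrite ea in tw'; apply: same_bad => //.
  have V2 := alpha_ge2 (bad_neq0 bV) sV; have W2 := alpha_ge2 (bad_neq0 bW) sW.
  exact: (twin_same_al V2 W2 (al_sqr sV) (al_sqr sW) tw tw').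
- case: (mixed a b d a' b' d' a0 am a0' b1' ad' am'); by rewrite -eX.
- case: (mixed a' b' d' a b d a0' am' a0 b1 ad am); by rewrite -eX.
have eq : bqf_class (a, 2 * b, d) = bqf_class (a', 2 * b', d') by rewrite -eX.
have [h1 h2] := reduced_le a0 b1 ad eq; have [h3 h4] := reduced_le a0' b1' ad' (esym eq).
have ea : a' = a by apply/eqP; rewrite eq_le h1 h3.
have ed : d' = d by apply/eqP; rewrite eq_le h2 // h4.
apply: same_bad => //; apply: (reduced_twin_inj rV); by rewrite -ea -ed.
Qed.

End Injectivity.

(** * Proof of the theorem *)

Section Counting.
Variables (a4 a6 : int) (hE : elliptic a4 a6).
Implicit Types P Q V W T : EC hE.

Lemma card_le_hurwitz (R : realType) (t m : int) (I : finType) (F : I -> EC hE) :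
    m = t ^+ 3 + a4 * t - a6 -> 0 < t -> (t + 1) ^+ 2 < m ->
    4 * m < (t + 1) ^+ 2 * t ^+ 2 ->
    injective F -> (forall i, small t m (F i)) -> (forall i j, compatible t m (F i) (F j)) ->
  #|I|%:R <= hurwitz R (- (4 * m)).
Proof.
move=> hm t0 hlow hup injF sF cF.
have t3 := t_ge3 hE hm t0 hlow hup.
have m4 : 4 < m.
  apply: le_lt_trans hlow; have h : 2 * 2 <= (t + 1) * (t + 1) by apply: ler_pM => //; clear - t3; lia.
  by rewrite expr2.
have form i : {X | [/\ point_form m (alpha t (F i)) (xysqrt (F i)) (ynum (F i)) X,
    bqf_classes (- (4 * m)) X & bqf_class_aut X = 1%N]}.
  apply/cid/point_form_ex => //.
  - exact: (alpha_gt0 hm t0 hlow hup).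
  - exact: (alpha_sqr_lt hm t0 hlow hup).
  - exact: coprime_alphaC.
  by rewrite (alpha_curve hm) dvdz_mulr // dvdzz.
pose G i := sval (form i).
(* Compatibility of a point with itself: the difference is the point at infinity, of height 1. *)
have dbl i : (t + 1) ^+ 4 * naive_height (F i + F i) < m ^+ 2.
  by have [_] := cF i i; rewrite subrr [naive_height (0 : EC hE)]/naive_height /= mulr1.
have injG : injective G.
  move=> i j e; apply: injF.
  have [h1 _ _] := svalP (form i); have [h2 _ _] := svalP (form j).
  rewrite -/(G i) e in h1.
  exact: (point_form_inj hm t0 hlow hup (sF i) (sF j) (cF i j) (dbl i) (dbl j) h1 h2).
pose X := [fset G i | i : I]%fset.
have -> : #|I| = #|` X|.
  by rewrite card_imfset //= -cardE.
apply: hurwitz_ge; first by clear - m4; lia.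
move=> C /imfsetP[i _ ->]; by have [_ h1 h2] := svalP (form i).
Qed.

Lemma torD V W : Etor (V : Ept a4 a6) -> Etor (W : Ept a4 a6) -> Etor (V + W : Ept a4 a6).
Proof.
move=> [n [n0]]; rewrite (EmulE (hE := hE)) => eV [k [k0]]; rewrite (EmulE (hE := hE)) => eW.
exists (n * k)%N; rewrite muln_gt0 n0 k0; split=> //.
have [eV' eW'] : V *+ n = 0 /\ W *+ k = 0 by [].
rewrite (EmulE (hE := hE)); suff -> : (V + W : EC hE) *+ (n * k) = 0 by [].
by rewrite mulrnDl {1}mulrnA eV' mul0rn mulnC mulrnA eW' mul0rn addr0.
Qed.

Lemma torN V : Etor (V : Ept a4 a6) -> Etor (- V : Ept a4 a6).
Proof.
move=> [n [n0]]; rewrite (EmulE (hE := hE)) => eV.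
have eV' : V *+ n = 0 by [].
exists n; split=> //; rewrite (EmulE (hE := hE)); suff -> : (- V : EC hE) *+ n = 0 by [].
by rewrite mulNrn eV' oppr0.
Qed.

Lemma infinite_order_tor P (z : int) : infinite_order (P : Ept a4 a6) ->
  Etor (P *~ z : Ept a4 a6) -> z = 0.
Proof.
move=> hP [n [n0]]; rewrite (EmulE (hE := hE)) => e; apply/eqP; apply: contraT => z0.
case: (hP (`|z| * n)%N); first by rewrite muln_gt0 n0 absz_gt0 z0.
rewrite (EmulE (hE := hE)) mulrnA.
case: z z0 e => k z0 e /=; first by [].
have : P *~ Negz k *+ n = 0 :> EC hE by [].
by rewrite NegzE mulrNz mulNrn => /eqP; rewrite oppr_eq0 => /eqP.
Qed.

End Counting.

(** * From canonical heights to smallness and compatibility *)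

Section HeightConditions.
Variables (R : realType) (a4 a6 : int) (hE : elliptic a4 a6) (t m : int).
Hypotheses (t0 : 0 < t) (m0 : 0 < m).
Implicit Types P Q V W T : EC hE.

Local Notation h := (canonical_height R).
Local Notation w := (weil_height R).
Local Notation dl := (delta a4 a6 R).
Local Notation L := (ln (m%:~R / (t%:~R + 1) ^+ 2 : R)).

Lemma weil_lt (x : int) (c : nat) : 0 < x -> ln (x%:~R : R) < c%:R * L ->
  (t + 1) ^+ (2 * c) * x < m ^+ c.
Proof.
move=> x0 lt.
have t1 : 0 < (t%:~R + 1) ^+ 2 :> R by rewrite exprn_gt0 // addr_gt0 // ltr0z.
have q0 : 0 < m%:~R / (t%:~R + 1) ^+ 2 :> R by rewrite divr_gt0 // ltr0z.
move: lt; rewrite mulr_natl -lnXn // ltr_ln ?posrE ?exprn_gt0 ?ltr0z //.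
rewrite expr_div_n ltr_pdivlMr; last exact: exprn_gt0.
rewrite -exprM -(ltr_int R).
by rewrite rmorphM !rmorphXn rmorphD /= mulrC.
Qed.

Lemma small_of_height V : 2 * (2 * (h V + dl)) < L -> small t m V.
Proof.
move=> lt; rewrite /small.
have H0 := naive_height_ge1 V.
have x0 : 0 < naive_height V ^+ 2 by rewrite exprn_gt0 // (lt_le_trans _ H0).
have := @weil_lt _ 1 x0; rewrite muln1 expr1 mul1r; apply.
rewrite rmorphXn /= lnXn ?(naive_height_gt0 R V) // -mulr_natl.
have hw := weil_height_le R V.
apply: le_lt_trans lt; rewrite -[ln _]/(w V); lra.
Qed.

(** By the parallelogram law, the Weil heights of V + W and V - W add up to at most 4 (h V + h W +
    delta), although each of them alone may be large. *)
Lemma compatible_of_height V W : small t m (V + W) \/ small t m (V - W) ->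
    4 * (h V + h W + dl) < 2 * L -> compatible t m V W.
Proof.
move=> sm lt; split=> //.
have H0 := naive_height_ge1 (V + W); have H1 := naive_height_ge1 (V - W).
have x0 : 0 < naive_height (V + W) by apply: lt_le_trans H0.
have x1 : 0 < naive_height (V - W) by apply: lt_le_trans H1.
apply: (@weil_lt _ 2); first exact: mulr_gt0.
rewrite rmorphM /= lnM ?posrE ?ltr0z //.
have e := canonical_heightD R V W.
have h1 := weil_height_le R (V + W); have h2 := weil_height_le R (V - W).
apply: le_lt_trans lt; rewrite -[ln _]/(w (V + W)) -[X in _ + X <= _]/(w (V - W)); lra.
Qed.

End HeightConditions.

Theorem theorem1p1 (R : realType) (a4 a6 : int)
    (hE : elliptic a4 a6)
    (hrank : rank_ge a4 a6 1)
    (P : Ept a4 a6) (hP : infinite_order P)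
    (t : int) (ht : 0 < t)
    (hlow : 4 * (t%:~R + 1) ^+ 2 * expR (4 * delta a4 a6 R)
            < (Ediscr a4 a6 t)%:~R)
    (hup : Ediscr a4 a6 t < (t + 1) ^+ 2 * t ^+ 2) :
  canonical_height R P >=
    (card_tor a4 a6)%:R ^+ 2
    / (hurwitz R (- Ediscr a4 a6 t) + (card_tor a4 a6)%:R) ^+ 2
    * TE a4 a6 R (Ediscr a4 a6 t) t.
Proof.
pose Q : EC hE := P; have h0 := canonical_height_ge0 R Q; rewrite -[P]/Q.
pose m := t ^+ 3 + a4 * t - a6; have eD : Ediscr a4 a6 t = 4 * m by [].
have t1 : 0 < (t%:~R + 1) ^+ 2 :> R by rewrite exprn_gt0 // addr_gt0 // ltr0z.
have dl0 := delta_ge0 R hE.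
have lowR : (t%:~R + 1) ^+ 2 * expR (4 * delta a4 a6 R) < m%:~R.
  by rewrite -(ltr_pM2l (_ : 0 < 4)) // mulrA (lt_le_trans hlow) // eD rmorphM.
have low : (t + 1) ^+ 2 < m.
  rewrite -(ltr_int R) rmorphXn rmorphD /=; apply: le_lt_trans lowR.
  rewrite ler_peMr ?(ltW t1) //; apply: le_trans (expR_ge1Dx _).
  by rewrite lerDl mulr_ge0.
have m0 : 0 < m by apply: lt_trans low; rewrite exprn_gt0 // addr_gt0.
have hurw0 : 0 <= hurwitz R (- Ediscr a4 a6 t).
  have := @hurwitz_ge R (- Ediscr a4 a6 t) fset0; rewrite cardfs0; apply.
    by rewrite eD oppr_lt0 mulr_gt0.
  by move=> C; rewrite in_fset0.
(* For an infinite set [fset_set] is empty by default; then [card_tor] is 0 and the bound reads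
   0. *)
have [fT|nT] := pselect (finite_set (@Etor a4 a6)); last first.
  by rewrite /card_tor /fset_set; case: pselect => // _; rewrite cardfs0 expr0n /= !mul0r.
pose L : R := ln (m%:~R / (t%:~R + 1) ^+ 2).
have eT : TE a4 a6 R (Ediscr a4 a6 t) t = L - 4 * delta a4 a6 R.
  rewrite /TE eD rmorphM /=; congr (ln _ - _).
  by rewrite -mulf_div divff ?mul1r.
rewrite eT; set TT := card_tor a4 a6; set HH := hurwitz _ _ in hurw0 *.
have T0 : 0 < TT%:R :> R.
  rewrite ltr0n /TT /card_tor cardfs_gt0; apply/fset0Pn; exists (0 : EC hE).
  by rewrite in_fset_set //; apply/mem_set; exists 1%N; split=> //; rewrite (EmulE (hE := hE)).
rewrite leNgt; apply/negP => lt.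
pose x := HH / TT%:R.
have x0 : 0 <= x by rewrite divr_ge0 // ltW.
have {}lt : (x + 1) ^+ 2 * canonical_height R Q < L - 4 * delta a4 a6 R.
  have d0 : 0 < (x + 1) ^+ 2 by rewrite exprn_gt0 //; lra.
  rewrite mulrC -ltr_pdivlMr //; apply: lt_le_trans lt _.
  rewrite le_eqVlt; apply/orP; left; apply/eqP; rewrite /x; field.
  by rewrite !gt_eqF //; lra.
(* The first inequality gives 4 N^2 <= (x + 1)^2, which keeps the points small; the second is 2 N +
   1 > x, which makes them too many. *)
have [N N1 N2] : exists2 N : nat, N%:R <= (x + 1) / 2 & (x + 1) / 2 < N%:R + 1 :> R.
  exists (Num.truncn ((x + 1) / 2)).
    by rewrite truncn_le //; lra.
  by rewrite natr1; apply: truncnS_gt.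
have hN : 4 * (N%:R ^+ 2 * canonical_height R Q) < L - 4 * delta a4 a6 R.
  apply: le_lt_trans lt; rewrite mulrA ler_wpM2r //.
  have : N%:R ^+ 2 <= ((x + 1) / 2) ^+ 2 :> R by rewrite lerXn2r ?nnegrE //; lra.
  by lra.
pose I : finType := ('I_(N + N).+1 * fset_set (@Etor a4 a6))%type.
pose idx (i : I) : int := (i.1 : nat)%:Z - N%:Z.
pose F (i : I) : EC hE := Q *~ idx i + (val i.2 : EC hE).
have idx_le i : `|idx i| <= N%:Z by rewrite /idx; move: (ltn_ord i.1); clear; lia.
have tor (i : I) : Etor (val i.2) by have := valP i.2; rewrite in_fset_set // => /set_mem.
have sm (n : int) (S : EC hE) : `|n| <= N%:Z -> Etor (S : Ept a4 a6) ->
    canonical_height R (Q *~ n + S) <= N%:R ^+ 2 * canonical_height R Q.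
  move=> nN tS; rewrite canonical_height_torsion // canonical_heightMz ler_wpM2r //.
  by rewrite -(real_normK (num_real n%:~R)) lerXn2r ?nnegrE // -intr_norm pmulrn ler_int.
have smV n S : `|n| <= N%:Z -> Etor (S : Ept a4 a6) -> small t m (Q *~ n + S).
  move=> nN tS; apply: (small_of_height (R := R)) => //; have := sm n S nN tS; rewrite -/L; lra.
have : (#|I|%:R : R) <= HH.
  rewrite /HH eD; apply: (@card_le_hurwitz _ _ hE R t m I F) => //.
  - move=> i j e; have ei : idx i - idx j = 0.
      apply: (infinite_order_tor (hE := hE) hP).
      suff -> : (P : EC hE) *~ (idx i - idx j) = (val j.2 : EC hE) - (val i.2 : EC hE).
        by apply: torD; [exact: tor | apply: torN; exact: tor].
      rewrite mulrzBr; apply: (addIr (val i.2 : EC hE)).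
      by rewrite subrK addrAC -[P]/Q -/(F i) e /F addrAC subrr add0r.
    have e1 : i.1 = j.1 by apply/val_inj; move: ei; rewrite /idx /=; clear; lia.
    have e2 : i.2 = j.2.
      by apply/val_inj; move: e; rewrite /F /idx e1 => /addrI.
    by case: i e1 e2 {e ei} => i1 i2; case: j => j1 j2 /= -> ->.
  - by move=> i; apply: smV.
  move=> i j; apply: (compatible_of_height (R := R)) => //.
    (* One of the two equals the difference of the absolute values up to sign. *)
    have dec : `|idx i + idx j| <= N%:Z \/ `|idx i - idx j| <= N%:Z.
      by move: (idx_le i) (idx_le j); clear; lia.
    case: dec => hd; [left | right].
      rewrite /F addrACA -mulrzDr; apply: smV => //; apply: torD; exact: tor.
    rewrite /F opprD addrACA -mulrzBr; apply: smV => //; apply: torD; first exact: tor.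
    by apply: torN; exact: tor.
  (* Twice [hN] bounds the two heights together by 2 L - 8 delta, and only 4 delta has to be added
     back. *)
  have h1 := sm _ _ (idx_le i) (tor i); have h2 := sm _ _ (idx_le j) (tor j).
  by rewrite -/(F i) in h1; rewrite -/(F j) in h2; rewrite -/L; lra.
rewrite card_prod card_ord -cardfE -/(card_tor a4 a6) -/TT natrM => hI.
have : (N + N).+1%:R <= x by rewrite ler_pdivlMr.
by rewrite -natr1 natrD; lra.
Qed.
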